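(* Assume $\diamondsuit_{\aleph_1}$. If $M$ is a countable model of PA, then $M$ has an elementary extension $N$ of cardinality $\aleph_1$ such that $E^5_N = E^3_N$; that is, $N$ is 3-o.r.
   Context: All models are models of Peano Arithmetic (PA) in the vocabulary $\{0,1,<,+,\times\}$ which are ordinary, i.e. the standard natural numbers $\mathbb N$ form an initial segment of the model. For a model $N$ and $a\in N$, $N_{<a}=\{c\in N: c<_N a\}$ with the induced order. On $N\setminus\mathbb N$ define: $a\,E^3_N\,b$ iff there is $c\in N$ such that for every $n\in\mathbb N$ we have $c^n<_N a$ and $c^n<_N b$, and moreover $a<_N b\times_N c$ and $b<_N a\times_N c$. Define $a\,E^5_N\,b$ iff some automorphism of the linear order $(N,<_N)$ maps $a$ to $b$. $N$ is called 3-o.r. (order-rigid) if for all $a,b\in N\setminus\mathbb N$, $(N_{<a},<_N)\cong(N_{<b},<_N)$ implies $a\,E^3_N\,b$. *)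

(* Defs.v *)
From mathcomp Require Import all_boot.
From mathcomp Require Import boolp classical_sets functions cardinality.

Set Implicit Arguments.
Unset Strict Implicit.
Unset Printing Implicit Defensive.

Local Open Scope classical_set_scope.
Local Open Scope card_scope.

(* First-order logic with equality in the vocabulary {0, 1, <, +, *}.
   Variables are de Bruijn indices; the remaining connectives are derived
   classically from falsum, implication and universal quantification. *)

Inductive term : Type :=
| tVar of nat
| tZero
| tOne
| tAdd of term & term
| tMul of term & term.

Inductive formula : Type :=
| fFalse
| fEq of term & term
| fLt of term & term
| fImp of formula & formula
| fAll of formula.

Definition fNot (p : formula) : formula := fImp p fFalse.
Definition fAnd (p q : formula) : formula := fNot (fImp p (fNot q)).
Definition fIff (p q : formula) : formula := fAnd (fImp p q) (fImp q p).
Definition fEx (p : formula) : formula := fNot (fAll (fNot p)).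

Fixpoint tsubst (s : nat -> term) (t : term) : term :=
  match t with
  | tVar n => s n
  | tZero => tZero
  | tOne => tOne
  | tAdd t1 t2 => tAdd (tsubst s t1) (tsubst s t2)
  | tMul t1 t2 => tMul (tsubst s t1) (tsubst s t2)
  end.

Definition tshift (t : term) : term := tsubst (fun n => tVar n.+1) t.

Definition sub_up (s : nat -> term) (n : nat) : term :=
  if n is m.+1 then tshift (s m) else tVar 0.

Fixpoint fsubst (s : nat -> term) (p : formula) : formula :=
  match p with
  | fFalse => fFalse
  | fEq t1 t2 => fEq (tsubst s t1) (tsubst s t2)
  | fLt t1 t2 => fLt (tsubst s t1) (tsubst s t2)
  | fImp p1 p2 => fImp (fsubst s p1) (fsubst s p2)
  | fAll p1 => fAll (fsubst (sub_up s) p1)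
  end.

(* [sub0 t] replaces variable 0 by t, and lowers the other variables; [subS]
   replaces variable 0 by its successor, and keeps the other variables. *)
Definition sub0 (t : term) (n : nat) : term := if n is m.+1 then tVar m else t.
Definition subS (n : nat) : term :=
  if n is 0 then tAdd (tVar 0) tOne else tVar n.

Record structure := Structure {
  carrier :> Type;
  zero : carrier;
  one : carrier;
  lt : carrier -> carrier -> Prop;
  add : carrier -> carrier -> carrier;
  mul : carrier -> carrier -> carrier
}.

Definition env_cons (T : Type) (x : T) (e : nat -> T) (n : nat) : T :=
  if n is m.+1 then e m else x.

Fixpoint teval (M : structure) (e : nat -> M) (t : term) : M :=
  match t with
  | tVar n => e n
  | tZero => zero M
  | tOne => one M
  | tAdd t1 t2 => add (teval e t1) (teval e t2)
  | tMul t1 t2 => mul (teval e t1) (teval e t2)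
  end.

Fixpoint sat (M : structure) (e : nat -> M) (p : formula) : Prop :=
  match p with
  | fFalse => False
  | fEq t1 t2 => teval e t1 = teval e t2
  | fLt t1 t2 => lt (teval e t1) (teval e t2)
  | fImp p1 p2 => sat e p1 -> sat e p2
  | fAll p1 => forall x : M, sat (env_cons x e) p1
  end.

(* Axioms are understood through their universal closures, so the free
   variables of the induction formula act as parameters. *)
Inductive PA : formula -> Prop :=
| PA_succ_neq0 : PA (fNot (fEq (tAdd (tVar 0) tOne) tZero))
| PA_succ_inj :
    PA (fImp (fEq (tAdd (tVar 0) tOne) (tAdd (tVar 1) tOne))
             (fEq (tVar 0) (tVar 1)))
| PA_add0 : PA (fEq (tAdd (tVar 0) tZero) (tVar 0))
| PA_addS :
    PA (fEq (tAdd (tVar 0) (tAdd (tVar 1) tOne))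
            (tAdd (tAdd (tVar 0) (tVar 1)) tOne))
| PA_mul0 : PA (fEq (tMul (tVar 0) tZero) tZero)
| PA_mulS :
    PA (fEq (tMul (tVar 0) (tAdd (tVar 1) tOne))
            (tAdd (tMul (tVar 0) (tVar 1)) (tVar 0)))
| PA_lt :
    PA (fIff (fLt (tVar 0) (tVar 1))
             (fEx (fEq (tAdd (tVar 1) (tAdd (tVar 0) tOne)) (tVar 2))))
| PA_induction p :
    PA (fImp (fsubst (sub0 tZero) p)
             (fImp (fAll (fImp p (fsubst subS p))) (fAll p))).

Definition PA_model (M : structure) : Prop :=
  forall p, PA p -> forall e : nat -> M, sat e p.

Definition elementary_embedding (M N : structure) (h : M -> N) : Prop :=
  forall p (e : nat -> M), sat e p <-> sat (h \o e) p.

Fixpoint numeral (M : structure) (n : nat) : M :=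
  if n is m.+1 then add (numeral M m) (one M) else zero M.

Definition standard (M : structure) : set M := range (numeral M).

Definition ordinary (M : structure) : Prop :=
  (forall m n : nat, (m < n)%N <-> lt (numeral M m) (numeral M n)) /\
  (forall a b : M, standard b -> lt a b -> standard a).

Fixpoint power (M : structure) (c : M) (n : nat) : M :=
  if n is m.+1 then mul (power c m) c else one M.

Definition below (T : Type) (R : T -> T -> Prop) (a : T) : set T :=
  [set x | R x a].

Definition order_iso (N : structure) (A B : set N) (f : N -> N) : Prop :=
  set_bij A B f /\
  (forall x y, A x -> A y -> (lt x y <-> lt (f x) (f y))).

(* E3 and E5 are only meant for nonstandard arguments. *)
Definition E3 (N : structure) (a b : N) : Prop :=
  exists c : N,
    (forall n : nat, lt (power c n) a /\ lt (power c n) b) /\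
    lt a (mul b c) /\ lt b (mul a c).

Definition E5 (N : structure) (a b : N) : Prop :=
  exists f : N -> N, order_iso setT setT f /\ f a = b.

Definition order_rigid3 (N : structure) : Prop :=
  forall a b : N, ~ standard a -> ~ standard b ->
    (exists f : N -> N, order_iso (below (@lt N) a) (below (@lt N) b) f) ->
    E3 a b.

(* R is a strict well-order of type omega_1. *)
Definition omega1_order (W : Type) (R : W -> W -> Prop) : Prop :=
  [/\ well_founded R,
      (forall x y z, R x y -> R y z -> R x z),
      (forall x y, R x y \/ x = y \/ R y x),
      ~ countable [set: W] &
      (forall x, countable (below R x))].

Definition card_aleph1 (T : Type) : Prop :=
  exists (W : Type) (R : W -> W -> Prop),
    omega1_order R /\ [set: T] #= [set: W].

Section Diamond.
Variables (W : Type) (R : W -> W -> Prop).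

(* The hypotheses on d in [closed_in] say that d is a limit point of C. *)
Definition closed_in (C : set W) : Prop :=
  forall d, (exists x, R x d) ->
    (forall x, R x d -> exists y, [/\ C y, R x y & R y d]) -> C d.

Definition unbounded_in (C : set W) : Prop :=
  forall x, exists y, C y /\ R x y.

Definition stationary (S : set W) : Prop :=
  forall C, closed_in C -> unbounded_in C -> S `&` C !=set0.

Definition diamond_on : Prop :=
  exists A : W -> set W,
    (forall a, A a `<=` below R a) /\
    (forall X : set W, stationary [set a | X `&` below R a = A a]).

End Diamond.

(* Any two orders of type omega_1 are isomorphic, so the choice of R does not
   matter. *)
Definition diamond_aleph1 : Prop :=
  exists (W : Type) (R : W -> W -> Prop), omega1_order R /\ diamond_on R.

(* Main.v *)
Require Import Defs.
From HB Require Import structures.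
From Stdlib Require Import Ring_theory Ring.
From mathcomp Require Import all_boot all_order all_algebra.
From mathcomp Require Import boolp classical_sets functions cardinality.
Import Defs.

(** If [c] witnesses [E3 a b], let [I] be the cut of the elements below some
    standard power of [c].  Multiplication by [b / a] induces an automorphism of
    the order of the classes modulo [I], because [I] is closed under
    multiplication by [c]; translating every class rigidly along this map gives
    an automorphism of the order sending [a] to [b].

    For rigidity, [N] is the union of a chain of countable models indexed by
    omega_1.  Each one is a definable ultrapower of the union [K] of its
    predecessors, by a generic ultrafilter on the definable sets of [K].  Given an
    increasing map [F] of [[0, a]] into [[0, F a]] guessed by diamond, with
    [a < F a] and not [E3 a (F a)], the new element [y] is such that the cut
    [{x | F x < y}] is filled neither now nor later, so that [F] does not extend
    to an isomorphism onto the elements below [F a].  The conditions are the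
    definable sets [Y] contained in [[F d, F (d + s))] whose cardinality, computed
    in [K], is infinitely larger than [s * P], where [P] is nonstandard and
    [s <= P ^ k] with [k] standard.
    - An omitted cut remains omitted: halve [Y] at the median of a definable
      function [g].
    - The cut of [y] is not filled by [g y]: either some [x] separates [g y] from
      it for many [y] in [Y], or [x |-> |{y in Y | g y <= x}|] is a definable
      approximation of the undefinable [x |-> |{y in Y | y < F x}|].  In the latter
      case the pigeonhole principle, which is not available for [F], applies to the
      approximation, and yields a subinterval of [[d, d + s)] of length about
      [s / P] with an almost unchanged ratio between the size of [Y] and the
      length.  As [s <= P ^ k], this happens at most [k] times. *)

Set Implicit Arguments.
Unset Strict Implicit.
Unset Printing Implicit Defensive.

(** * Substitution, renaming and the finite support of formulas *)

Lemma teval_subst (K : structure) (e : nat -> K) s t :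
  teval e (tsubst s t) = teval (fun n => teval e (s n)) t.
Proof. by elim: t => //= t1 -> t2 ->. Qed.

Lemma sat_subst (K : structure) p (e : nat -> K) s :
  sat e (fsubst s p) <-> sat (fun n => teval e (s n)) p.
Proof.
elim: p e s => [|t1 t2|t1 t2|p IHp q IHq|p IHp] e s //=; rewrite ?teval_subst //.
  by split=> pq /IHp /pq /IHq.
suff E x : (fun n => teval (env_cons x e) (sub_up s n)) =
           env_cons x (fun n => teval e (s n)).
  by split=> H x; move: (H x); rewrite IHp E.
by apply/funext => -[|n] //=; rewrite /tshift teval_subst.
Qed.

Definition ren (f : nat -> nat) (p : formula) := fsubst (fun i => tVar (f i)) p.

Lemma sat_ren (K : structure) p (e : nat -> K) f :
  sat e (ren f p) <-> sat (fun i => e (f i)) p.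
Proof. exact: sat_subst. Qed.

Lemma teval_local (t : term) : exists n, forall (K : structure) (e e' : nat -> K),
  (forall i, i < n -> e i = e' i) -> teval e t = teval e' t.
Proof.
elim: t => [i|||t1 [n1 H1] t2 [n2 H2]|t1 [n1 H1] t2 [n2 H2]].
- by exists i.+1 => K e e'; apply.
- by exists 0.
- by exists 0.
- exists (maxn n1 n2) => K e e' H /=; congr add; [apply: H1|apply: H2] => i Hi;
    by apply: H; rewrite leq_max Hi ?orbT.
- exists (maxn n1 n2) => K e e' H /=; congr mul; [apply: H1|apply: H2] => i Hi;
    by apply: H; rewrite leq_max Hi ?orbT.
Qed.

(** A formula mentions finitely many variables, and the bound is uniform in the structure. Infinite
    assignments thereby reduce to finitely many values, in enumerations, ultrapowers and directed
    unions. *)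
Lemma sat_local (p : formula) : exists n, forall (K : structure) (e e' : nat -> K),
  (forall i, i < n -> e i = e' i) -> (sat e p <-> sat e' p).
Proof.
elim: p => [|t1 t2|t1 t2|p [n1 H1] q [n2 H2]|p [n H]].
- by exists 0.
- have [n1 H1] := teval_local t1; have [n2 H2] := teval_local t2.
  exists (maxn n1 n2) => K e e' H /=; rewrite (H1 _ e e') ?(H2 _ e e') // => i Hi;
    by apply: H; rewrite leq_max Hi ?orbT.
- have [n1 H1] := teval_local t1; have [n2 H2] := teval_local t2.
  exists (maxn n1 n2) => K e e' H /=; rewrite (H1 _ e e') ?(H2 _ e e') // => i Hi;
    by apply: H; rewrite leq_max Hi ?orbT.
- exists (maxn n1 n2) => K e e' H /=; rewrite (H1 _ e e') ?(H2 _ e e') // => i Hi;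
    by apply: H; rewrite leq_max Hi ?orbT.
- exists n => K e e' E /=.
  have E' x : sat (env_cons x e) p <-> sat (env_cons x e') p.
    by apply: H => -[|i] //= Hi; apply: E; apply: ltnW.
  by split=> H' x; apply/E'.
Qed.

(** * Definability with parameters *)

Section Definability.
Variable K : structure.
Implicit Types (S : (nat -> K) -> Prop) (t : (nat -> K) -> K).

Definition inter (e r : nat -> K) (i : nat) : K :=
  if odd i then r i./2 else e i./2.

(* Even variables are the arguments, odd variables hold the parameters. *)
Definition Def S := exists p (r : nat -> K), forall e, S e <-> sat (inter e r) p.

Lemma Def_ext S S' : (forall e, S e <-> S' e) -> Def S -> Def S'.
Proof. by move=> E [p [r H]]; exists p, r => e; rewrite -E. Qed.

Lemma Def_prop (P : Prop) : Def (fun=> P).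
Proof.
case: (pselect P) => HP.
  by exists (fNot fFalse), (fun=> zero K) => e; split=> //= _.
by exists fFalse, (fun=> zero K).
Qed.

Lemma parity i : (exists k, i = k.*2) \/ (exists k, i = k.*2.+1).
Proof.
case H: (odd i); [right|left]; exists i./2; by rewrite -{1}(odd_double_half i) H.
Qed.

Lemma if_odd T (x y : T) k : (if odd k.*2.+1 then x else y) = x.
Proof. by rewrite /= odd_double. Qed.

Lemma inter_even e r k : inter e r k.*2 = e k.
Proof. by rewrite /inter odd_double doubleK. Qed.

Lemma inter_odd e r k : inter e r k.*2.+1 = r k.
Proof. by rewrite /inter /= odd_double /= uphalf_double. Qed.

Lemma Def_imp S1 S2 : Def S1 -> Def S2 -> Def (fun e => S1 e -> S2 e).
Proof.
move=> [p1 [r1 H1]] [p2 [r2 H2]].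
(* The two parameter sequences are interleaved: parameter [k] of [p1] moves to variable 4k+1 and
   parameter [k] of [p2] to variable 4k+3, while the arguments stay in place. *)
pose f1 i := if odd i then i./2.*2.*2.+1 else i.
pose f2 i := if odd i then i./2.*2.+1.*2.+1 else i.
exists (fImp (ren f1 p1) (ren f2 p2)), (inter r1 r2) => e /=.
rewrite H1 H2 !sat_ren.
have -> : (fun i => inter e (inter r1 r2) (f1 i)) = inter e r1.
  apply/funext => i; case: (parity i) => -[k ->]; rewrite /f1.
    by rewrite odd_double !inter_even.
  by rewrite if_odd !inter_odd inter_even [_./2]uphalf_double.
have -> : (fun i => inter e (inter r1 r2) (f2 i)) = inter e r2.
  apply/funext => i; case: (parity i) => -[k ->]; rewrite /f2.
    by rewrite odd_double !inter_even.
  by rewrite if_odd !inter_odd [_./2]uphalf_double.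
by [].
Qed.

Lemma Def_all (S : K -> (nat -> K) -> Prop) :
  Def (fun e => S (e 0) (fun i => e i.+1)) -> Def (fun e => forall x, S x e).
Proof.
move=> [p [r H]].
(* The quantifier puts its variable in front of the interleaved assignment: parameter variables move
   up by one, and the argument variable 2k+2 becomes 2k+1. *)
pose f i := if i is 0 then 0 else if odd i then i.+1 else i.-1.
exists (fAll (ren f p)), r => e /=.
suff E x : sat (env_cons x (inter e r)) (ren f p) <-> S x e.
  by split=> H' x; move: (H' x); rewrite E.
rewrite sat_ren -(_ : S (env_cons x e 0) (fun i => env_cons x e i.+1) <-> S x e) //.
rewrite H.
suff -> : (fun i => env_cons x (inter e r) (f i)) = inter (env_cons x e) r by [].
apply/funext => i; case: (parity i) => -[k ->]; last first.
  by rewrite /f if_odd /= !inter_odd.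
rewrite inter_even /f odd_double; case: k => [//|k].
by rewrite doubleS /= inter_even.
Qed.

Lemma Def_ren f S : Def S -> Def (fun e => S (fun i => e (f i))).
Proof.
move=> [p [r H]]; pose g i := if odd i then i else (f i./2).*2.
exists (ren g p), r => e; rewrite H sat_ren.
suff -> : (fun i => inter e r (g i)) = inter (fun i => e (f i)) r by [].
apply/funext => i; case: (parity i) => -[k ->]; rewrite /g.
  by rewrite odd_double doubleK !inter_even.
by rewrite if_odd !inter_odd.
Qed.

(** All arguments but the first become parameters, so that an instance of a definable family is a
    definable set. *)
Lemma Def_fix (e0 : nat -> K) S :
  Def S -> Def (fun e => S (env_cons (e 0) e0)).
Proof.
move=> [p [r H]].
pose f i := if odd i then i./2.*2.+1.*2.+1 else
  if i./2 is j.+1 then j.*2.*2.+1 else 0.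
exists (ren f p), (inter e0 r) => e; rewrite H sat_ren.
suff -> : (fun i => inter e (inter e0 r) (f i)) = inter (env_cons (e 0) e0) r by [].
apply/funext => i; case: (parity i) => -[k ->]; rewrite /f.
  by rewrite odd_double doubleK inter_even; case: k => [|k]; rewrite ?inter_odd ?inter_even.
by rewrite if_odd !inter_odd [_./2]uphalf_double.
Qed.

Lemma Def_not S : Def S -> Def (fun e => ~ S e).
Proof. by move=> H; apply: Def_imp => //; apply: Def_prop. Qed.

Lemma Def_or S1 S2 : Def S1 -> Def S2 -> Def (fun e => S1 e \/ S2 e).
Proof.
move=> H1 H2; apply: (@Def_ext (fun e => ~ S1 e -> S2 e)).
  move=> e; split=> [H|[]//]; case: (pselect (S1 e)) => H'; first by left.
  by right; apply: H.
by apply: Def_imp => //; apply: Def_not.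
Qed.

Lemma Def_and S1 S2 : Def S1 -> Def S2 -> Def (fun e => S1 e /\ S2 e).
Proof.
move=> H1 H2; apply: (@Def_ext (fun e => ~ (S1 e -> ~ S2 e))).
  move=> e; split=> [H|[h1 h2] /(_ h1)//]; split.
    by apply: contrapT => H'; apply: H.
  by apply: contrapT => H'; apply: H.
by apply: Def_not; apply: Def_imp => //; apply: Def_not.
Qed.

Lemma Def_iff S1 S2 : Def S1 -> Def S2 -> Def (fun e => S1 e <-> S2 e).
Proof. by move=> H1 H2; apply: Def_and; apply: Def_imp. Qed.

Lemma Def_ex (S : K -> (nat -> K) -> Prop) :
  Def (fun e => S (e 0) (fun i => e i.+1)) -> Def (fun e => exists x, S x e).
Proof.
move=> H; apply: (@Def_ext (fun e => ~ forall x, ~ S x e)).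
  move=> e; split=> [H'|[x Hx] /(_ x)//].
  by apply: contrapT => /forallNP.
by apply: Def_not; apply: Def_all; apply: Def_not.
Qed.

Definition DF t := Def (fun e => e 0 = t (fun i => e i.+1)).
Definition D1 (A : K -> Prop) := Def (fun e => A (e 0)).
Definition D2 (A : K -> K -> Prop) := Def (fun e => A (e 0) (e 1)).
Definition D3 (A : K -> K -> K -> Prop) := Def (fun e => A (e 0) (e 1) (e 2)).
Definition F1 (f : K -> K) := DF (fun e => f (e 0)).

Lemma Def_comp1 A t : D1 A -> DF t -> Def (fun e => A (t e)).
Proof.
move=> HA Ht; apply: (@Def_ext (fun e => exists x, x = t e /\ A x)).
  by move=> e; split=> [[_ [->]]//|H]; exists (t e).
by apply: Def_ex; apply: Def_and.
Qed.

Lemma Def_comp2 A t1 t2 : D2 A -> DF t1 -> DF t2 -> Def (fun e => A (t1 e) (t2 e)).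
Proof.
move=> HA H1 H2.
apply: (@Def_ext (fun e => exists y x, x = t1 e /\ y = t2 e /\ A x y)).
  by move=> e; split=> [[_ [_ [-> [-> //]]]]|H]; exists (t2 e), (t1 e).
apply: Def_ex; apply: Def_ex; apply: Def_and; last apply: Def_and.
- exact: (Def_ren (fun i => if i is j.+1 then j.+2 else 0) H1).
- exact: (Def_ren S H2).
- exact: HA.
Qed.

Lemma Def_comp3 A t1 t2 t3 : D3 A -> DF t1 -> DF t2 -> DF t3 ->
  Def (fun e => A (t1 e) (t2 e) (t3 e)).
Proof.
move=> HA H1 H2 H3.
apply: (@Def_ext (fun e => exists z y x,
   x = t1 e /\ y = t2 e /\ z = t3 e /\ A x y z)).
  by move=> e; split=> [[_ [_ [_ [-> [-> [-> //]]]]]]|H]; exists (t3 e), (t2 e), (t1 e).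
apply: Def_ex; apply: Def_ex; apply: Def_ex; apply: Def_and; last apply: Def_and;
  last apply: Def_and.
- exact: (Def_ren (fun i => if i is j.+1 then j.+3 else 0) H1).
- exact: (Def_ren (fun i => if i is j.+1 then j.+3 else 1) H2).
- exact: (Def_ren (fun i => if i is j.+1 then j.+3 else 2) H3).
- exact: HA.
Qed.

Lemma Def_atom (p : formula) (s : nat -> nat) :
  Def (fun e => sat (fun i => e (s i)) p).
Proof.
exists (ren (fun i => (s i).*2) p), (fun=> zero K) => e; rewrite sat_ren.
suff -> : (fun i => inter e (fun=> zero K) (s i).*2) = (fun i => e (s i)) by [].
by apply/funext => i; rewrite /inter odd_double doubleK.
Qed.

Lemma Def_const2 (k : K) : D1 (fun x => x = k).
Proof. by exists (fEq (tVar 0) (tVar 1)), (fun=> k) => e. Qed.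

Lemma DF_const k : DF (fun=> k).
Proof. exact: Def_const2. Qed.

Lemma DF_var i : DF (fun e => e i).
Proof. exact: (Def_atom (fEq (tVar 0) (tVar i.+1)) id). Qed.

Lemma Def_eq t1 t2 : DF t1 -> DF t2 -> Def (fun e => t1 e = t2 e).
Proof.
by move=> H1 H2; apply: (@Def_comp2 (fun x y => x = y)) => //;
  exact: (Def_atom (fEq (tVar 0) (tVar 1)) id).
Qed.

Lemma Def_lt t1 t2 : DF t1 -> DF t2 -> Def (fun e => lt (t1 e) (t2 e)).
Proof.
by move=> H1 H2; apply: (@Def_comp2 (fun x y => lt x y)) => //;
  exact: (Def_atom (fLt (tVar 0) (tVar 1)) id).
Qed.

Lemma DF_tail t : DF t -> DF (fun e => t (fun i => e i.+1)).
Proof. by move=> H; exact: (Def_ren (fun i => if i is j.+1 then j.+2 else 0) H). Qed.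

Lemma DF_comp1 f t : F1 f -> DF t -> DF (fun e => f (t e)).
Proof.
move=> Hf Ht; apply: (@Def_comp2 (fun x y => x = f y)) (DF_var 0) (DF_tail Ht).
exact: Hf.
Qed.

Lemma DF_comp2 (f : K -> K -> K) t1 t2 : D3 (fun x y z => x = f y z) ->
  DF t1 -> DF t2 -> DF (fun e => f (t1 e) (t2 e)).
Proof.
move=> Hf H1 H2; exact: (Def_comp3 Hf (DF_var 0) (DF_tail H1) (DF_tail H2)).
Qed.

Lemma DF_add t1 t2 : DF t1 -> DF t2 -> DF (fun e => add (t1 e) (t2 e)).
Proof.
apply: DF_comp2; exact: (Def_atom (fEq (tVar 0) (tAdd (tVar 1) (tVar 2))) id).
Qed.

Lemma DF_mul t1 t2 : DF t1 -> DF t2 -> DF (fun e => mul (t1 e) (t2 e)).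
Proof.
apply: DF_comp2; exact: (Def_atom (fEq (tVar 0) (tMul (tVar 1) (tVar 2))) id).
Qed.

End Definability.

Ltac def1 :=
  cbn beta;
  match goal with
  | |- DF _ => first
    [ assumption
    | apply DF_const | apply DF_var | apply DF_add | apply DF_mul
    | match goal with H : F1 _ |- _ => apply (DF_comp1 H) end ]
  | |- Def _ => first
    [ assumption
    | apply Def_prop
    | match goal with H : D1 _ |- _ => apply (Def_comp1 H) end
    | match goal with H : D2 _ |- _ => apply (Def_comp2 H) end
    | match goal with H : D3 _ |- _ => apply (Def_comp3 H) end
    | apply Def_and | apply Def_or | apply Def_iff | apply Def_imp
    | apply Def_not | apply Def_eq | apply Def_lt
    | apply Def_ex | apply Def_all ]
  end.

Ltac definable := match goal with
  | |- D1 _ => rewrite /D1 | |- D2 _ => rewrite /D2 | |- D3 _ => rewrite /D3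
  | |- F1 _ => rewrite /F1 | _ => idtac end; solve [repeat def1].

(** * Arithmetic in a model of PA *)

Section Arith.
Variables (K : structure) (hK : PA_model K).
Local Notation "x '+k' y" := (@add K x y) (at level 50, left associativity).
Local Notation "x '*k' y" := (@mul K x y) (at level 40, left associativity).
Local Notation "0k" := (zero K).
Local Notation "1k" := (one K).
Implicit Types x y : K.

Lemma PA_ind A : D1 A -> A 0k -> (forall x, A x -> A (x +k 1k)) -> forall x, A x.
Proof.
move=> [p [r H]] A0 AS x.
(* All argument variables are merged with the induction variable 0, and the parameters become the
   variables 1, 2, and so on. Nothing is lost, since [A] reads only the first argument. *)
pose q := ren (fun i => if odd i then i./2.+1 else 0) p.
have Hq y : sat (env_cons y r) q <-> A y.
  rewrite /q sat_ren; have /= -> := H (fun=> y).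
  suff -> : (fun i => env_cons y r (if odd i then i./2.+1 else 0)) =
            inter (fun=> y) r by [].
  by apply/funext => i; rewrite /inter; case: (odd i).
have := hK (PA_induction q) r; rewrite /= sat_subst.
have -> : (fun n => teval r (sub0 tZero n)) = env_cons 0k r.
  by apply/funext => -[].
move=> /(_ (iffRL (Hq _) A0)) HI; apply/(Hq x)/HI => y; rewrite sat_subst.
have -> : (fun n => teval (env_cons y r) (subS n)) = env_cons (y +k 1k) r.
  by apply/funext => -[].
by rewrite !Hq //; apply: AS.
Qed.

Definition env2 x y i := if i is 0 then x else (y : K).

Lemma ksucc_neq0 x : x +k 1k <> 0k.
Proof. exact: (hK PA_succ_neq0 (env2 x x)). Qed.

Lemma ksucc_inj x y : x +k 1k = y +k 1k -> x = y.
Proof. exact: (hK PA_succ_inj (env2 x y)). Qed.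

Lemma kadd0 x : x +k 0k = x.
Proof. exact: (hK PA_add0 (env2 x x)). Qed.

Lemma kaddS x y : x +k (y +k 1k) = x +k y +k 1k.
Proof. exact: (hK PA_addS (env2 x y)). Qed.

Lemma kmul0 x : x *k 0k = 0k.
Proof. exact: (hK PA_mul0 (env2 x x)). Qed.

Lemma kmulS x y : x *k (y +k 1k) = x *k y +k x.
Proof. exact: (hK PA_mulS (env2 x y)). Qed.

Lemma klt_def x y : lt x y <-> exists z, x +k (z +k 1k) = y.
Proof.
have := hK PA_lt (env2 x y); rewrite /fIff /fAnd /fNot /fEx /= => H.
split=> [Hl|[z Hz]]; apply: contrapT => H'; apply: H => H1 H2.
  by apply: (H1 Hl) => z Hz; apply: H'; exists z.
by apply/H'/H2 => /(_ z).
Qed.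

Lemma kadd0l x : 0k +k x = x.
Proof.
apply: (PA_ind (A := fun x => 0k +k x = x)) x; first by definable.
  exact: kadd0.
by move=> x; rewrite kaddS => ->.
Qed.

Lemma kaddSl x y : x +k 1k +k y = x +k y +k 1k.
Proof.
apply: (PA_ind (A := fun y => x +k 1k +k y = x +k y +k 1k)) y; first by definable.
  by rewrite !kadd0.
by move=> y; rewrite !kaddS => ->.
Qed.

Lemma kaddC x y : x +k y = y +k x.
Proof.
apply: (PA_ind (A := fun y => x +k y = y +k x)) y; first by definable.
  by rewrite kadd0 kadd0l.
by move=> y; rewrite kaddS kaddSl => ->.
Qed.

Lemma kaddA x y z : x +k (y +k z) = x +k y +k z.
Proof.
apply: (PA_ind (A := fun z => x +k (y +k z) = x +k y +k z)) z; first by definable.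
  by rewrite !kadd0.
by move=> z; rewrite !kaddS => ->.
Qed.

Lemma kaddI x y z : x +k z = y +k z -> x = y.
Proof.
apply: (PA_ind (A := fun z => x +k z = y +k z -> x = y)) z; first by definable.
  by rewrite !kadd0.
by move=> z IH; rewrite !kaddS => /ksucc_inj.
Qed.

Lemma kmul0l x : 0k *k x = 0k.
Proof.
apply: (PA_ind (A := fun x => 0k *k x = 0k)) x; first by definable.
  exact: kmul0.
by move=> x; rewrite kmulS kadd0.
Qed.

Lemma kmulSl x y : (x +k 1k) *k y = x *k y +k y.
Proof.
apply: (PA_ind (A := fun y => (x +k 1k) *k y = x *k y +k y)) y; first by definable.
  by rewrite !kmul0 kadd0.
move=> y IH; rewrite !kmulS IH !kaddS; congr (_ +k _).
by rewrite -!kaddA (kaddC y x).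
Qed.

Lemma kmulC x y : x *k y = y *k x.
Proof.
apply: (PA_ind (A := fun y => x *k y = y *k x)) y; first by definable.
  by rewrite kmul0 kmul0l.
by move=> y; rewrite kmulS kmulSl => ->.
Qed.

Lemma kmulDl x y z : (x +k y) *k z = x *k z +k y *k z.
Proof.
apply: (PA_ind (A := fun z => (x +k y) *k z = x *k z +k y *k z)) z;
  first by definable.
  by rewrite !kmul0 kadd0.
move=> z IH; rewrite !kmulS IH -!kaddA; congr (_ +k _).
by rewrite kaddC -kaddA; congr (_ +k _); rewrite kaddC.
Qed.

Lemma kmulA x y z : x *k (y *k z) = x *k y *k z.
Proof.
apply: (PA_ind (A := fun z => x *k (y *k z) = x *k y *k z)) z; first by definable.
  by rewrite !kmul0.
by move=> z IH; rewrite !kmulS kmulC kmulDl -IH (kmulC x y) (kmulC x (_ *k _)).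
Qed.

Lemma kmul1l x : 1k *k x = x.
Proof. by rewrite -[1k]kadd0l kmulSl kmul0l kadd0l. Qed.

Lemma ksemiring : semi_ring_theory 0k 1k (@add K) (@mul K) (@eq K).
Proof.
by split; [exact: kadd0l|exact: kaddC|exact: kaddA|exact: kmul1l|exact: kmul0l
  |exact: kmulC|exact: kmulA|exact: kmulDl].
Qed.
Add Ring kring : ksemiring.

Lemma kcases x : x = 0k \/ exists y, x = y +k 1k.
Proof.
apply: (PA_ind (A := fun x => x = 0k \/ exists y, x = y +k 1k)) x;
  first by definable.
  by left.
by move=> x _; right; exists x.
Qed.

Lemma kadd_eq0 x y : x +k y = 0k -> x = 0k.
Proof.
case: (kcases y) => [->|[z ->]]; first by rewrite kadd0.
by rewrite kaddS => /ksucc_neq0.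
Qed.

Lemma kmul_eq0 x y : x *k y = 0k -> x = 0k \/ y = 0k.
Proof.
case: (kcases x) => [->|[x' ->]]; first by left.
case: (kcases y) => [->|[y' ->]]; first by right.
by rewrite kmulS kaddS => /ksucc_neq0.
Qed.

(** The order is taken from addition, so that a proof of an inequality yields the difference. *)
Definition kle x y := exists z, x +k z = y.

Lemma kle_total x y : kle x y \/ kle y x.
Proof.
apply: (PA_ind (A := fun x => kle x y \/ kle y x)) x; first by definable.
  by left; exists y; rewrite kadd0l.
move=> x [[z Hz]|[z Hz]]; last by right; exists (z +k 1k); rewrite kaddA Hz.
case: (kcases z) => [z0|[z' z0]]; subst z.
  by right; exists 1k; rewrite -Hz kadd0.
by left; exists z'; rewrite -Hz; ring.
Qed.

(* [lra], [nra] and [ring] do not apply to the semiring [K] itself, only to its ring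
   of differences. *)

Definition zpair := (K * K)%type.
Definition zeqv (p q : zpair) := p.1 +k q.2 = q.1 +k p.2.

Lemma zeqv_trans p q r : zeqv p q -> zeqv q r -> zeqv p r.
Proof.
rewrite /zeqv => H1 H2; apply: (@kaddI _ _ (q.1 +k q.2)).
transitivity ((p.1 +k q.2) +k (q.1 +k r.2)); first by ring.
by rewrite H1 H2; ring.
Qed.

Lemma zeqv_sym p q : zeqv p q -> zeqv q p. Proof. by rewrite /zeqv. Qed.

(** Classes are predicates, so that equality of classes is Leibniz equality. The type carries the
    proof of [PA_model K], on which the ring laws attached to it depend. *)
Definition zk_of (_ : PA_model K) : Type := {C : set zpair | exists p, C = zeqv p}.
Local Notation zk := (zk_of hK).
Definition cls (p : zpair) : zk :=
  exist _ (zeqv p : set zpair) (ex_intro (fun p' => zeqv p = zeqv p') p erefl).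

Lemma cls_eqP p q : cls p = cls q <-> zeqv p q.
Proof.
split=> [/(congr1 sval) /= H|H]; first by rewrite H.
suff E : (zeqv p : set zpair) = zeqv q.
  by apply: eq_exist.
by apply/seteqP; split=> r; [apply: zeqv_trans; apply: zeqv_sym|apply: zeqv_trans].
Qed.

Lemma cls_surj (z : zk) : exists p, z = cls p.
Proof. by case: z => C [p HC]; exists p; apply: eq_exist. Qed.

Definition rep (z : zk) : zpair := sval (cid (cls_surj z)).

Lemma repK (z : zk) : cls (rep z) = z.
Proof. by rewrite /rep; case: cid => p /= ->. Qed.

Lemma rep_cls p : zeqv (rep (cls p)) p.
Proof. by apply/cls_eqP; rewrite repK. Qed.

Definition padd (p q : zpair) : zpair := (p.1 +k q.1, p.2 +k q.2).
Definition pmul (p q : zpair) : zpair :=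
  (p.1 *k q.1 +k p.2 *k q.2, p.1 *k q.2 +k p.2 *k q.1).
Definition zadd (z w : zk) : zk := cls (padd (rep z) (rep w)).
Definition zmul (z w : zk) : zk := cls (pmul (rep z) (rep w)).
Definition zopp (z : zk) : zk := cls ((rep z).2, (rep z).1).

Lemma zaddE p q : zadd (cls p) (cls q) = cls (padd p q).
Proof.
apply/cls_eqP; have := rep_cls p; have := rep_cls q.
move: (rep _) (rep _) => p' q'; rewrite /zeqv /= => Hq Hp.
transitivity ((q'.1 +k q.2) +k (p'.1 +k p.2)); first by ring.
by rewrite Hq Hp; ring.
Qed.

Lemma pmul_eqv p p' q : zeqv p p' -> zeqv (pmul p q) (pmul p' q).
Proof.
rewrite /zeqv /= => H.
transitivity ((p.1 +k p'.2) *k q.1 +k (p'.1 +k p.2) *k q.2); first by ring.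
rewrite H; transitivity ((p'.1 +k p.2) *k q.1 +k (p.1 +k p'.2) *k q.2); last by ring.
by rewrite H.
Qed.

Lemma pmulC p q : pmul p q = pmul q p.
Proof. by rewrite /pmul; congr pair; ring. Qed.

Lemma zmulE p q : zmul (cls p) (cls q) = cls (pmul p q).
Proof.
apply/cls_eqP; apply: (zeqv_trans (pmul_eqv _ (rep_cls p))).
by rewrite pmulC (pmulC p); apply: pmul_eqv; apply: rep_cls.
Qed.

Lemma zoppE p : zopp (cls p) = cls (p.2, p.1).
Proof.
apply/cls_eqP; have := rep_cls p; rewrite /zeqv /= => H.
by rewrite kaddC -H kaddC.
Qed.

Definition zinj x : zk := cls (x, 0k).

Ltac zk_ext := repeat match goal with z : zk |- _ =>
    let p := fresh "p" in have [p ->] := cls_surj z; clear z end;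
  rewrite /zinj ?(zaddE, zmulE, zoppE); apply/cls_eqP;
  rewrite /zeqv /padd /pmul /=; ring.

HB.instance Definition _ := gen_eqMixin zk.
HB.instance Definition _ := gen_choiceMixin zk.

Lemma zaddA : associative zadd. Proof. by move=> x y z; zk_ext. Qed.
Lemma zaddC : commutative zadd. Proof. by move=> x y; zk_ext. Qed.
Lemma zadd0 : left_id (zinj 0k) zadd. Proof. by move=> x; zk_ext. Qed.
Lemma zaddN : left_inverse (zinj 0k) zopp zadd. Proof. by move=> x; zk_ext. Qed.
Lemma zmulA : associative zmul. Proof. by move=> x y z; zk_ext. Qed.
Lemma zmulC : commutative zmul. Proof. by move=> x y; zk_ext. Qed.
Lemma zmul1 : left_id (zinj 1k) zmul. Proof. by move=> x; zk_ext. Qed.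
Lemma zmulDl : left_distributive zmul zadd. Proof. by move=> x y z; zk_ext. Qed.

Lemma zinj_inj x y : zinj x = zinj y -> x = y.
Proof. by move/cls_eqP; rewrite /zeqv /= !kadd0. Qed.

Lemma z1_neq0 : zinj 1k != zinj 0k.
Proof.
by apply/eqP => /zinj_inj H; apply: (@ksucc_neq0 0k); rewrite kadd0l.
Qed.

HB.instance Definition _ := GRing.isZmodule.Build zk zaddA zaddC zadd0 zaddN.
HB.instance Definition _ :=
  GRing.Zmodule_isComNzRing.Build zk zmulA zmulC zmul1 zmulDl z1_neq0.

(** An integral domain of the hierarchy comes with an inverse on its units; it is obtained by
    choice, and is the identity elsewhere. *)
Definition zunit : {pred zk} := fun z => `[< exists w, zmul w z = zinj 1k >].
Definition zinv (z : zk) : zk :=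
  if pselect (exists w, zmul w z = zinj 1k) is left H then sval (cid H) else z.

Lemma zmulV : {in zunit, left_inverse (GRing.one zk) zinv *%R}.
Proof.
move=> z /asboolP Hz; rewrite /zinv; case: pselect => // H.
by case: (cid H).
Qed.

Lemma zunitPl (x y : zk) : (y * x = 1)%R -> zunit x.
Proof. by move=> H; apply/asboolP; exists y. Qed.

Lemma zinv_out : {in [predC zunit], zinv =1 id}.
Proof.
move=> z /negP Hz; rewrite /zinv; case: pselect => // H.
by case: Hz; apply/asboolP.
Qed.

HB.instance Definition _ :=
  GRing.ComNzRing_hasMulInverse.Build zk zmulV zunitPl zinv_out.

Lemma zk_cases (z : zk) : exists x, z = zinj x \/ z = zopp (zinj x).
Proof.
have [p ->] := cls_surj z.
case: (kle_total p.1 p.2) => -[x Hx]; exists x; [right|left]; rewrite ?zoppE;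
  apply/cls_eqP; rewrite /zeqv /= -Hx; ring.
Qed.

Lemma zinjM x y : zinj (x *k y) = (zinj x * zinj y)%R.
Proof. by rewrite [RHS]zmulE; apply/cls_eqP; rewrite /zeqv /=; ring. Qed.

Lemma zinjD x y : zinj (x +k y) = (zinj x + zinj y)%R.
Proof. by rewrite [RHS]zaddE; apply/cls_eqP; rewrite /zeqv /=; ring. Qed.

Lemma zinj0 : zinj 0k = 0%R. Proof. by []. Qed.
Lemma zinj1 : zinj 1k = 1%R. Proof. by []. Qed.

Local Open Scope ring_scope.

Lemma zk_integral : GRing.integral_domain_axiom zk.
Proof.
have H0 x y : (zinj x * zinj y = 0)%R -> (zinj x == 0) || (zinj y == 0).
  rewrite -zinjM -zinj0 => /zinj_inj /kmul_eq0 [] ->; by rewrite eqxx ?orbT.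
move=> z w; have [x Hx] := zk_cases z; have [y Hy] := zk_cases w.
have [-> | ->] : z = zinj x \/ z = (- zinj x)%R by exact: Hx.
  have [-> | ->] : w = zinj y \/ w = (- zinj y)%R by exact: Hy.
    exact: H0.
  by rewrite GRing.mulrN GRing.oppr_eq0 => /eqP; rewrite GRing.oppr_eq0 => /eqP /H0.
have [-> | ->] : w = zinj y \/ w = (- zinj y)%R by exact: Hy.
  by rewrite GRing.mulNr GRing.oppr_eq0 => /eqP; rewrite GRing.oppr_eq0 => /eqP /H0.
by rewrite GRing.mulrNN !GRing.oppr_eq0 => /H0.
Qed.

HB.instance Definition _ := GRing.ComUnitRing_isIntegral.Build zk zk_integral.

Definition zle (z w : zk) : bool := `[< exists x, w - z = zinj x >]%R.
Definition zlt (z w : zk) : bool := (w != z) && zle z w.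
Definition znorm (z : zk) : zk := if zle 0%R z then z else (- z)%R.

Lemma zle0P (z : zk) : reflect (exists x, z = zinj x) (zle 0%R z).
Proof. by apply: (iffP (asboolP _)); rewrite GRing.subr0. Qed.

Lemma zle0_add (x y : zk) : zle 0 x -> zle 0 y -> zle 0 (x + y)%R.
Proof.
by move=> /zle0P [a ->] /zle0P [b ->]; apply/zle0P; exists (a +k b); rewrite zinjD.
Qed.

Lemma zle0_mul (x y : zk) : zle 0 x -> zle 0 y -> zle 0 (x * y)%R.
Proof.
by move=> /zle0P [a ->] /zle0P [b ->]; apply/zle0P; exists (a *k b); rewrite zinjM.
Qed.

Lemma zle0N (x : zk) : zle x 0 = zle 0 (- x)%R.
Proof. by rewrite /zle GRing.sub0r GRing.subr0. Qed.

Lemma zle0_anti (x : zk) : zle 0 x -> zle x 0 -> x = 0%R.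
Proof.
rewrite zle0N => /zle0P [a Ha] /zle0P [b Hb]; apply/eqP.
rewrite Ha -zinj0; apply/eqP; congr zinj; apply: (@kadd_eq0 a b).
by apply: zinj_inj; rewrite zinjD -Ha -Hb GRing.subrr.
Qed.

Lemma zsub_ge0 (x y : zk) : zle 0 (y - x)%R = zle x y.
Proof. by rewrite /zle GRing.subr0. Qed.

Lemma zle0_total (x : zk) : zle 0 x || zle x 0.
Proof.
have [a [->|H]] := zk_cases x; apply/orP; [left|right; rewrite zle0N]; apply/zle0P.
  by exists a.
by exists a; rewrite [x]H GRing.opprK.
Qed.

Lemma znormN (x : zk) : znorm (- x)%R = znorm x.
Proof.
rewrite /znorm; have := zle0_total x; rewrite -zle0N => /orP [] H; rewrite H.
  case: ifP => // H'; first by rewrite (zle0_anti H H') GRing.oppr0.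
  by rewrite GRing.opprK.
by case: ifP => // H'; rewrite (zle0_anti H' H) GRing.oppr0.
Qed.

Lemma zge0_norm (x : zk) : zle 0 x -> znorm x = x.
Proof. by rewrite /znorm => ->. Qed.

Lemma zlt_def (x y : zk) : zlt x y = (y != x) && zle x y. Proof. by []. Qed.

HB.instance Definition _ := Num.IntegralDomain_isLeReal.Build zk
  zle0_add zle0_mul zle0_anti zsub_ge0 zle0_total znormN zge0_norm zlt_def.

Lemma zinj_ge0 x : (0 <= zinj x)%R.
Proof. by apply/zle0P; exists x. Qed.


(** The gap of 1 hands the discreteness of the order to linear arithmetic, which reasons in
    arbitrary ordered rings. *)
Lemma zinj_ltE x y : lt x y <-> (zinj x + 1 <= zinj y)%R.
Proof.
rewrite klt_def; split=> [[z <-]|/asboolP [z]].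
  apply/asboolP; exists z; rewrite !zinjD zinj1 GRing.addrA GRing.opprD.
  by rewrite GRing.addrACA GRing.addrN GRing.addr0 GRing.addrC GRing.addKr.
move=> /eqP; rewrite GRing.subr_eq => /eqP H; exists z; apply: zinj_inj.
by rewrite !zinjD H zinj1 GRing.addrCA.
Qed.

Lemma zinj_lt_ltE x y : lt x y <-> (zinj x < zinj y)%R.
Proof.
rewrite zinj_ltE; split=> [|H].
  by apply: Order.POrderTheory.lt_le_trans; rewrite Num.Theory.ltrDl Num.Theory.ltr01.
move: (Order.POrderTheory.ltW H) => /asboolP [z Hz].
case: (kcases z) => [z0|[z' z0]]; subst z.
  by move: H; rewrite -Num.Theory.subr_gt0 Hz Order.POrderTheory.ltxx.
apply/asboolP; exists z'; rewrite GRing.opprD GRing.addrA Hz zinjD zinj1.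
by rewrite GRing.addrK.
Qed.

End Arith.

From mathcomp Require Import ring lra.

(** * Transfer of the order to the ring of differences *)

Section Transfer.
Variables (K : structure) (hK : PA_model K).
Implicit Types x y : K.

Lemma zinj_leE x y : kle x y <-> (zinj hK x <= zinj hK y)%R.
Proof.
split=> [[z <-]|/asboolP [z]]; first by rewrite zinjD Num.Theory.lerDl zinj_ge0.
move=> /eqP; rewrite GRing.subr_eq => /eqP H; exists z; apply: (@zinj_inj _ hK).
by rewrite zinjD H GRing.addrC.
Qed.

Lemma zinj_nltE x y : ~ lt x y <-> (zinj hK y <= zinj hK x)%R.
Proof.
rewrite (zinj_lt_ltE hK); split=> [/negP|H]; first by rewrite -Order.TotalTheory.leNgt.
by apply/negP; rewrite -Order.TotalTheory.leNgt.
Qed.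

Lemma zinj_nleE x y : ~ kle x y <-> (zinj hK y + 1 <= zinj hK x)%R.
Proof.
rewrite -zinj_ltE (zinj_lt_ltE hK) zinj_leE; split=> [/negP|H].
  by rewrite -Order.TotalTheory.ltNge.
by apply/negP; rewrite -Order.TotalTheory.ltNge.
Qed.

End Transfer.

Ltac to_z :=
  repeat match goal with
  | hK : PA_model ?K, H : @lt ?K _ _ |- _ => apply (zinj_ltE hK) in H
  | hK : PA_model ?K, H : ~ @lt ?K _ _ |- _ => apply (zinj_nltE hK) in H
  | hK : PA_model ?K, H : @kle ?K _ _ |- _ => apply (zinj_leE hK) in H
  | hK : PA_model ?K, H : ~ @kle ?K _ _ |- _ => apply (zinj_nleE hK) in H
  | hK : PA_model ?K, H : @eq (carrier ?K) _ _ |- _ => apply (congr1 (zinj hK)) in H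
  end;
  match goal with
  | hK : PA_model ?K |- @lt ?K _ _ => apply (zinj_ltE hK)
  | hK : PA_model ?K |- ~ @lt ?K _ _ => apply (zinj_nltE hK)
  | hK : PA_model ?K |- @kle ?K _ _ => apply (zinj_leE hK)
  | hK : PA_model ?K |- ~ @kle ?K _ _ => apply (zinj_nleE hK)
  | hK : PA_model ?K |- @eq (carrier ?K) _ _ => apply (@zinj_inj _ hK)
  | _ => idtac
  end;
  repeat match goal with
  | |- context [zinj _ (add _ _)] => rewrite zinjD
  | |- context [zinj _ (mul _ _)] => rewrite zinjM
  | |- context [zinj _ (one _)] => rewrite zinj1
  | |- context [zinj _ (zero _)] => rewrite zinj0
  | H : context [zinj _ (add _ _)] |- _ => rewrite zinjD in H
  | H : context [zinj _ (mul _ _)] |- _ => rewrite zinjM in H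
  | H : context [zinj _ (one _)] |- _ => rewrite zinj1 in H
  | H : context [zinj _ (zero _)] |- _ => rewrite zinj0 in H
  end.

Ltac pose_ge0 :=
  let pose1 hK x :=
    lazymatch goal with
    | _ : is_true (0 <= zinj hK x)%R |- _ => fail
    | _ => have := zinj_ge0 hK x; let G := fresh "G" in move=> G
    end in
  repeat match goal with
  | |- context [zinj ?hK ?x] => pose1 hK x
  | _ : context [zinj ?hK ?x] |- _ => pose1 hK x
  end.

(* The arithmetic tactics fail on implications between equations of [K]. *)
Ltac drop_imp := repeat match goal with
  | H : forall _, _ |- _ => clear H
  | H : ~ _ |- _ => clear H
  | H : @eq ?T _ _ |- _ => lazymatch T with zk_of _ => fail | _ => clear H end
  | H : _ \/ _ |- _ => clear H
  | H : _ /\ _ |- _ => clear H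
  end.

Ltac klra := to_z; drop_imp; pose_ge0; lra.
Ltac knra := to_z; drop_imp; pose_ge0; nra.
Ltac kring := to_z; ring.


(** Serves predicates such as [is_cnt], which use a definable family under further quantifiers: its
    argument becomes the term [t], and its parameters are renamed. *)
Lemma Def_family (K : structure) (A : K -> (nat -> K) -> Prop) t f :
  Def (fun e => A (e 0) (fun i => e i.+1)) -> DF t ->
  Def (fun e => A (t e) (fun i => e (f i))).
Proof.
move=> H Ht; apply: (@Def_ext _ (fun e => exists x, x = t e /\ A x (fun i => e (f i)))).
  by move=> e; split=> [[_ [->]]//|H']; exists (t e).
apply: Def_ex; apply: Def_and => //.
exact: (Def_ren (fun i => if i is j.+1 then (f j).+1 else 0) H).
Qed.

(** * Counting bounded definable sets *)

Section Counting.
Variables (K : structure) (hK : PA_model K).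
Local Notation "x '+k' y" := (@add K x y) (at level 50, left associativity).
Local Notation "x '*k' y" := (@mul K x y) (at level 40, left associativity).
Local Notation "0k" := (zero K).
Local Notation "1k" := (one K).
Implicit Types x y : K.

Lemma Def_kle (t1 t2 : (nat -> K) -> K) : DF t1 -> DF t2 ->
  Def (fun e => kle (t1 e) (t2 e)).
Proof. by move=> H1 H2; rewrite /kle; apply: Def_ex; apply: Def_eq; repeat def1;
  apply: DF_tail. Qed.

Lemma kge0 x : kle 0k x. Proof. klra. Qed.

Lemma kle_or_lt x y : kle x y \/ lt y x.
Proof. by case: (pselect (kle x y)) => H; [left|right; klra]. Qed.

Lemma PA_least (A : K -> Prop) : D1 A -> (exists x, A x) ->
  exists x, A x /\ forall y, lt y x -> ~ A y.
Proof.
move=> HA [x Ax]; apply: contrapT => /forallNP H.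
suff H' z : forall y, lt y z -> ~ A y by apply: (H' (x +k 1k) x) => //; klra.
apply: (PA_ind hK (A := fun z => forall y, lt y z -> ~ A y)) z; first by definable.
  by move=> y Hy; exfalso; klra.
move=> z IH y Hy Ay; apply: (H y); split=> // w Hw; apply: IH; klra.
Qed.

Lemma kdiv x y : lt 0k y -> exists q, kle (y *k q) x /\ lt x (y *k (q +k 1k)).
Proof.
move=> Hy; have [] := @PA_least (fun q => lt x (y *k (q +k 1k))).
- by definable.
- by exists x; knra.
- move=> q [Hq Hm]; exists q; split=> //.
  case: (kcases hK q) => [->|[p E]]; first by klra.
  case: (kle_or_lt (y *k (p +k 1k)) x) => [|H]; first by rewrite E.
  by exfalso; apply: (Hm p) => //; klra.
Qed.

Lemma ksqrt x : exists q, kle (q *k q) x /\ lt x ((q +k 1k) *k (q +k 1k)).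
Proof.
have [] := @PA_least (fun q => lt x ((q +k 1k) *k (q +k 1k))).
- by definable.
- by exists x; knra.
- move=> q [Hq Hm]; exists q; split=> //.
  case: (kcases hK q) => [->|[p E]]; first by klra.
  case: (kle_or_lt ((p +k 1k) *k (p +k 1k)) x) => [|H]; first by rewrite E.
  by exfalso; apply: (Hm p) => //; klra.
Qed.

(** * Gödel's coding of finite sets by divisibility *)

Definition dvd x y := exists k, y = x *k k.

Lemma dvd_sub p a b : dvd p (a +k b) -> dvd p a -> dvd p b.
Proof.
move=> [k Hk] [l Hl]; case: (kle_total hK l k) => -[z Hz].
  exists z; move: Hk; rewrite Hl -Hz => Hk; to_z; nra.
exists 0k; move: Hk; rewrite Hl -Hz => Hk; knra.
Qed.

Lemma dvd_mulr p a b : dvd p a -> dvd p (a *k b).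
Proof. by move=> [k ->]; exists (k *k b); kring. Qed.

(** Plays the role of a factorial in the choice of Gödel's moduli. *)
Lemma common_multiple n : exists m, lt 0k m /\
  forall i, lt 0k i -> kle i n -> dvd i m.
Proof.
apply: (PA_ind hK (A := fun n => exists m, lt 0k m /\
  forall i, lt 0k i -> kle i n -> dvd i m)) n.
- by rewrite /dvd /kle; definable.
- by exists 1k; split=> [|i H1 H2]; [klra|exfalso; klra].
- move=> n [m [m0 H]]; exists (m *k (n +k 1k)); split; first by knra.
  move=> i i0 Hi; case: (pselect (i = n +k 1k)) => [->|Hn].
    by exists m; kring.
  apply: dvd_mulr; apply: H => //; apply: contrapT => H'; apply: Hn; klra.
Qed.

(** The moduli of Gödel's beta function. If [m] is a multiple of all positive numbers up to [n],
    those of index at most [n] are pairwise coprime. *)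
Definition modulus m i := 1k +k (i +k 1k) *k m.

Lemma modulus_gt1 m i : lt 0k m -> lt 1k (modulus m i).
Proof. by rewrite /modulus => m0; knra. Qed.

(** The modulus is coprime to [m]: the number x is the difference between x (1 + (i + 1) m) and x m
    (i + 1). *)
Lemma dvd_modulus_mul m i x : dvd (modulus m i) (x *k m) -> dvd (modulus m i) x.
Proof.
move=> H; apply: (@dvd_sub _ (x *k m *k (i +k 1k))); last exact: dvd_mulr.
by exists x; rewrite /modulus; kring.
Qed.

(** Multiplying a code by a modulus adds exactly one index to the coded set. If the indices differ
    by d > 0, then the modulus of j divides c d m; since d divides m, it divides c m m, hence c,
    being coprime to m. *)
Lemma dvd_modulus_ext m n c i j : lt 0k m ->
  (forall i, lt 0k i -> kle i n -> dvd i m) -> kle i n -> kle j n ->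
  dvd (modulus m j) (c *k modulus m i) <-> dvd (modulus m j) c \/ j = i.
Proof.
move=> m0 Hm Hi Hj; split=> [H|[H|->]]; last 2 first.
- exact: dvd_mulr.
- by exists c; kring.
suff H2 d : lt 0k d -> kle d n -> dvd (modulus m j) (c *k d *k m) ->
    dvd (modulus m j) c.
  case: (pselect (j = i)) => E; [by right|left].
  case: (kle_total hK i j) => -[d Hd].
    apply: (H2 d); [|klra|].
      by case: (kcases hK d) => [d0|[d' ->]]; [case: E; rewrite -Hd d0; kring|klra].
    apply: (@dvd_sub _ (c *k modulus m i)) => //; exists c.
    by rewrite /modulus -Hd; kring.
  apply: (H2 d); [|klra|].
    by case: (kcases hK d) => [d0|[d' ->]]; [case: E; rewrite -Hd d0; kring|klra].
  apply: (@dvd_sub _ (c *k modulus m j)); last by exists c; kring.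
  by move: H; congr dvd; rewrite /modulus -Hd; kring.
move=> d0 dn Hd; have [k Hk] := Hm d d0 dn.
apply: (@dvd_modulus_mul m); apply: (@dvd_modulus_mul m).
have -> : c *k m *k m = c *k d *k m *k k by rewrite {1}Hk; kring.
exact: dvd_mulr.
Qed.

(* (c, m, B) codes the set of pairs (i, u), u < B, such that
   1 + (i * B + u + 1) * m divides c. *)
Definition gr c m B i u := lt u B /\ dvd (modulus m (i *k B +k u)) c.

(** The code holds a computation of the counting function of [A] up to [z], with value [v] at [z].
    Demanding only that each pair at [i + 1] comes from a pair at [i] already gives the intermediate
    values and their uniqueness. *)
Definition is_cnt (A : K -> Prop) z v := exists c m B,
  (forall u, gr c m B 0k u -> u = 0k) /\
  (forall i, lt i z -> forall u, gr c m B (i +k 1k) u ->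
     exists w, gr c m B i w /\ ((A i /\ u = w +k 1k) \/ (~ A i /\ u = w))) /\
  gr c m B z v.

Lemma is_cnt_uniq A z v v' : D1 A -> is_cnt A z v -> is_cnt A z v' -> v = v'.
Proof.
move=> HA [c [m [B [H0 [HS Hz]]]]] [c' [m' [B' [H0' [HS' Hz']]]]].
suff H i : kle i z -> forall u u', gr c m B i u -> gr c' m' B' i u' -> u = u'.
  by apply: H Hz Hz'; klra.
apply: (PA_ind hK (A := fun i => kle i z ->
  forall u u', gr c m B i u -> gr c' m' B' i u' -> u = u')) i.
- by rewrite /gr /dvd /modulus /kle; definable.
- by move=> _ u u' /H0 -> /H0' ->.
- move=> i IH Hi u u' Hu Hu'; have iz : lt i z by klra.
  have [w [Hw Ew]] := HS _ iz _ Hu; have [w' [Hw' Ew']] := HS' _ iz _ Hu'.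
  have E : w = w' by apply: IH => //; klra.
  by case: Ew Ew' => -[? ->] [] [? ->]; rewrite ?E.
Qed.

Lemma is_cnt_exists A z : D1 A -> exists v, is_cnt A z v.
Proof.
move=> HA; pose B := z +k 1k.
have [m [m0 Hm]] := common_multiple (z *k B +k z).
(* The numbers [m] and [B] are fixed for all stages, and only the code grows. The last clause says
   that no pair is coded yet at an index above [x] and up to [z], so that the next pair meets no
   older one. *)
pose P x := kle x z -> exists c v,
  ((forall u, gr c m B 0k u -> u = 0k) /\
  (forall i, lt i x -> forall u, gr c m B (i +k 1k) u ->
     exists w, gr c m B i w /\ ((A i /\ u = w +k 1k) \/ (~ A i /\ u = w))) /\
  gr c m B x v) /\
  (kle v x /\ forall i u, kle i z -> gr c m B i u -> kle i x).
suff HP x : P x.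
  have /HP [c [v [H _]]] : kle z z by klra.
  by exists v, c, m, B.
have Hidx i u : kle i z -> lt u B -> kle (i *k B +k u) (z *k B +k z).
  by move=> Hi; rewrite /B => Hu; knra.
have Hinj i u i' u' : lt u B -> lt u' B -> i *k B +k u = i' *k B +k u' ->
    i = i' /\ u = u'.
  move=> Hu Hu' E; have Ei : i = i'.
    apply: contrapT => N; have [] : lt i i' \/ lt i' i.
      case: (kle_or_lt i i') => H; last by right.
      by left; apply: contrapT => H'; apply: N; klra.
    + by move=> H; knra.
    + by move=> H; knra.
  by split=> //; subst i'; klra.
apply: (PA_ind hK (A := P)) x.
- by rewrite /P /gr /dvd /modulus /kle; definable.
- move=> _; exists (1k *k modulus m 0k), 0k.
  have G i u : kle i z -> gr (1k *k modulus m 0k) m B i u -> i = 0k /\ u = 0k.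
    move=> Hi [Hu Hd]; move: Hd; rewrite (dvd_modulus_ext _ m0 Hm); last first.
    + exact: Hidx.
    + exact: kge0.
    case=> [[k]|E]; last by apply: Hinj => //; rewrite ?E /B; klra.
    have := modulus_gt1 (i *k B +k u) m0; move: (modulus _ _) => p p1 E; exfalso.
    by case: (kcases hK k) => [|[l]] El; subst k; [klra|knra].
  have G0 : gr (1k *k modulus m 0k) m B 0k 0k.
    split; first by rewrite /B; klra.
    by exists 1k; rewrite /modulus; kring.
  split; first split; [|split=> //|].
  + by move=> u /G [] //; klra.
  + by move=> i Hi; exfalso; klra.
  + split; first by klra.
    by move=> i u Hi /G [] // -> _; klra.
- move=> x IH Hx; have [|c [v [[H0 [HS Hv]] [vx Hc]]]] := IH; first by klra.
  have [v' [Hv' v'x]] : exists v', ((A x /\ v' = v +k 1k) \/ (~ A x /\ v' = v)) /\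
      kle v' (x +k 1k).
    case: (pselect (A x)) => Ax; [exists (v +k 1k)|exists v]; (split; last by klra).
    + by left.
    + by right.
  pose c' := c *k modulus m ((x +k 1k) *k B +k v').
  have v'B : lt v' B by rewrite /B; klra.
  have G i u : kle i z -> gr c' m B i u <-> gr c m B i u \/ (i = x +k 1k /\ u = v').
    move=> Hi; split=> [[Hu]|[[Hu]|[-> ->]]]; rewrite /gr /c'.
    + rewrite (dvd_modulus_ext _ m0 Hm); [|exact: Hidx..].
      by case=> [Hd|E]; [left|right; apply: Hinj].
    + rewrite (dvd_modulus_ext _ m0 Hm); [|exact: Hidx..].
      by move=> Hd; split=> //; left.
    + split=> //; rewrite (dvd_modulus_ext _ m0 Hm); [|exact: Hidx..].
      by right.
  exists c', v'; split; first split; [|split|].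
  + move=> u /G [|/H0 //|[E _]]; first exact: kge0.
    by exfalso; klra.
  + move=> i Hi u /G [|Hu|[E Eu]]; first by klra.
      have Hi' := Hc _ _ _ Hu; have : kle (i +k 1k) x by apply: Hi'; klra.
      move=> Hix; have [|w [Hw Ew]] := HS i _ u Hu; first by klra.
      by exists w; split=> //; apply/G; [klra|left].
    have Ei : i = x by klra.
    by subst i u; exists v; split=> //; apply/G; [klra|left].
  + by apply/G => //; right.
  + split=> // i u Hi /G [] // => [/Hc H|[-> _]]; last by klra.
    by have H' := H Hi; klra.
Qed.

Definition cnt (A : K -> Prop) z : K :=
  if pselect (exists v, is_cnt A z v) is left H then sval (cid H) else 0k.

Lemma cntP A z : D1 A -> is_cnt A z (cnt A z).
Proof.
by move=> HA; rewrite /cnt; case: pselect => [H|[]]; [case: (cid H)|exact: is_cnt_exists].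
Qed.

Lemma cnt0 A : D1 A -> cnt A 0k = 0k.
Proof. by move=> HA; have [c [m [B [H0 [_ /H0]]]]] := cntP 0k HA. Qed.

Lemma cntS A z : D1 A -> (A z -> cnt A (z +k 1k) = cnt A z +k 1k) /\
  (~ A z -> cnt A (z +k 1k) = cnt A z).
Proof.
move=> HA; have [c [m [B [H0 [HS Hz]]]]] := cntP (z +k 1k) HA.
have [|w [Hw Ew]] := HS z _ _ Hz; first by klra.
have <- : w = cnt A z.
  apply: is_cnt_uniq HA _ (cntP z HA); exists c, m, B; split=> //; split=> //.
  by move=> i Hi; apply: HS; klra.
by case: Ew => -[? ?]; split.
Qed.

(** [is_cnt] is first-order in [A] and determines its value, so cardinalities depend definably on
    the parameters of a family. *)
Lemma DF_cnt (A : K -> (nat -> K) -> Prop) t :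
  Def (fun e => A (e 0) (fun i => e i.+1)) -> DF t ->
  DF (fun e => cnt (fun y => A y e) (t e)).
Proof.
move=> HA Ht.
have Ht2 := DF_tail Ht.
apply: (@Def_ext _ (fun e => is_cnt (fun y => A y (fun i => e i.+1))
   (t (fun i => e i.+1)) (e 0))).
  move=> e; have H1 : D1 (fun y => A y (fun i => e i.+1)).
    exact: (Def_fix (fun i => e i.+1) HA).
  split=> [H|->]; last exact: cntP.
  exact: is_cnt_uniq H1 H (cntP _ H1).
apply: (@Def_ext _ (fun e => exists z, z = t (fun i => e i.+1) /\
   is_cnt (fun y => A y (fun i => e i.+1)) z (e 0))).
  by move=> e; split=> [[_ [-> //]]|H]; exists (t (fun i => e i.+1)).
apply: Def_ex; apply: Def_and; first exact: Ht2.
rewrite /is_cnt /gr /dvd /modulus.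
repeat first [def1 | eapply (Def_family _ HA)].
Qed.

End Counting.

Ltac def2 := first
  [ match goal with |- Def _ => apply Def_kle end
  | match goal with hK : PA_model _ |- DF _ => apply (DF_cnt hK) end
  | def1 ].

Ltac definable ::= match goal with
  | |- D1 _ => rewrite /D1 | |- D2 _ => rewrite /D2 | |- D3 _ => rewrite /D3
  | |- F1 _ => rewrite /F1 | _ => idtac end; solve [repeat def2].

(** * Cardinalities, numerals and nonstandard elements *)

Section CountingLemmas.
Variables (K : structure) (hK : PA_model K).
Local Notation "x '+k' y" := (@add K x y) (at level 50, left associativity).
Local Notation "x '*k' y" := (@mul K x y) (at level 40, left associativity).
Local Notation "0k" := (zero K).
Local Notation "1k" := (one K).
Implicit Types (x y z : K) (A B C : K -> Prop).

Lemma cnt_sub2 A B C z : D1 A -> D1 B -> D1 C ->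
  (forall y, lt y z -> A y -> B y \/ C y) ->
  kle (cnt A z) (cnt B z +k cnt C z).
Proof.
move=> HA HB HC H.
suff Hi i : kle i z -> kle (cnt A i) (cnt B i +k cnt C i) by apply: Hi; klra.
apply: (PA_ind hK (A := fun i => kle i z -> kle (cnt A i) (cnt B i +k cnt C i))) i.
- by definable.
- by move=> _; rewrite !cnt0 //; klra.
- move=> i IH Hi; have {}IH : kle (cnt A i) (cnt B i +k cnt C i) by apply: IH; klra.
  have Hb : kle (cnt B i) (cnt B (i +k 1k)).
    case: (pselect (B i)) => Bi; first by rewrite (cntS hK i HB).1 //; klra.
    by rewrite (cntS hK i HB).2 //; klra.
  have Hc : kle (cnt C i) (cnt C (i +k 1k)).
    case: (pselect (C i)) => Ci; first by rewrite (cntS hK i HC).1 //; klra.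
    by rewrite (cntS hK i HC).2 //; klra.
  case: (pselect (A i)) => Ai; last by rewrite (cntS hK i HA).2 //; klra.
  rewrite (cntS hK i HA).1 //; have [|Bi|Ci] := H i _ Ai; first by klra.
    by move: Hb; rewrite (cntS hK i HB).1 // => Hb; klra.
  by move: Hc; rewrite (cntS hK i HC).1 // => Hc; klra.
Qed.

Lemma cnt_all A z : D1 A -> (forall y, lt y z -> A y) -> cnt A z = z.
Proof.
move=> HA H; suff Hi i : kle i z -> cnt A i = i by apply: Hi; klra.
apply: (PA_ind hK (A := fun i => kle i z -> cnt A i = i)) i.
- by definable.
- by rewrite cnt0.
- move=> i IH Hi; rewrite (cntS hK i HA).1; last by apply: H; klra.
  by rewrite IH //; klra.
Qed.

Lemma cnt_none A z : D1 A -> (forall y, lt y z -> ~ A y) -> cnt A z = 0k.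
Proof.
move=> HA H; suff Hi i : kle i z -> cnt A i = 0k by apply: Hi; klra.
apply: (PA_ind hK (A := fun i => kle i z -> cnt A i = 0k)) i.
- by definable.
- by rewrite cnt0.
- move=> i IH Hi; rewrite (cntS hK i HA).2; last by apply: H; klra.
  by rewrite IH //; klra.
Qed.

Lemma cnt_sub A B z : D1 A -> D1 B -> (forall y, lt y z -> A y -> B y) ->
  kle (cnt A z) (cnt B z).
Proof.
move=> HA HB H; have HF : D1 (fun _ : K => False) by definable.
have H1 := cnt_sub2 HA HB HF (fun y hy Ay => or_introl (H y hy Ay)).
have H2 : cnt (fun _ : K => False) z = 0k by apply: (cnt_none HF) => y _ [].
by rewrite H2 in H1; klra.
Qed.

Lemma cnt_pos A z : D1 A -> lt 0k (cnt A z) -> exists y, lt y z /\ A y.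
Proof.
move=> HA H; apply: contrapT => N; move: H; rewrite cnt_none //; first by move=> ?; klra.
by move=> y yz Ay; apply: N; exists y.
Qed.

Lemma cnt_single k z : kle (cnt (fun y => y = k) z) 1k.
Proof.
have HA : D1 (fun y => y = k) by definable.
suff [] : kle (cnt (fun y => y = k) z) 1k /\
  (kle z k -> cnt (fun y => y = k) z = 0k) by [].
apply: (PA_ind hK (A := fun z => kle (cnt (fun y => y = k) z) 1k /\
  (kle z k -> cnt (fun y => y = k) z = 0k))) z.
- by definable.
- by rewrite cnt0 //; split=> //; klra.
- move=> z [H1 H2]; have [S1 S2] := cntS hK z HA.
  case: (pselect (z = k)) => E; last first.
    by rewrite S2 //; split=> // H; apply: H2; klra.
  rewrite S1 // H2; last by klra.
  by split=> [|H]; [klra|exfalso; klra].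
Qed.

Lemma bounded_image g z : F1 g -> exists v, forall y, lt y z -> kle (g y) v.
Proof.
move=> Hg; apply: (PA_ind hK (A := fun z => exists v, forall y, lt y z -> kle (g y) v)) z.
- by definable.
- by exists 0k => y H; exfalso; klra.
- move=> z [v H]; exists (v +k g z) => y Hy.
  case: (kle_or_lt hK z y) => Hyz; last by have Hv := H y Hyz; klra.
  have -> : y = z by klra.
  by klra.
Qed.

Lemma numeralD m n : numeral K (m + n) = numeral K m +k numeral K n.
Proof.
elim: n => [|n IH]; first by rewrite addn0 /= kadd0.
by rewrite addnS /= IH; kring.
Qed.

Lemma numeralM m n : numeral K (m * n) = numeral K m *k numeral K n.
Proof.
elim: n => [|n IH]; first by rewrite muln0 /= kmul0.
by rewrite mulnS numeralD IH /=; kring.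
Qed.

Lemma lt_numeral n x : lt x (numeral K n) -> exists2 m, (m < n)%N & x = numeral K m.
Proof.
elim: n => [|n IH] /= H; first by exfalso; klra.
case: (pselect (lt x (numeral K n))) => [/IH [m mn ->]|H'].
  by exists m => //; apply: ltnW.
by exists n => //; klra.
Qed.

Lemma numeral_lt m n : (m < n)%N -> lt (numeral K m) (numeral K n).
Proof.
elim: n => // n IH; rewrite ltnS leq_eqVlt => /orP [/eqP ->|/IH H] /=; klra.
Qed.

Lemma PA_ordinary : ordinary K.
Proof.
split=> [m n|a b [n _ <-] /lt_numeral [m _ ->]]; last by exists m.
split=> [|H]; first exact: numeral_lt.
rewrite ltnNge; apply/negP; rewrite leq_eqVlt => /orP [/eqP E|/numeral_lt H'].
  by subst n; klra.
by klra.
Qed.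

Definition nonstd x := forall n, lt (numeral K n) x.

Lemma nonstdP x : ~ standard x <-> nonstd x.
Proof.
split=> [H n|H [n _ E]]; last by have := H n; rewrite E => ?; klra.
apply: contrapT => H'; apply: H.
have /lt_numeral [m _ ->] : lt x (numeral K n.+1) by rewrite /=; klra.
by exists m.
Qed.

Lemma power_le x y n : kle x y -> kle (power x n) (power y n).
Proof. by move=> H; elim: n => [|n IH] /=; [klra|knra]. Qed.

Lemma power_mul x m n : power x (m + n) = power x m *k power x n.
Proof.
elim: n => [|n IH]; first by rewrite addn0 /=; kring.
by rewrite addnS /= IH; kring.
Qed.

Lemma power_pow x m n : power (power x m) n = power x (m * n).
Proof.
elim: n => [|n IH]; first by rewrite muln0.
by rewrite mulnSr power_mul /= IH.
Qed.

(** The quotient of [y] by [x] is infinite. The case n = 0 contains 0 < y. *)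
Definition ll x y := forall n, lt (numeral K n *k x) y.

Lemma ll_scale k x y z : ll x y -> kle y (numeral K k *k z) -> ll x z.
Proof.
move=> H Hz n; have := H (k * n)%N; rewrite numeralM => H1.
by case: (kle_or_lt hK z (numeral K n *k x)) => // H2; exfalso; knra.
Qed.

Lemma ll_le x x' y : kle x' x -> ll x y -> ll x' y.
Proof. by move=> Hx H n; have H1 := H n; knra. Qed.

End CountingLemmas.

(** * Separating a definable function from the new cut *)

Section Killing.
Variables (K : structure) (hK : PA_model K).
Local Notation "x '+k' y" := (@add K x y) (at level 50, left associativity).
Local Notation "x '*k' y" := (@mul K x y) (at level 40, left associativity).
Local Notation "0k" := (zero K).
Local Notation "1k" := (one K).
Implicit Types (x y z : K) (A B C Y : K -> Prop).

Lemma kmul_le x y z : kle x y -> kle (z *k x) (z *k y).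
Proof. by move=> H; knra. Qed.

Lemma kmul_leI x y z : lt 0k z -> kle (z *k x) (z *k y) -> kle x y.
Proof.
move=> z0 H; case: (kle_or_lt hK x y) => // H'; exfalso.
by have := kmul_le z (_ : kle (y +k 1k) x) => /(_ ltac:(klra)) H2; klra.
Qed.

Lemma power_gt0 x n : lt 0k x -> lt 0k (power x n).
Proof. by move=> H; elim: n => [|n IH] /=; [klra|knra]. Qed.

Lemma ll_divide P s t k u : lt 0k P -> ll (s *k P) t ->
  kle t (numeral K k *k P *k u) -> ll s u.
Proof.
move=> P0 H Ht n; case: (kle_or_lt hK u (numeral K n *k s)) => // Hu; exfalso.
have := H (k * n)%N; rewrite (numeralM hK) => H1.
by have H2 := kmul_le (numeral K k *k P) Hu; klra.
Qed.

(** If [G] grows by less than t / R on each window of length [w], it grows by at most i t / R on [i]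
    windows. Multiplying by [R] avoids fractions. *)
Lemma small_increments (G : K -> K) d s w t R : F1 G ->
  (forall x x', kle d x -> kle x x' -> kle x' (x +k w) -> kle x' (d +k s) ->
     lt (R *k G x') (t +k R *k G x)) ->
  forall i x, kle d x -> kle x (d +k s) -> kle x (d +k i *k w) ->
    kle (R *k G x) (R *k G d +k i *k t).
Proof.
move=> HG H i.
apply: (PA_ind hK (A := fun i => forall x, kle d x -> kle x (d +k s) ->
  kle x (d +k i *k w) -> kle (R *k G x) (R *k G d +k i *k t))) i.
- by definable.
- move=> x H1 _ H2; have -> : x = d by klra.
  by klra.
- move=> {}i IH x H1 H2 H3; case: (kle_or_lt hK x (d +k w)) => Hx.
    have H4 : lt (R *k G x) (t +k R *k G d) by apply: H => //; klra.
    by knra.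
  have [z Hz] : kle (d +k w) x by klra.
  have IHz : kle (R *k G (d +k z)) (R *k G d +k i *k t) by apply: IH; klra.
  have H4 : lt (R *k G x) (t +k R *k G (d +k z)) by apply: H; klra.
  by klra.
Qed.

(** [u1] and [u2] bound the errors between a definable count [G] and the true count [H]. Multiplied
    by 2r, which is at most 4P, these errors and the 1 cost at most t/4 + t/4 + t/8, so 2ru keeps at
    least 3t/8. *)
Lemma growth_of_increment t r P G G' H H' u1 u2 u : kle r (P +k P) ->
  lt (numeral K 16 *k P *k u1) t -> lt (numeral K 16 *k P *k u2) t ->
  kle G' (H' +k 1k +k u1) -> kle H (G +k u2) -> kle H' (H +k u) ->
  kle (numeral K 32 *k P) t -> kle (t +k (r +k r) *k G) ((r +k r) *k G') ->
  kle t (numeral K 8 *k r *k u).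
Proof.
move=> rP hA hB h1 h2 h3 h32 h.
have R1 : kle ((r +k r) *k G') ((r +k r) *k (G +k u2 +k u +k 1k +k u1)).
  by apply: kmul_le; clear - hK h1 h2 h3; klra.
have R2 : kle ((u2 +k (u1 +k 1k)) *k r) ((u2 +k (u1 +k 1k)) *k (P +k P)) by exact: kmul_le.
rewrite /= in hA hB h32 *.
by clear - hK R1 R2 hA hB h32 h; klra.
Qed.

(** G is at most t/32 + t/16 and G' is at least t - t/16, so their difference exceeds t/2. *)
Lemma total_increment_big t P G G' u1 u2 : lt 1k P ->
  lt (numeral K 16 *k P *k u1) t -> lt (numeral K 16 *k P *k u2) t ->
  kle G (1k +k u1) -> kle t (G' +k u2) -> kle (numeral K 32 *k P) t ->
  ~ kle (G' +k G') (G +k G +k t).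
Proof.
move=> P1 hA hB h1 h2 h32 h; have P1' : kle 1k P by clear - hK P1; klra.
have A2 := kmul_le (numeral K 16 *k u1) P1'.
have B2 := kmul_le (numeral K 16 *k u2) P1'.
by rewrite /= in hA hB h32 A2 B2; klra.
Qed.

(** The size drops at most by the factor 8r, but the length drops at least by r/2; the ratio changes
    by a standard factor only. *)
Lemma ll_subinterval t r w s s1 P u : ll (s *k P *k P) t ->
  kle t (numeral K 8 *k r *k u) -> kle (w *k r) (s +k s) -> kle s1 w ->
  ll (s1 *k P *k P) u.
Proof.
move=> HL Ht wr sw n.
case: (kle_or_lt hK u (numeral K n *k (s1 *k P *k P))) => // Hc; exfalso.
have H1 := HL (16 * n)%N; rewrite (numeralM hK) in H1.
have H2 := kmul_le (numeral K 8 *k r) Hc.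
have H3 := kmul_le (numeral K 8 *k r *k numeral K n *k P *k P) sw.
have H4 := kmul_le (numeral K 8 *k numeral K n *k P *k P) wr.
have E16 : numeral K 16 = numeral K 8 +k numeral K 8 by rewrite -numeralD.
rewrite E16 in H1; clear - hK H1 H2 H3 H4 Ht.
by move: (numeral K 8) (numeral K n) H1 H2 H3 H4 Ht => c8 cn *; klra.
Qed.

(** [F] is not assumed definable: only its values at single points enter the definition of a set. *)
Variables (F : K -> K) (a : K).
Hypothesis Fmono : forall x y, lt x y -> kle y a -> lt (F x) (F y).
Local Notation size Y := (cnt Y (F a)).

(** The point [x] separates [g y] from the cut [{x | F x < y}], uniformly for [y] in [Y]. *)
Definition killed (g : K -> K) Y := exists x, kle x a /\
  ((forall y, Y y -> kle (g y) x /\ lt (F x) y) \/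
   (forall y, Y y -> kle x (g y) /\ lt y (F x))).

Definition inside Y d s := forall y, Y y -> kle (F d) y /\ lt y (F (d +k s)).

Lemma Fmono_le x y : kle x y -> kle y a -> kle (F x) (F y).
Proof.
move=> H1 H2; case: (pselect (x = y)) => [->|E]; first by klra.
have H3 : lt (F x) (F y); last by klra.
apply: Fmono => //; apply: contrapT => H3; apply: E; klra.
Qed.

Variable g : K -> K.
Hypothesis Hg : F1 g.

(** [sideA Y x] and [sideB Y x] are the largest parts of [Y] on which [x] separates [g y] from the
    cut of [y], in the two possible ways. *)
Definition sideA Y x y := Y y /\ (kle (g y) x /\ lt (F x) y).
Definition sideB Y x y := Y y /\ (kle x (g y) /\ lt y (F x)).

Lemma D1_sideA Y x : D1 Y -> D1 (sideA Y x).
Proof. by move=> HY; rewrite /sideA; definable. Qed.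

Lemma D1_sideB Y x : D1 Y -> D1 (sideB Y x).
Proof. by move=> HY; rewrite /sideB; definable. Qed.

Lemma sideA_killed Y x : kle x a -> killed g (sideA Y x).
Proof. by move=> Hx; exists x; split=> //; left=> y []. Qed.

Lemma sideB_killed Y x : kle x a -> killed g (sideB Y x).
Proof. by move=> Hx; exists x; split=> //; right=> y []. Qed.

Definition kill_goal P Y s := exists d1 s1 Y1,
  [/\ D1 Y1, (forall y, Y1 y -> Y y), kle (d1 +k s1) a, inside Y1 d1 s1 &
   [/\ kle s1 s, ll (s1 *k P) (size Y1) & killed g Y1]].

Lemma kill_goal_side P Y d s Y1 x : D1 Y -> kle (d +k s) a -> inside Y d s ->
  kle x a -> Y1 = sideA Y x \/ Y1 = sideB Y x -> ll (s *k P) (size Y1) ->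
  kill_goal P Y s.
Proof.
move=> HY Hd HI Hx E H; exists d, s, Y1; split=> //.
- by case: E => ->; [exact: D1_sideA|exact: D1_sideB].
- by case: E => -> y [].
- by case: E => -> y [/HI].
- split=> //; first by klra.
  by case: E => ->; [exact: sideA_killed|exact: sideB_killed].
Qed.

(** No element lies between d and d + 1, so every y in Y other than F d is on a side: [sideA] at d
    if g y <= d, and [sideB] at d + 1 otherwise. The larger side has at least a third of [Y]. *)
Lemma kill_unit P Y d : nonstd P -> kle (d +k 1k) a -> D1 Y -> inside Y d 1k ->
  ll (1k *k P *k P) (size Y) -> kill_goal P Y 1k.
Proof.
move=> HP Hd HY HI HL; have P1 : lt 1k P by have := HP 1%N => /= H; klra.
have HA := D1_sideA d HY; have HB := D1_sideB (d +k 1k) HY.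
have HC : D1 (fun y => y = F d) by definable.
have HAB : D1 (fun y => sideA Y d y \/ sideB Y (d +k 1k) y) by definable.
have H1 : kle (size Y) (size (sideA Y d) +k size (sideB Y (d +k 1k)) +k 1k).
  have S1 := cnt_sub2 hK (z := F a) HY HAB HC.
  have S2 := cnt_sub2 hK (z := F a) HAB HA HB (fun y _ => id).
  have S3 := cnt_single hK (F d) (F a).
  suff S4 : kle (size Y) (size (fun y => sideA Y d y \/ sideB Y (d +k 1k) y) +k
     size (fun y => y = F d)) by klra.
  apply: S1 => y _ Yy; have [y1 y2] := HI y Yy.
  case: (pselect (y = F d)) => E; [by right|left].
  case: (kle_or_lt hK (g y) d) => Hgy; [left|right]; split=> //; split=> //; last by klra.
  by apply: contrapT => E'; apply: E; klra.
have HL0 : lt (numeral K 4 *k (1k *k P *k P)) (size Y) := HL 4%N.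
have {}HL0 : lt (numeral K 4) (size Y) by rewrite /= in HL0 *; knra.
rewrite /= in HL0.
have da : kle d a by klra.
case: (kle_total hK (size (sideA Y d)) (size (sideB Y (d +k 1k)))) => Hle.
  apply: (@kill_goal_side P Y d 1k (sideB Y (d +k 1k)) (d +k 1k)) => //; first by right.
  apply: (ll_le hK (x := 1k *k P *k P)); first by knra.
  by apply: (@ll_scale _ hK 3%N) HL _; rewrite /=; klra.
apply: (@kill_goal_side P Y d 1k (sideA Y d) d) => //; first by left.
apply: (ll_le hK (x := 1k *k P *k P)); first by knra.
by apply: (@ll_scale _ hK 3%N) HL _; rewrite /=; klra.
Qed.


(* If neither side is large for any x, then x |-> |{y : g y <= x}| is a definable
   approximation of the undefinable x |-> |{y : y < F x}|; the pigeonhole principle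
   applies to the former, and yields an interval of length w on which F grows fast. *)
Lemma kill_divide P Y d s w : nonstd P -> kle (d +k s) a -> D1 Y -> inside Y d s ->
  ll (s *k P *k P) (size Y) -> lt 0k w -> lt w s -> kle s (w *k P) ->
  kill_goal P Y s \/
  exists x s1 Y1, [/\ D1 Y1, (forall y, Y1 y -> Y y), kle (x +k s1) a, inside Y1 x s1 &
    kle s1 w /\ ll (s1 *k P *k P) (size Y1)].
Proof.
move=> HP Hd HY HI HL w0 ws sw.
have P1 : lt 1k P by have := HP 1%N => /= H; klra.
set t := size Y in HL *.
(* A side of this size is enough: it loses one of the two factors [P] in the hypothesis on
   [size Y]. *)
pose big u := kle t (numeral K 16 *k P *k u).
case: (pselect (exists x Y1, [/\ kle x a, Y1 = sideA Y x \/ Y1 = sideB Y x &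
    big (size Y1)])) => [[x [Y1 [xa E Hbig]]]|Hsmall].
  by left; apply: (kill_goal_side HY Hd HI xa E); apply: (ll_divide _ HL Hbig); klra.
right.
have HA x : kle x a -> lt (numeral K 16 *k P *k size (sideA Y x)) t.
  move=> xa; case: (kle_or_lt hK t (numeral K 16 *k P *k size (sideA Y x))) => // H.
  by exfalso; apply: Hsmall; exists x, (sideA Y x); split=> //; left.
have HB x : kle x a -> lt (numeral K 16 *k P *k size (sideB Y x)) t.
  move=> xa; case: (kle_or_lt hK t (numeral K 16 *k P *k size (sideB Y x))) => // H.
  by exfalso; apply: Hsmall; exists x, (sideB Y x); split=> //; right.
pose G x := size (fun y => Y y /\ kle (g y) x).
pose H x := size (fun y => Y y /\ lt y (F x)).
have DG x : D1 (fun y => Y y /\ kle (g y) x) by definable.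
have DH x : D1 (fun y => Y y /\ lt y (F x)) by definable.
have GH x : kle (G x) (H x +k 1k +k size (sideA Y x)).
  have DA := D1_sideA x HY; have DC : D1 (fun y => y = F x) by definable.
  have DD : D1 (fun y => (Y y /\ lt y (F x)) \/ y = F x).
    exact: Def_or (DH x) DC.
  have S1 := cnt_sub2 hK (z := F a) DD (DH x) DC (fun y _ => id).
  have S2 := cnt_single hK (F x) (F a).
  suff S3 : kle (G x) (size (fun y => (Y y /\ lt y (F x)) \/ y = F x) +k
    size (sideA Y x)) by rewrite /H; klra.
  apply: cnt_sub2 => // y _ [Yy gy]; case: (kle_or_lt hK y (F x)) => Hy; last by right.
  left; case: (pselect (y = F x)) => E; [by right|left; split=> //].
  by apply: contrapT => E'; apply: E; klra.
have HG x : kle (H x) (G x +k size (sideB Y x)).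
  have DB := D1_sideB x HY.
  apply: cnt_sub2 => // y _ [Yy yF]; case: (kle_or_lt hK (g y) x) => Hy; first by left.
  by right; split=> //; split=> //; klra.
have t32 : kle (numeral K 32 *k P) t.
  have H1 := HL 32%N; have s1 : kle 1k s by klra.
  have P1' : kle 1k P by klra.
  have H2 := kmul_le (numeral K 32 *k P) P1'.
  by have H3 := kmul_le (numeral K 32 *k P *k P) s1; klra.
(* With r = r0 + 1, the interval of length [s] is covered by r windows of length [w]; moreover w r
   <= 2s because w < s, and r <= 2P. *)
have [r0 [Hr0 Hr0']] := kdiv hK s w0.
pose r := r0 +k 1k.
have r01 : kle 1k r0.
  case: (kle_or_lt hK 1k r0) => // Hr; exfalso.
  have E : r0 = 0k by klra.
  by rewrite E in Hr0'; klra.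
have rP : kle r (P +k P).
  have : kle r0 P by apply: (kmul_leI w0); klra.
  by rewrite /r => ?; klra.
have wr : kle (w *k r) (s +k s) by rewrite /r; klra.
have r_gt0 : lt 0k r by rewrite /r; klra.
have [x [x' [dx xx' x'x x's Hinc]]] : exists x x', [/\ kle d x, kle x x',
    kle x' (x +k w), kle x' (d +k s) & kle (t +k (r +k r) *k G x) ((r +k r) *k G x')].
  (* Otherwise [G] grows by at most t/2 on the whole interval, although it is close to H d = 0 at
     [d] and close to H (d + s) >= t at the end. *)
  apply: contrapT => N.
  have DFG : F1 G by rewrite /G; definable.
  have Hs : kle ((r +k r) *k G (d +k s)) ((r +k r) *k G d +k r *k t).
    apply: (small_increments DFG (w := w) (s := s)); [|clear - hK; klra|clear - hK; klra|].
      2: by rewrite /r; clear - hK Hr0'; klra.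
    move=> x x' H1 H2 H3 H4.
    case: (kle_or_lt hK (t +k (r +k r) *k G x) ((r +k r) *k G x')) => // H5.
    by exfalso; apply: N; exists x, x'.
  have {}Hs : kle (G (d +k s) +k G (d +k s)) (G d +k G d +k t).
    by apply: (kmul_leI r_gt0); clear - hK Hs; klra.
  have Hd0 : H d = 0k.
    apply: cnt_none => // y _ [Yy yd]; have [yd' _] := HI y Yy; clear - hK yd yd'; klra.
  have Hds : kle t (H (d +k s)).
    by apply: cnt_sub => // y _ Yy; split=> //; have [] := HI y Yy.
  have da : kle d a by clear - hK Hd; klra.
  apply: (total_increment_big P1 (HA d da) (HB (d +k s) Hd) _ _ t32 Hs).
    by have := GH d; rewrite Hd0 kadd0l.
  by have := HG (d +k s); clear - hK Hds => Hds'; klra.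
have [s1 Hs1] := xx'.
pose Y1 y := Y y /\ (kle (F x) y /\ lt y (F x')).
have DY1 : D1 Y1 by rewrite /Y1; definable.
have x'a : kle x' a by clear - hK x's Hd; klra.
have xa : kle x a by clear - hK xx' x'a; klra.
have Hincr : kle (H x') (H x +k size Y1).
  apply: cnt_sub2 => // y _ [Yy y1]; case: (kle_or_lt hK (F x) y) => Hy.
    by right.
  by left; split.
have HY1 : kle t (numeral K 8 *k r *k size Y1).
  exact: (growth_of_increment rP (HA x' x'a) (HB x xa) (GH x') (HG x) Hincr t32 Hinc).
exists x, s1, Y1; split=> //.
- by move=> y [].
- by rewrite Hs1.
- by move=> y [_ []]; rewrite Hs1.
have sw1 : kle s1 w by clear - hK x'x Hs1; klra.
by split=> //; exact: (ll_subinterval HL HY1 wr sw1).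
Qed.

(** Induction on the exponent bounding the length. [kill_divide] with w = P^n either succeeds or
    lowers the exponent by one, and keeps both factors [P] in the ratio. At exponent 0 the length is
    1, or it is 0 and [Y] would be empty. *)
Lemma kill_interval P n : nonstd P -> forall Y d s, kle (d +k s) a -> D1 Y ->
  inside Y d s -> ll (s *k P *k P) (size Y) -> kle s (power P n) -> kill_goal P Y s.
Proof.
move=> HP; have P1 : lt 1k P by have := HP 1%N => /= H; klra.
elim: n => [|n IH] Y d s Hd HY HI HL /= Hs.
  case: (pselect (s = 1k)) => [E|E]; first by subst s; exact: (kill_unit HP Hd HY HI HL).
  have E' : s = 0k.
    apply: contrapT => E'; apply: E.
    by case: (kcases hK s) => [//|[u Hu]]; klra.
  have E0 : size Y = 0k.
    apply: cnt_none => // y _ /HI []; have -> : d +k s = d by klra.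
    by move=> ? ?; klra.
  by exfalso; have H := HL 0%N; rewrite E0 /= in H; klra.
case: (kle_or_lt hK s (power P n)) => Hs'; first exact: (IH Y d s Hd HY HI HL Hs').
have w0 : lt 0k (power P n) by apply: power_gt0; klra.
have [//|[x [s1 [Y1 [DY1 Y1Y xa HI1 [s1w HL1]]]]]] := kill_divide HP Hd HY HI HL w0 Hs' Hs.
have [d2 [s2 [Y2 [? Y21 ? ? [? ? ?]]]]] := IH _ _ _ xa DY1 HI1 HL1 s1w.
exists d2, s2, Y2; split=> //; first by move=> y /Y21 /Y1Y.
by split=> //; klra.
Qed.

End Killing.

(** * Conditions *)

Section Conditions.
Variables (K : structure) (hK : PA_model K).
Local Notation "x '+k' y" := (@add K x y) (at level 50, left associativity).
Local Notation "x '*k' y" := (@mul K x y) (at level 40, left associativity).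
Local Notation "0k" := (zero K).
Local Notation "1k" := (one K).
Implicit Types (x y z : K) (Y L U : K -> Prop).

(** An element filling the cut would lie strictly between [L] and [U]. These sets need not be closed
    downwards or upwards. *)
Definition omits L U := forall z, (exists l, L l /\ kle z l) \/ (exists u, U u /\ kle u z).

Definition decides (g : K -> K) Y L U :=
  (exists l, L l /\ forall y, Y y -> kle (g y) l) \/
  (exists u, U u /\ forall y, Y y -> kle u (g y)).

Definition unbounded Y := D1 Y /\ forall x, exists y, Y y /\ lt x y.

(** Take the least [v] such that g <= v holds unboundedly often in [Y]. If [v] is below the cut,
    keep the points with g <= v; if it is above, keep those with v <= g, which are unbounded by
    minimality. If there is no such [v], then [g] exceeds a given element of [U] unboundedly
    often. *)
Lemma unbounded_decides g Y L U : F1 g -> (exists u, U u) -> omits L U ->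
  unbounded Y -> exists Y', [/\ unbounded Y', (forall y, Y' y -> Y y) & decides g Y' L U].
Proof.
move=> Hg [u0 Hu0] Hom [DY HY].
pose big v := forall x, exists y, (Y y /\ kle (g y) v) /\ lt x y.
case: (pselect (exists v, big v)) => [|N].
  case/(PA_least hK); first by rewrite /big; definable.
  move=> v [Hv Hmin]; case: (Hom v) => [[l [Ll vl]]|[u [Uu uv]]].
    exists (fun y => Y y /\ kle (g y) v); split; [split|by move=> y []|].
    - by definable.
    - exact: Hv.
    - by left; exists l; split=> // y [_ Hy]; klra.
  exists (fun y => Y y /\ kle v (g y)); split; [split|by move=> y []|].
  - by definable.
  - move=> x; case: (kcases hK v) => [v0|[w Hw]].
      have [y [Yy xy]] := HY x; exists y; split=> //; split=> //.
      by rewrite v0; exact: kge0.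
    have /existsNP [x' Hx'] : ~ big w by apply: Hmin; klra.
    have [y [Yy xy]] := HY (x +k x'); exists y; split; last by klra.
    split=> //; case: (kle_or_lt hK v (g y)) => // gv; exfalso.
    by apply: Hx'; exists y; split; [split=> //; klra|klra].
  - by right; exists u; split=> // y [_ Hy]; klra.
exists (fun y => Y y /\ kle u0 (g y)); split; [split|by move=> y []|].
- by definable.
- move=> x; have /existsNP [x' Hx'] : ~ big u0 by move=> H; apply: N; exists u0.
  have [y [Yy xy]] := HY (x +k x'); exists y; split; last by klra.
  split=> //; case: (kle_or_lt hK u0 (g y)) => // gv; exfalso.
  by apply: Hx'; exists y; split; [split=> //; klra|klra].
- by right; exists u0; split=> // y [].
Qed.

Variables (F : K -> K) (a : K).
Local Notation size Y := (cnt Y (F a)).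

Definition fat Y := D1 Y /\ exists d s P k,
  [/\ kle (d +k s) a, inside F Y d s, nonstd P, kle s (power P k) &
      ll (s *k P) (size Y)].

Lemma fat_nonempty Y : fat Y -> exists y, Y y.
Proof.
move=> [DY [d [s [P [k [_ _ _ _ HL]]]]]].
have [|y [_ Yy]] := cnt_pos hK (z := F a) DY; last by exists y.
by have H := HL 0%N; rewrite /= in H; klra.
Qed.

Lemma fat_half Y Y' : fat Y -> D1 Y' -> (forall y, Y' y -> Y y) ->
  kle (size Y) (size Y' +k size Y') -> fat Y'.
Proof.
move=> [DY [d [s [P [k [H1 HI HP Hs HL]]]]]] DY' sub Hle; split=> //.
exists d, s, P, k; split=> //; first by move=> y /sub /HI.
by apply: (@ll_scale _ hK 2%N) HL _; rewrite /=; klra.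
Qed.

(** If [v] is the median of [g] on [Y], then g <= v and v <= g both hold on at least half of [Y].
    The position of [v] relative to the cut tells which half to keep. *)
Lemma fat_decides g Y L U : F1 g -> omits L U -> fat Y ->
  exists Y', [/\ fat Y', (forall y, Y' y -> Y y) & decides g Y' L U].
Proof.
move=> Hg Hom HY; have DY := HY.1.
pose S v := size (fun y => Y y /\ kle (g y) v).
pose half v := kle (size Y) (S v +k S v).
have DS v : D1 (fun y => Y y /\ kle (g y) v) by definable.
have [||v [Hv Hmin]] := @PA_least _ hK half.
- by rewrite /half /S; definable.
- have [v Hv] := bounded_image hK (F a) Hg; exists v.
  have H1 : kle (size Y) (S v); last by rewrite /half; klra.
  by apply: cnt_sub => // y yb Yy; split=> //; apply: Hv.
case: (Hom v) => [[l [Ll vl]]|[u [Uu uv]]].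
  exists (fun y => Y y /\ kle (g y) v); split; [|by move=> y []|].
  - by apply: (fat_half HY) => // y [].
  - by left; exists l; split=> // y [_ Hy]; klra.
have DT : D1 (fun y => Y y /\ kle v (g y)) by definable.
exists (fun y => Y y /\ kle v (g y)); split; [|by move=> y []|].
- apply: (fat_half HY) => // [y []//|].
  case: (kcases hK v) => [v0|[w Hw]].
    have H1 : kle (size Y) (size (fun y => Y y /\ kle v (g y))); last by klra.
    by apply: cnt_sub => // y _ Yy; split=> //; rewrite v0; exact: kge0.
  have H1 : ~ half w by apply: Hmin; klra.
  have H2 : kle (size Y) (S w +k size (fun y => Y y /\ kle v (g y))).
    apply: cnt_sub2 => // y _ Yy; case: (kle_or_lt hK v (g y)) => H; [right|left] => //.
    by split=> //; klra.
  by rewrite /half in H1; klra.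
- by right; exists u; split=> // y [_ Hy]; klra.
Qed.

Lemma nonstd_sqrt P Q : nonstd P -> lt P ((Q +k 1k) *k (Q +k 1k)) -> nonstd Q.
Proof.
move=> HP HQ n; case: (kle_or_lt hK Q (numeral K n)) => // H; exfalso.
have := HP (n.+1 * n.+1)%N; rewrite (numeralM hK) /= => H1; knra.
Qed.

Lemma sqrt_bound P Q : lt 1k Q -> lt P ((Q +k 1k) *k (Q +k 1k)) -> kle P (power Q 4).
Proof.
move=> Q1 H /=; have H1 : kle (Q +k 1k) (Q *k Q) by knra.
have H2 := kmul_le hK (Q +k 1k) H1; have H3 := kmul_le hK (Q *k Q) H1.
by clear - hK H H2 H3; klra.
Qed.

Lemma nonstd_gt1 P : nonstd P -> lt 1k P.
Proof. by move=> HP; have := HP 1%N => /= H; klra. Qed.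

(** The integer square root [Q] of [P] splits the factor [P] into two factors [Q], of which
    [kill_interval] consumes one. The bound s <= P^k becomes s <= Q^(4k). *)
Lemma fat_kill g Y : F1 g -> fat Y ->
  exists Y', [/\ fat Y', (forall y, Y' y -> Y y) & killed F a g Y'].
Proof.
move=> Hg [DY [d [s [P [k [H1 HI HP Hs HL]]]]]].
have [Q [QP PQ]] := ksqrt hK P.
have HQ := nonstd_sqrt HP PQ; have Q1 := nonstd_gt1 HQ.
have sQ : kle s (power Q (4 * k)).
  rewrite -(power_pow hK); have := power_le hK k (sqrt_bound Q1 PQ) => H2; klra.
have HL' : ll (s *k Q *k Q) (size Y).
  by apply: (ll_le hK _ HL); have H2 := kmul_le hK s QP; klra.
have [d1 [s1 [Y1 [D1' sub H1' HI' [s1s HL1 Hk]]]]] :=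
  kill_interval hK Hg HQ H1 DY HI HL' sQ.
exists Y1; split=> //; split=> //; exists d1, s1, Q, (4 * k); split=> //.
by klra.
Qed.

(** Let c = q + 1, where q is the integer quotient of F a by a. If all standard powers of c were
    below a, then c would witness [E3]; hence a <= c^n for some n, and c is nonstandard because a
    is. With P the integer square root of q, the product a P is infinitely smaller than F a. *)
Lemma fat_init : F 0k = 0k -> nonstd a -> lt a (F a) -> ~ E3 a (F a) ->
  fat (fun y => lt y (F a)).
Proof.
move=> F0 Ha ab NE; have a0 : lt 0k a by have := Ha 0%N.
have [q [Hq Hq']] := kdiv hK (F a) a0.
pose c := q +k 1k.
have q1 : kle 1k q.
  case: (kle_or_lt hK 1k q) => // H; exfalso; have E : q = 0k by klra.
  by rewrite E in Hq'; klra.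
have [n Hn] : exists n, ~ (lt (power c n) a /\ lt (power c n) (F a)).
  apply: contrapT => N; apply: NE; exists c; split.
    by move=> n; apply: contrapT => H; apply: N; exists n.
  by split; rewrite /c; [have := kmul_le hK (F a) q1 => ?; klra|klra].
have {}Hn : kle a (power c n).
  case: (kle_or_lt hK a (power c n)) => // H; exfalso; apply: Hn.
  by split=> //; klra.
have Hc : nonstd c.
  apply/(nonstdP hK) => -[m _ Em].
  have [j Ej] : exists j, power c n = numeral K j.
    rewrite -Em; elim: (n) => [|i [j IH]] /=; first by exists 1%N; rewrite /= (kadd0l hK).
    by exists (j * m)%N; rewrite IH (numeralM hK).
  by have := Ha j; rewrite -Ej => ?; klra.
have Nq : nonstd q by move=> m; have := Hc m.+1; rewrite /c /= => ?; klra.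
have [P [Pq qP]] := ksqrt hK q.
have HP := nonstd_sqrt Nq qP; have P1 := nonstd_gt1 HP.
have DY : D1 (fun y => lt y (F a)) by definable.
split=> //; exists 0k, a, P, (6 * n); split=> //.
- by rewrite (kadd0l hK); klra.
- by move=> y Hy; rewrite F0 (kadd0l hK); split=> //; exact: kge0.
- rewrite -(power_pow hK).
  (* Since q <= P^4, one has c = q + 1 <= 2 P^4 <= P^6. *)
  have H2 : kle c (power P 6).
    have H3 := sqrt_bound P1 qP; rewrite /c.
    have -> : power P 6 = power P 4 *k (P *k P) by rewrite /=; kring.
    have H4 : kle (1k +k 1k) (P *k P) by knra.
    have H5 := kmul_le hK (power P 4) H4; clear - hK H3 H5 q1.
    by move: (power P 4) H3 H5 => p4 *; klra.
  by have := power_le hK n H2 => H3; klra.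
- move=> m; rewrite cnt_all //; have H1 := HP m.
  have H2 : kle (numeral K m *k P +k 1k) q by knra.
  have H3 := kmul_le hK a H2; clear - hK H3 Hq a0.
  by move: (numeral K m) H3 => u *; klra.
Qed.

End Conditions.

(** * Countability of the definable functions and generic sequences *)

Section Encoding.
Import GenTree.

Fixpoint tenc (t : term) : tree nat := match t with
  | tVar n => Leaf n | tZero => Node 0 [::] | tOne => Node 1 [::]
  | tAdd a b => Node 2 [:: tenc a; tenc b] | tMul a b => Node 3 [:: tenc a; tenc b]
  end.

Fixpoint tdec (u : tree nat) : term := match u with
  | Leaf n => tVar n
  | Node 1 _ => tOne
  | Node 2 [:: a; b] => tAdd (tdec a) (tdec b)
  | Node 3 [:: a; b] => tMul (tdec a) (tdec b)
  | _ => tZero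
  end.

Lemma tencK : cancel tenc tdec.
Proof. by elim=> //= a -> b ->. Qed.

Fixpoint fenc (p : formula) : tree nat := match p with
  | fFalse => Node 0 [::]
  | fEq a b => Node 1 [:: tenc a; tenc b] | fLt a b => Node 2 [:: tenc a; tenc b]
  | fImp p q => Node 3 [:: fenc p; fenc q] | fAll p => Node 4 [:: fenc p]
  end.

Fixpoint fdec (u : tree nat) : formula := match u with
  | Node 1 [:: a; b] => fEq (tdec a) (tdec b)
  | Node 2 [:: a; b] => fLt (tdec a) (tdec b)
  | Node 3 [:: p; q] => fImp (fdec p) (fdec q)
  | Node 4 [:: p] => fAll (fdec p)
  | _ => fFalse
  end.

Lemma fencK : cancel fenc fdec.
Proof. by elim=> //= [a b|a b|p -> q ->|p ->] //; rewrite !tencK. Qed.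

End Encoding.

Lemma countable_enum (T : Type) (x0 : T) : countable [set: T] ->
  exists f : nat -> T, forall x, exists n, f n = x.
Proof.
move=> /countable_injP [h hI].
pose f n := if pselect (exists x, h x = n) is left H then sval (cid H) else x0.
exists f => x; exists (h x); rewrite /f; case: pselect => [H|[]]; last by exists x.
by case: (cid H) => y /= /hI; apply; rewrite inE.
Qed.

Lemma definable_functions_enum (K : structure) : countable [set: K] ->
  exists E : nat -> (K -> K), forall g, F1 g -> exists n, E n = g.
Proof.
move=> /(countable_enum (zero K)) [f Hf].
(* Variable 0 is the value, the other argument variables all read [x], and the parameters are given
   by a list of indices; a finite list is enough by [sat_local]. *)
pose R p l (x y : K) := sat (inter (fun i => if i is 0 then y else x)
  (fun i => f (nth 0 l i))) p.
pose fn p l x := if pselect (exists y, R p l x y) is left H then sval (cid H)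
  else zero K.
pose E n := if unpickle n is Some ul then fn (fdec ul.1) ul.2 else id.
exists E => g [p [r H]].
have [N HN] := sat_local p.
have [l Hl] : exists l, forall i, i < N -> f (nth 0 l i) = r i.
  elim: N {HN} => [|N [l IH]]; first by exists [::].
  have [k Hk] := Hf (r N).
  exists (mkseq (fun i => if i < N then nth 0 l i else k) N.+1) => i Hi.
  rewrite nth_mkseq //; case: ifP => [/IH //|HiN].
  by have -> : i = N by apply/eqP; rewrite eqn_leq -ltnS Hi leqNgt HiN.
exists (pickle (fenc p, l)); rewrite /E pickleK /= fencK.
have HR x y : R p l x y <-> y = g x.
  rewrite (H (fun i => if i is 0 then y else x)); apply: HN => i Hi.
  rewrite /inter; case: ifP => // _; apply: Hl; apply: leq_ltn_trans Hi.
  by rewrite -{2}(odd_double_half i) -addnn addnA leq_addl.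
apply/funext => x; rewrite /fn; case: pselect => [H1|[]]; last by exists (g x); apply/HR.
by case: (cid H1) => y /= /HR.
Qed.

(** The Rasiowa-Sikorski argument: there are countably many pairs of an index and a definable
    function, and step [n] meets the requirement coded by [n]. *)
Lemma generic_sequence (K : structure) (C : (K -> Prop) -> Prop)
    (Q : nat -> (K -> K) -> (K -> Prop) -> Prop) Y0 : countable [set: K] -> C Y0 ->
  (forall i g Y, F1 g -> C Y -> exists Y', [/\ C Y', (forall y, Y' y -> Y y) & Q i g Y']) ->
  exists Ys : nat -> (K -> Prop), [/\ Ys 0 = Y0, (forall n, C (Ys n)),
    (forall n y, Ys n.+1 y -> Ys n y) & forall i g, F1 g -> exists n, Q i g (Ys n)].
Proof.
move=> /definable_functions_enum [E HE] C0 dense.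
pose good n Y Y' := [/\ C Y', (forall y, Y' y -> Y y) &
  forall ij, unpickle n = Some ij -> F1 (E ij.2) -> Q ij.1 (E ij.2) Y'].
have step n Y : C Y -> exists Y', good n Y Y'.
  move=> CY; case En: (unpickle n : option (nat * nat)) => [[i j]|]; last by exists Y; split=> // ij; rewrite En.
  case: (pselect (F1 (E j))) => Fj; last first.
    by exists Y; split=> // ij; rewrite En => -[<-].
  have [Y' [? ? ?]] := dense i (E j) Y Fj CY.
  by exists Y'; split=> // ij; rewrite En => -[<-].
have /choice [next Hnext] : forall nY : nat * {Y | C Y}, exists Y' : {Y | C Y},
    good nY.1 (sval nY.2) (sval Y').
  move=> [n [Y CY]] /=; have [Y' HY'] := step n Y CY.
  have CY' : C Y' by case: HY'.
  by exists (exist _ Y' CY').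
pose s := fix s n := if n is m.+1 then next (m, s m) else exist C Y0 C0.
exists (fun n => sval (s n)); split=> //.
- by move=> n; exact: svalP (s n).
- by move=> n y /=; have [_ H _] := Hnext (n, s n); apply: H.
- move=> i g Hg; have [j Ej] := HE g Hg.
  exists (pickle (i, j)).+1; have [_ _ H] := Hnext (pickle (i, j), s (pickle (i, j))).
  by move: (H (i, j)); rewrite pickleK /= Ej; apply.
Qed.

(** * Definable Skolem functions and definability of satisfaction *)

Section Skolem.
Variables (K : structure) (hK : PA_model K).

(** The least witness is definable; arguments without a witness are sent to zero. *)
Lemma definable_skolem (R : K -> K -> Prop) : D2 R ->
  exists g, F1 g /\ forall y, (exists x, R y x) -> R y (g y).
Proof.
move=> DR; pose G y z := (R y z /\ forall w, lt w z -> ~ R y w) \/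
  ((~ exists x, R y x) /\ z = zero K).
have Gex y : exists z, G y z.
  case: (pselect (exists x, R y x)) => Hx; last by exists (zero K); right.
  have [||z [Hz Hm]] := @PA_least _ hK (R y) => //; last by exists z; left.
  by definable.
have Guniq y z z' : G y z -> G y z' -> z = z'.
  move=> [[H1 H2]|[H1 ->]] [[H3 H4]|[H3 ->]] //.
  - case: (kle_or_lt hK z z') => H; last by case: (H2 _ H).
    by case: (kle_or_lt hK z' z) => H'; [klra|case: (H4 _ H')].
  - by case: H3; exists z.
  - by case: H1; exists z'.
have [g Hg] := choice Gex; exists g; split.
  apply: (@Def_ext _ (fun e => G (e 1) (e 0))); last by rewrite /G; definable.
  by move=> e; split=> [H|->]; [apply: Guniq H (Hg _)|].
by move=> y Hy; case: (Hg y) => [[]//|[]].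
Qed.

End Skolem.

Lemma DF_teval (K : structure) t (T : nat -> (nat -> K) -> K) :
  (forall i, DF (T i)) -> DF (fun e => teval (fun i => T i e) t).
Proof.
move=> H; elim: t => [n|||t1 H1 t2 H2|t1 H1 t2 H2] /=; first exact: H.
- exact: DF_const.
- exact: DF_const.
- exact: DF_add.
- exact: DF_mul.
Qed.

Lemma Def_sat (K : structure) p (T : nat -> (nat -> K) -> K) :
  (forall i, DF (T i)) -> Def (fun e => sat (fun i => T i e) p).
Proof.
elim: p T => [|t1 t2|t1 t2|p IHp q IHq|p IHp] T H /=.
- exact: Def_prop.
- by apply: Def_eq; apply: DF_teval.
- by apply: Def_lt; apply: DF_teval.
- by apply: Def_imp; [apply: IHp|apply: IHq].
- apply: Def_all.
  have := IHp (fun i e => if i is j.+1 then T j (fun i => e i.+1) else e 0).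
  set S := (X in Def X); set S' := (X in _ -> Def X).
  suff -> : S = S' by apply=> -[|i]; [exact: DF_var|apply: DF_tail].
  rewrite /S /S'; apply/funext => e; congr sat.
Qed.

(** * Definable ultrapowers *)

Section Ultrapower.
Variables (K : structure) (hK : PA_model K).
(** [U] is a proper filter on arbitrary subsets of [K], required to decide the definable ones
    only. *)
Variable U : (K -> Prop) -> Prop.
Hypothesis U_up : forall A B : K -> Prop, U A -> (forall y, A y -> B y) -> U B.
Hypothesis U_and : forall A B : K -> Prop, U A -> U B -> U (fun y => A y /\ B y).
Hypothesis U_ex : forall A : K -> Prop, U A -> exists y, A y.
Hypothesis U_dec : forall A : K -> Prop, D1 A -> U A \/ U (fun y => ~ A y).

Lemma U_T (A : K -> Prop) : (forall y, A y) -> U A.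
Proof.
move=> H; have [H'|H'] := @U_dec (fun=> True) (Def_prop K True); first by apply: U_up H' _.
by have [y []] := U_ex H'.
Qed.

Lemma U_up2 (A B C : K -> Prop) : U A -> U B -> (forall y, A y -> B y -> C y) -> U C.
Proof. by move=> HA HB H; apply: U_up (U_and HA HB) _ => y []; apply: H. Qed.

Definition ucls (g : K -> K) : set (K -> K) := [set h | F1 h /\ U (fun y => g y = h y)].
Definition ult_type : Type := {C : set (K -> K) | exists g, F1 g /\ C = ucls g}.
Definition mk (g : K -> K) (Hg : F1 g) : ult_type :=
  exist _ (ucls g) (ex_intro _ g (conj Hg erefl)).

Lemma mk_eqP g h (Hg : F1 g) (Hh : F1 h) : mk Hg = mk Hh <-> U (fun y => g y = h y).
Proof.
split=> [/(congr1 sval) /= E|H].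
  have : ucls h h by split=> //; apply: U_T.
  by rewrite -E => -[].
apply: eq_exist => /=; apply/seteqP; split=> k [Hk H']; split=> //;
  by apply: U_up2 H H' _ => y -> ->.
Qed.

Lemma mk_surj (u : ult_type) : exists g, exists Hg : F1 g, u = mk Hg.
Proof.
by case: u => C H; have [g [Hg E]] := H; exists g, Hg; apply: eq_exist.
Qed.

Definition urep (u : ult_type) : K -> K := sval (cid (mk_surj u)).

Lemma F1_urep u : F1 (urep u).
Proof. by rewrite /urep; case: cid => g []. Qed.

Lemma urepK u : mk (F1_urep u) = u.
Proof.
move: (F1_urep u); rewrite /urep; case: cid => g /= [Hg ->] Hg'.
by apply/mk_eqP; apply: U_T.
Qed.

Lemma urep_mk g (Hg : F1 g) : U (fun y => urep (mk Hg) y = g y).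
Proof. by apply/(mk_eqP (F1_urep _) Hg); rewrite urepK. Qed.

Lemma ueqP u v : u = v <-> U (fun y => urep u y = urep v y).
Proof. by rewrite -{1}(urepK u) -{1}(urepK v) mk_eqP. Qed.

Lemma F1_const k : F1 (fun _ : K => k). Proof. exact: DF_const. Qed.
Lemma F1_id : F1 (fun x : K => x). Proof. exact: DF_var. Qed.

Lemma F1_add2 (g h : K -> K) : F1 g -> F1 h -> F1 (fun y => add (g y) (h y)).
Proof. by move=> Hg Hh; definable. Qed.

Lemma F1_mul2 (g h : K -> K) : F1 g -> F1 h -> F1 (fun y => mul (g y) (h y)).
Proof. by move=> Hg Hh; definable. Qed.

Definition ultrapower : structure := {|
  carrier := ult_type;
  zero := mk (F1_const (zero K));
  one := mk (F1_const (one K));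
  lt := fun u v => U (fun y => lt (urep u y) (urep v y));
  add := fun u v => mk (F1_add2 (F1_urep u) (F1_urep v));
  mul := fun u v => mk (F1_mul2 (F1_urep u) (F1_urep v)) |}.

Lemma los_term (e : nat -> ultrapower) t :
  U (fun y => urep (teval e t) y = teval (fun i => urep (e i) y) t).
Proof.
elim: t => [n|||t1 H1 t2 H2|t1 H1 t2 H2] /=.
- exact: U_T.
- exact: urep_mk.
- exact: urep_mk.
- by apply: (U_up2 (urep_mk (F1_add2 (F1_urep (teval e t1)) (F1_urep (teval e t2)))) (U_and H1 H2)) => y -> [-> ->].
- by apply: (U_up2 (urep_mk (F1_mul2 (F1_urep (teval e t1)) (F1_urep (teval e t2)))) (U_and H1 H2)) => y -> [-> ->].
Qed.

Lemma D1_los (e : nat -> ultrapower) p : D1 (fun y => sat (fun i => urep (e i) y) p).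
Proof.
apply: (@Def_sat K p (fun i e' => urep (e i) (e' 0))) => i.
exact: DF_comp1 (F1_urep _) (DF_var _ 0).
Qed.

(** For an implication, [U] decides the truth set of the premise, which is definable. For a
    universal formula that fails almost everywhere, a definable Skolem function picks
    counterexamples, and its class is a counterexample in the ultrapower. *)
Lemma los p (e : nat -> ultrapower) :
  sat e p <-> U (fun y => sat (fun i => urep (e i) y) p).
Proof.
elim: p e => [|t1 t2|t1 t2|p IHp q IHq|p IHp] e /=.
- by split=> // /U_ex [].
- have H := U_and (los_term e t1) (los_term e t2); rewrite ueqP.
  by split=> H'; apply: U_up2 H H' _ => y [-> ->].
- have H := U_and (los_term e t1) (los_term e t2).
  by split=> H'; apply: U_up2 H H' _ => y [-> ->].
- rewrite IHp IHq; split=> H.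
    have [/H|] := U_dec (D1_los e p); first by move/U_up; apply=> y.
    by move/U_up; apply=> y.
  by move=> H'; apply: U_up2 H H' _ => y; apply.
- have E (u : ultrapower) y : (fun i => urep (env_cons u e i) y) =
      env_cons (urep u y) (fun i => urep (e i) y).
    by apply/funext => -[].
  split=> H; last first.
    by move=> u; apply/IHp; apply: U_up H _ => y /(_ (urep u y)); rewrite -E.
  have [//|H'] := U_dec (D1_los e (fAll p)); exfalso.
  pose R y x := ~ sat (env_cons x (fun i => urep (e i) y)) p.
  have DR : D2 R.
    apply: Def_not.
    have := @Def_sat K p (fun i e' => if i is j.+1 then urep (e j) (e' 0) else e' 1).
    set S := (X in Def X); set S' := (X in _ -> Def X).
    suff -> : S = S'.
      by apply=> -[|i]; [exact: DF_var|apply: DF_comp1 (F1_urep _) (DF_var _ 0)].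
    by apply/funext => e'; rewrite /S /S'; congr sat; apply/funext => -[].
  have [g [Hg HR]] := definable_skolem hK DR.
  have /IHp Hs := H (mk Hg).
  have [y [[Hy1 Hy2] Hy3]] := U_ex (U_and (U_and Hs H') (urep_mk Hg)).
  have : R y (g y) by apply: HR; apply/not_existsP => N; apply: Hy2 => x; apply: contrapT; apply: N.
  by apply; move: Hy1; rewrite E Hy3.
Qed.

Definition uinj (k : K) : ultrapower := mk (F1_const k).
Definition ugen : ultrapower := mk F1_id.

Lemma uinj_elementary : elementary_embedding uinj.
Proof.
move=> p e; rewrite los.
have [N HN] := sat_local p.
(* The chosen representative of a constant agrees with it only on a set of [U], which may vary with
   the constant; finitely many constants are involved. *)
have H : U (fun y => forall i, i < N -> urep (uinj (e i)) y = e i).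
  elim: N {HN} => [|N IH]; first exact: U_T.
  apply: U_up2 IH (urep_mk (F1_const (e N))) _ => y H1 H2 i.
  by rewrite ltnS leq_eqVlt => /orP [/eqP ->|/H1].
split=> Hs.
  by apply: U_up H _ => y Hy; apply/(HN _ e) => // i Hi; rewrite /= Hy.
have [y [Hy1 Hy2]] := U_ex (U_and H Hs).
by apply/(HN _ e (fun i => urep (uinj (e i)) y)) => // i Hi; rewrite Hy1.
Qed.

Lemma ultrapower_PA : PA_model ultrapower.
Proof. by move=> p Hp e; apply/los; apply: U_T => y; apply: hK. Qed.

Lemma ultrapower_countable : countable [set: K] -> countable [set: ultrapower].
Proof.
move=> /definable_functions_enum [E HE].
have /choice [f Hf] : forall u : ultrapower, exists n, E n = urep u.
  by move=> u; apply: HE; apply: F1_urep.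
apply/countable_injP; exists f => u v _ _ Euv.
by apply/ueqP; apply: U_T => y; rewrite -!Hf Euv.
Qed.

Lemma ult_leP (u v : ultrapower) : U (fun y => kle (urep u y) (urep v y)) -> kle u v.
Proof.
move=> H; apply/(zinj_leE ultrapower_PA)/(zinj_nltE ultrapower_PA) => /= H'.
by have [y [H1 H2]] := U_ex (U_and H H'); klra.
Qed.

End Ultrapower.

(** * One-step extensions *)

Section Step.
Variables (K : structure) (hK : PA_model K) (cK : countable [set: K]).
Implicit Types (Y : K -> Prop).

(** A generic sequence generates the filter. A definable set is decided by deciding its
    characteristic function, with values 0 and 1, against the cut between 0 and 1. *)
Lemma generic_ultrafilter (C : (K -> Prop) -> Prop)
    (Q : nat -> (K -> K) -> (K -> Prop) -> Prop) Y0 :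
  C Y0 -> (forall Y, C Y -> exists y, Y y) ->
  (forall g Y L U, F1 g -> (exists u, U u) -> omits L U -> C Y ->
     exists Y', [/\ C Y', (forall y, Y' y -> Y y) & decides g Y' L U]) ->
  (forall i g Y, F1 g -> C Y -> exists Y', [/\ C Y', (forall y, Y' y -> Y y) & Q i g Y']) ->
  exists U : (K -> Prop) -> Prop,
  [/\ (forall A B : K -> Prop, U A -> (forall y, A y -> B y) -> U B),
      (forall A B : K -> Prop, U A -> U B -> U (fun y => A y /\ B y)),
      (forall A : K -> Prop, U A -> exists Y, C Y /\ forall y, Y y -> A y),
      (forall A : K -> Prop, D1 A -> U A \/ U (fun y => ~ A y)) &
      U Y0 /\ forall i g, F1 g -> exists Y, [/\ C Y, U Y & Q i g Y]].
Proof.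
move=> C0 Cex Cdec CQ.
pose L x := x = zero K; pose R x := x = one K.
pose Q' i := if i is j.+1 then Q j else fun g Y => decides g Y L R.
have [|Ys [Ys0 YsC Ysdec YsQ]] := @generic_sequence K C Q' Y0 cK C0.
  case=> [|i] g Y Hg CY /=; last exact: CQ.
  apply: Cdec => //; first by exists (one K).
  move=> z; case: (kcases hK z) => [->|[w ->]]; [left|right].
    by exists (zero K); split=> //; klra.
  by exists (one K); split=> //; klra.
have Ysle m n y : m <= n -> Ys n y -> Ys m y.
  elim: n => [|n IH]; first by rewrite leqn0 => /eqP ->.
  by rewrite leq_eqVlt => /orP [/eqP ->//|/IH H /Ysdec].
exists (fun A => exists n, forall y, Ys n y -> A y); split.
- by move=> A B [n H] AB; exists n => y /H /AB.
- move=> A B [m Hm] [n Hn]; exists (maxn m n) => y Hy; split.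
    by apply: Hm; apply: Ysle Hy; rewrite leq_maxl.
  by apply: Hn; apply: Ysle Hy; rewrite leq_maxr.
- by move=> A [n H]; exists (Ys n).
- move=> A DA; pose g x := if pselect (A x) then zero K else one K.
  have Hg : F1 g.
    apply: (@Def_ext _ (fun e => (A (e 1) /\ e 0 = zero K) \/ (~ A (e 1) /\ e 0 = one K))).
      move=> e; rewrite /g; case: pselect => H; split.
      + by case=> -[].
      + by left.
      + by case=> -[].
      + by right.
    by definable.
  have [n [[l [-> H]]|[u [-> H]]]] := YsQ 0 g Hg; [left|right]; exists n => y /H;
    rewrite /g; case: pselect => //= Ay Hle; by exfalso; klra.
- split; first by exists 0 => y; rewrite Ys0.
  move=> i g Hg; have [n Hn] := YsQ i.+1 g Hg.
  by exists (Ys n); split=> //; exists n.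
Qed.

Variable cuts : nat -> (K -> Prop) * (K -> Prop).
Hypothesis cuts_inh : forall i, exists u, (cuts i).2 u.
Hypothesis cuts_omitted : forall i, omits (cuts i).1 (cuts i).2.

Definition good_extension (K' : structure) (h : K -> K') :=
  [/\ PA_model K', countable [set: K'], elementary_embedding h &
    forall i (z : K'), (exists l, (cuts i).1 l /\ kle z (h l)) \/
                       (exists u, (cuts i).2 u /\ kle (h u) z)].

(** Requirement 0 is [Q], and requirement j + 1 decides every definable function against the cut of
    index j; by this, no class of functions fills that cut. *)
Lemma extend_generic (C : (K -> Prop) -> Prop)
    (Q : (K -> K) -> (K -> Prop) -> Prop) Y0 :
  C Y0 -> (forall Y, C Y -> exists y, Y y) ->
  (forall g Y L U, F1 g -> (exists u, U u) -> omits L U -> C Y ->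
     exists Y', [/\ C Y', (forall y, Y' y -> Y y) & decides g Y' L U]) ->
  (forall g Y, F1 g -> C Y -> exists Y', [/\ C Y', (forall y, Y' y -> Y y) & Q g Y']) ->
  exists U (K' := ultrapower U), [/\
    good_extension (uinj U),
    (forall u v : K', U (fun y => kle (urep u y) (urep v y)) -> kle u v),
    (forall A B : K -> Prop, U A -> (forall y, A y -> B y) -> U B) /\
    (forall A : K -> Prop, U A -> exists Y, C Y /\ forall y, Y y -> A y),
    (forall A B : K -> Prop, U A -> U B -> U (fun y => A y /\ B y)) /\
    (forall g (Hg : F1 g), U (fun y => urep (mk U Hg) y = g y)) &
    U Y0 /\ forall g, F1 g -> exists Y, [/\ C Y, U Y & Q g Y]].
Proof.
move=> C0 Cex Cdec CQ.
pose Q' i g Y := if i is j.+1 then decides g Y (cuts j).1 (cuts j).2 else Q g Y.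
have [|U [U_up U_and U_C U_dec [U0 UQ]]] := @generic_ultrafilter C Q' Y0 C0 Cex Cdec.
  by case=> [|i] g Y Hg CY; [exact: CQ|exact: Cdec].
have U_ex A : U A -> exists y, A y.
  by move=> /U_C [Y [/Cex [y Yy] H]]; exists y; apply: H.
have le_mk := ult_leP hK U_up U_and U_ex U_dec.
have rep_mk := urep_mk U_up U_and U_ex U_dec.
exists U; split=> //; last by split=> // g Hg; exact: (UQ 0).
split.
- exact: ultrapower_PA.
- exact: ultrapower_countable.
- exact: uinj_elementary.
- move=> i z.
  have [Y [_ UY [[l [Ll Hl]]|[u [Uu Hu]]]]] := UQ i.+1 (urep z) (F1_urep z);
    [left; exists l|right; exists u]; split=> //; apply: le_mk.
    by apply: U_up (U_and _ _ UY (rep_mk _ (F1_const l))) _ => y [/Hl H ->].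
  by apply: U_up (U_and _ _ UY (rep_mk _ (F1_const u))) _ => y [/Hu H ->].
Qed.

Lemma proper_extension : exists (K' : structure) (h : K -> K'),
  good_extension h /\ exists y, forall k, y <> h k.
Proof.
have [||||U [K'g _ [U_up U_C] [U_and rep_mk] _]] :=
  @extend_generic (@unbounded K) (fun _ _ => True) (fun=> True).
- split; first exact: Def_prop.
  by move=> x; exists (add x (one K)); split=> //; klra.
- by move=> Y [_ /(_ (zero K)) [y []]]; exists y.
- by move=> g Y L R Hg HR HLR HY; exact: unbounded_decides.
- by move=> g Y _ HY; exists Y; split.
exists (ultrapower U), (uinj U); split=> //; exists (ugen U) => k E.
have H1 := rep_mk _ (F1_const k); have H2 := rep_mk _ (@F1_id K).
(* If the generic element were [k], some condition would be contained in [{k}]. *)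
have [Y [[_ HY] H]] : exists Y, unbounded Y /\ forall y, Y y -> y = k.
  apply: U_C; apply: U_up (U_and _ _ H1 H2) _ => y [Ek Ey].
  by rewrite -[LHS]Ey -/(ugen U) E.
by have [y [/H -> ky]] := HY k; klra.
Qed.

(** With fat sets as conditions, [y] is the class of the identity. For any [z], a set of [U] that
    kills a representative of [z] provides the point [x] that keeps [z] out of the cut of [y]. *)
Lemma killing_extension (F : K -> K) (a : K) :
  (forall x y, lt x y -> kle y a -> lt (F x) (F y)) -> F (zero K) = zero K ->
  nonstd a -> lt a (F a) -> ~ E3 a (F a) ->
  exists (K' : structure) (h : K -> K'), good_extension h /\
  exists y : K', [/\ lt y (h (F a)), (forall k, y <> h k) &
    forall z, exists x, kle x a /\
      ((kle z (h x) /\ lt (h (F x)) y) \/ (kle (h x) z /\ lt y (h (F x))))].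
Proof.
move=> Fm F0 Ha ab NE.
have [||||U [K'g le_mk [U_up U_C] [U_and rep_mk] [U0 UQ]]] :=
  @extend_generic (@fat K F a) (killed F a) (fun y => lt y (F a)).
- exact: fat_init.
- by move=> Y; exact: fat_nonempty.
- by move=> g Y L R Hg HR HLR HY; exact: fat_decides.
- by move=> g Y Hg HY; exact: fat_kill.
have Hid := rep_mk _ (@F1_id K).
exists (ultrapower U), (uinj U); split=> //; exists (ugen U); split.
- by apply: U_up (U_and _ _ U0 (U_and _ _ Hid (rep_mk _ (F1_const (F a))))) _ => y [H [-> ->]].
- move=> k E; have H1 := rep_mk _ (F1_const k).
  (* A fat set is not contained in [{k}]: its size exceeds s P, where P > 1, and s > 0 because the
     interval contains a point. *)
  have [Y [[DY [d [s [P [n [_ HI HP _ HL]]]]]] H]] : exists Y, fat F a Y /\ forall y, Y y -> y = k.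
    apply: U_C; apply: U_up (U_and _ _ H1 Hid) _ => y [Ek Ey].
    by rewrite -[LHS]Ey -/(ugen U) E.
  have S1 : kle (cnt Y (F a)) (one K).
    have H2 := cnt_single hK k (F a).
    have H3 : kle (cnt Y (F a)) (cnt (fun y => y = k) (F a)); last by klra.
    by apply: cnt_sub => //; [definable|move=> y _ /H].
  have [|y [_ Yy]] := cnt_pos hK (z := F a) DY.
    by have H2 := HL 0; rewrite /= in H2; klra.
  have [y1 y2] := HI y Yy; have P1 := nonstd_gt1 hK HP.
  case: (kcases hK s) => [s0|[s' Es]].
    by rewrite s0 kadd0 // in y2; klra.
  by have := HL 1; rewrite Es /= => H2; knra.
- move=> z; have [Y [_ UY [x [xa H]]]] := UQ (urep z) (F1_urep z).
  exists x; split=> //; have H1 := rep_mk _ (F1_const x); have H2 := rep_mk _ (F1_const (F x)).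
  case: H => H; [left|right]; split; try apply: le_mk;
    apply: U_up (U_and _ _ UY (U_and _ _ (U_and _ _ H1 H2) Hid)) _ => y [/H [H3 H4] [[E1 E2] E3']].
  + by rewrite E1.
  + by rewrite /= E2 E3'.
  + by rewrite E1.
  + by rewrite /= E2 E3'.
Qed.

End Step.

(** * E3 implies E5 *)

Section E3_E5.
Variables (K : structure) (hK : PA_model K).
Local Notation "x '+k' y" := (@add K x y) (at level 50, left associativity).
Local Notation "x '*k' y" := (@mul K x y) (at level 40, left associativity).
Local Notation "0k" := (zero K).
Local Notation "1k" := (one K).
Implicit Types x y z : K.
Variables a b c : K.
Hypothesis cpow : forall n, lt (power c n) a /\ lt (power c n) b.
Hypothesis abc : lt a (b *k c).
Hypothesis bac : lt b (a *k c).

Lemma base_a_gt0 : lt 0k a. Proof. by have [H _] := cpow 0; rewrite /= in H; klra. Qed.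
Lemma base_b_gt0 : lt 0k b. Proof. by have [_ H] := cpow 0; rewrite /= in H; klra. Qed.

Lemma base_ge2 : kle (1k +k 1k) c.
Proof.
case: (kcases hK c) => [E|[d E]]; first by move: abc; rewrite E kmul0 // => ?; klra.
case: (kcases hK d) => [E'|[d' E']]; last by klra.
by move: abc bac; rewrite E E' => ? ?; klra.
Qed.

(** The cut [I]. It is closed under addition because c >= 2. *)
Definition small x := exists n, lt x (power c n).

Lemma small_le x y : kle x y -> small y -> small x.
Proof. by move=> H [n Hn]; exists n; klra. Qed.

Lemma small_add x y : small x -> small y -> small (x +k y).
Proof.
have mono m n : kle (power c m) (power c (m + n)).
  elim: n => [|n IH]; first by rewrite addn0; klra.
  rewrite addnS /=; have := kmul_le hK (power c (m + n)) base_ge2 => ?; klra.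
move=> [m Hm] [n Hn]; exists (m + n).+1 => /=.
have H1 := mono m n; have H2 := mono n m; rewrite addnC in H2.
by have := kmul_le hK (power c (m + n)) base_ge2 => ?; klra.
Qed.

Lemma small_mul x : small x -> small (x *k c).
Proof. by move=> [n Hn]; have c2 := base_ge2; exists n.+1 => /=; knra. Qed.

Lemma small1 : small 1k. Proof. by have c2 := base_ge2; exists 1 => /=; klra. Qed.
Lemma small0 : small 0k. Proof. by exists 0 => /=; klra. Qed.

Lemma not_small_a : ~ small a.
Proof. by move=> [n H]; have [H' _] := cpow n; klra. Qed.

Definition close x y := exists i, [/\ small i, kle x (y +k i) & kle y (x +k i)].

Lemma close_refl x : close x x.
Proof. by exists 0k; split; [exact: small0|klra|klra]. Qed.

Lemma close_sym x y : close x y -> close y x.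
Proof. by move=> [i [H1 H2 H3]]; exists i. Qed.

Lemma close_trans x y z : close x y -> close y z -> close x z.
Proof.
move=> [i [H1 H2 H3]] [j [H4 H5 H6]]; exists (i +k j).
by split; [exact: small_add|klra|klra].
Qed.

Lemma scale_exists x : exists q, kle (a *k q) (x *k b) /\ lt (x *k b) (a *k (q +k 1k)).
Proof. exact: (kdiv hK _ base_a_gt0). Qed.

Definition scale x := sval (cid (scale_exists x)).

Lemma scaleP x : kle (a *k scale x) (x *k b) /\ lt (x *k b) (a *k (scale x +k 1k)).
Proof. by rewrite /scale; case: cid. Qed.

Lemma kmul_ltI x y z : lt 0k z -> lt (z *k x) (z *k y) -> lt x y.
Proof.
move=> z0 H; case: (kle_or_lt hK y x) => // H'; exfalso.
by have H2 := kmul_le hK z H'; klra.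
Qed.

(** Since b < a c, multiplication by b / a stretches a difference [i] to at most i c, and rounding
    adds 1. Symmetrically, [scale_down] rests on a < b c. Together they give an order embedding on
    the classes modulo [I]. *)
Lemma scale_up x y i : kle x (y +k i) -> kle (scale x) (scale y +k (1k +k i *k c)).
Proof.
move=> H; have [H1 _] := scaleP x; have [_ H2] := scaleP y.
suff H3 : lt (scale x) (scale y +k (1k +k i *k c)) by klra.
apply: (kmul_ltI base_a_gt0); have H4 := kmul_le hK b H.
have bac' : kle b (a *k c) by have B := bac; klra.
by have H5 := kmul_le hK i bac'; clear - hK H1 H2 H4 H5; klra.
Qed.

Lemma scale_down x y i : kle (scale x) (scale y +k i) -> kle x (y +k (i +k 1k) *k c).
Proof.
move=> H; have [_ H1] := scaleP x; have [H2 _] := scaleP y.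
suff H3 : lt x (y +k (i +k 1k) *k c) by klra.
apply: (kmul_ltI base_b_gt0); have H4 := kmul_le hK a H.
have abc' : kle a (b *k c) by have B := abc; klra.
by have H5 := kmul_le hK (i +k 1k) abc'; clear - hK H1 H2 H4 H5; klra.
Qed.

Lemma scale_close x y : close x y -> close (scale x) (scale y).
Proof.
move=> [i [Hi H1 H2]]; exists (1k +k i *k c); split; try exact: scale_up.
by apply: small_add; [exact: small1|exact: small_mul].
Qed.

Lemma scale0 : scale 0k = 0k.
Proof. by have [H _] := scaleP 0k; have a0 := base_a_gt0; knra. Qed.

Lemma scale_a : scale a = b.
Proof.
have [H1 H2] := scaleP a.
have H3 : kle (scale a) b by apply: (kmul_leI hK base_a_gt0); klra.
have H4 : lt b (scale a +k 1k) by apply: (kmul_ltI base_a_gt0); klra.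
by klra.
Qed.

(** The representative is computed from the class as a predicate, hence is common to the whole
    class. Preferring 0 and [a] makes them representatives of their classes, so that [a] goes
    exactly to [b]. *)
Definition choose_center (P : K -> Prop) : K :=
  if pselect (P 0k) then 0k else if pselect (P a) then a else
  if pselect (exists y, P y) is left H then sval (cid H) else 0k.

Definition center x := choose_center (close x).

Lemma center_close x : close x (center x).
Proof.
rewrite /center /choose_center; case: pselect => // H1; case: pselect => // H2 /=.
case: pselect => [H|[]]; first by case: (cid H).
by exists x; apply: close_refl.
Qed.

Lemma center_eq x y : close x y -> center x = center y.
Proof.
move=> H; have E : close x = close y.
  apply/funext => z; apply/propext; split; apply: close_trans => //.
  exact: close_sym.
by rewrite /center E.
Qed.

Lemma center_small x : small (center x) -> center x = 0k.
Proof.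
move=> H; rewrite /center /choose_center.
case: (pselect (close x 0k)) => // N; exfalso; apply: N.
by apply: close_trans (center_close x) _; exists (center x); split=> //; klra.
Qed.

Lemma center_a : center a = a.
Proof.
rewrite /center /choose_center; case: pselect => [H|_] /=.
  by case: H => i [Hi H1 _]; exfalso; apply: not_small_a; apply: small_le Hi; klra.
by case: pselect => // -[]; exact: close_refl.
Qed.

Lemma large_center x i : small i -> center x = 0k \/ (kle i (center x) /\ kle i (scale (center x))).
Proof.
move=> Hi; case: (pselect (small (center x))) => H; [left; exact: center_small|right].
split; [case: (kle_or_lt hK i (center x))|case: (kle_or_lt hK i (scale (center x)))] => // H';
  exfalso; apply: H.
  by apply: small_le Hi; klra.
have H0 := @scale_down (center x) 0k i; rewrite scale0 in H0.
have {}H0 : kle (center x) (0k +k (i +k 1k) *k c) by apply: H0; klra.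
apply: small_le H0 _; apply: small_add; first exact: small0.
by apply: small_mul; apply: small_add => //; exact: small1.
Qed.

(** The translate is x - center x + scale (center x). It exists because a center other than 0, and
    its image, exceed every small element. *)
Lemma move_exists x : exists z, z +k center x = scale (center x) +k x.
Proof.
have [i [Hi H1 H2]] := center_close x.
suff [z Hz] : kle (center x) (scale (center x) +k x) by exists z; klra.
by case: (large_center x Hi) => [->|[H3 H4]]; klra.
Qed.

Definition move_fun x := sval (cid (move_exists x)).

Lemma move_funP x : move_fun x +k center x = scale (center x) +k x.
Proof. by rewrite /move_fun; case: cid. Qed.

(** Inside a class the map is a translation. If it reversed two points x < y, the image of the
    center of [y] would exceed that of the center of [x] by a small amount at most; [scale_down]
    would then put both points in one class. *)
Lemma move_fun_lt x y : lt x y -> lt (move_fun x) (move_fun y).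
Proof.
move=> xy; have Hx := move_funP x; have Hy := move_funP y.
case: (pselect (close x y)) => [/center_eq E|N]; first by rewrite E in Hx; klra.
case: (kle_or_lt hK (move_fun y) (move_fun x)) => // H; exfalso; apply: N.
have [i [Hi H1 H2]] := center_close x; have [j [Hj H3 H4]] := center_close y.
have H5 : kle (scale (center y)) (scale (center x) +k (i +k j)) by klra.
have H6 := scale_down H5.
exists (((i +k j) +k 1k) *k c +k (i +k j)); split; [|klra|klra].
have Hij := small_add Hi Hj.
by apply: small_add => //; apply: small_mul; apply: small_add => //; exact: small1.
Qed.

Lemma move_fun_surj z : exists x, move_fun x = z.
Proof.
(* Since [y] is about z a / b, its image by [scale] is in the class of [z]; translating from the
   center of [y] then reaches [z] exactly. *)
have [y [H1 H2]] := kdiv hK (z *k a) base_b_gt0.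
have Hz : close (scale y) z.
  have [H3 H4] := scaleP y; exists (1k +k c); split.
  - by apply: small_add; [exact: small1|have c2 := base_ge2; exists 2 => /=; knra].
  - have : kle (scale y) z by apply: (kmul_leI hK base_a_gt0); klra.
    by move=> ?; klra.
  - suff : lt z (scale y +k (1k +k c)) by move=> ?; klra.
    by apply: (kmul_ltI base_a_gt0); have B := bac; clear - hK H2 H4 B; klra.
have [i [Hi H5 H6]] := close_trans (close_sym (scale_close (center_close y))) Hz.
have [x Hx] : kle (scale (center y)) (center y +k z).
  by case: (large_center y Hi) => [->|[H7 H8]]; [rewrite scale0; klra|klra].
have E : center x = center y.
  apply: center_eq.
  apply: close_trans (close_sym (center_close y)).
  by exists i; split=> //; klra.
by exists x; have := move_funP x; rewrite E => ?; klra.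
Qed.

Lemma E3_E5_aux : E5 a b.
Proof.
exists move_fun; split; last first.
  have := move_funP a; rewrite center_a scale_a => ?; klra.
have iff_lt x y : lt x y <-> lt (move_fun x) (move_fun y).
  split=> [|H]; first exact: move_fun_lt.
  case: (kle_or_lt hK y x) => // H'; exfalso.
  case: (pselect (y = x)) => E; first by rewrite E in H; klra.
  have /move_fun_lt H2 : lt y x by apply: contrapT => N; apply: E; klra.
  by klra.
split=> //; split=> //.
- move=> x y _ _ E; apply: contrapT => N.
  have [/iff_lt|/iff_lt] : lt x y \/ lt y x; try (by rewrite E => ?; klra).
  by case: (kle_or_lt hK x y) => H; [left; apply: contrapT => H'; apply: N; klra|right].
- by move=> z _; have [x Hx] := move_fun_surj z; exists x.
Qed.

End E3_E5.

Lemma E3_imp_E5 (K : structure) (a b : K) : PA_model K -> E3 a b -> E5 a b.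
Proof. by move=> hK [c [H1 [H2 H3]]]; exact: E3_E5_aux hK _ _ _ H1 H2 H3. Qed.

Local Open Scope classical_set_scope.

(** * Elementary embeddings and unions *)

(** With s = x + y, the value s^2 + x lies between s^2 and (s + 1)^2, so it determines s and x. This
    pairing turns the graph of a function into a set of elements. *)
Definition pr (K : structure) (x y : K) : K := add (mul (add x y) (add x y)) x.

Lemma pr_inj (K : structure) (x y x' y' : K) : PA_model K ->
  pr x y = pr x' y' -> x = x' /\ y = y'.
Proof.
move=> hK; rewrite /pr => E.
have Hs : add x y = add x' y'.
  apply: contrapT => N; have [H|H] : lt (add x y) (add x' y') \/ lt (add x' y') (add x y).
    case: (kle_or_lt hK (add x y) (add x' y')) => H; [left|by right].
    by apply: contrapT => H'; apply: N; klra.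
  + by clear N; knra.
  + by clear N; knra.
rewrite Hs in E; have Ex : x = x' by klra.
by subst x'; split=> //; klra.
Qed.

Section Embedding.
Variables (K N : structure) (h : K -> N).
Hypothesis hel : elementary_embedding h.

Let e2 (x y : K) i := if i is 0 then x else y.

Lemma emb_inj : injective h.
Proof.
move=> x y E; have [_] := hel (fEq (tVar 0) (tVar 1)) (e2 x y).
by apply.
Qed.

Lemma emb_lt x y : lt x y <-> lt (h x) (h y).
Proof. exact: (hel (fLt (tVar 0) (tVar 1)) (e2 x y)). Qed.

Let e3 (x y z : K) i := if i is 0 then x else if i is 1 then y else z.

Lemma emb_add x y : h (add x y) = add (h x) (h y).
Proof.
have [H _] := hel (fEq (tAdd (tVar 0) (tVar 1)) (tVar 2)) (e3 x y (add x y)).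
by symmetry; apply: H.
Qed.

Lemma emb_mul x y : h (mul x y) = mul (h x) (h y).
Proof.
have [H _] := hel (fEq (tMul (tVar 0) (tVar 1)) (tVar 2)) (e3 x y (mul x y)).
by symmetry; apply: H.
Qed.

Lemma emb_zero : h (zero K) = zero N.
Proof. by have [H _] := hel (fEq (tVar 0) tZero) (fun=> zero K); apply: H. Qed.

Lemma emb_one : h (one K) = one N.
Proof. by have [H _] := hel (fEq (tVar 0) tOne) (fun=> one K); apply: H. Qed.

Lemma emb_pr x y : h (pr x y) = pr (h x) (h y).
Proof. by rewrite /pr !(emb_add, emb_mul). Qed.

Lemma emb_numeral n : h (numeral K n) = numeral N n.
Proof. by elim: n => [|n IH] /=; rewrite ?emb_zero // emb_add IH emb_one. Qed.

Lemma emb_power x n : h (power x n) = power (h x) n.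
Proof. by elim: n => [|n IH] /=; rewrite ?emb_one // emb_mul IH. Qed.

Lemma emb_E3 x y : E3 x y -> E3 (h x) (h y).
Proof.
move=> [c [H1 [H2 H3]]]; exists (h c); split.
  by move=> n; rewrite -emb_power -!emb_lt.
by rewrite -!emb_mul -!emb_lt.
Qed.

Lemma emb_kle x y : PA_model K -> PA_model N -> kle x y <-> kle (h x) (h y).
Proof.
move=> hK hN; rewrite !(zinj_leE hK, zinj_leE hN) -!(zinj_nltE hK, zinj_nltE hN).
by rewrite emb_lt.
Qed.

Lemma emb_nonstd x : nonstd (h x) -> nonstd x.
Proof. by move=> H n; apply/emb_lt; rewrite emb_numeral. Qed.

End Embedding.

Lemma elementary_comp (K M N : structure) (h : K -> M) (g : M -> N) :
  elementary_embedding h -> elementary_embedding g -> elementary_embedding (g \o h).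
Proof. by move=> Hh Hg p e; rewrite (Hh p e) (Hg p (h \o e)). Qed.

Lemma elementary_id (K : structure) : elementary_embedding (@id K).
Proof. by []. Qed.

(** * Labelled structures and their directed unions *)

Section Labelled.
Variable W : Type.

(** Labels identify elements across different carriers. When labels are injective, a
    label-preserving embedding is unique, so no coherent system of maps has to be carried along the
    chain. *)
Record lstr := LStr { lst :> structure; lab : lst -> W }.

Definition lemb (A B : lstr) (i : A -> B) :=
  elementary_embedding i /\ forall x, lab (i x) = lab x.

Definition emb (A B : lstr) := exists i : A -> B, lemb i.

Lemma lemb_comp (A B C : lstr) (i : A -> B) (j : B -> C) :
  lemb i -> lemb j -> lemb (j \o i).
Proof.
move=> [H1 H2] [H3 H4]; split; first exact: elementary_comp.
by move=> x /=; rewrite H4 H2.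
Qed.

Lemma emb_refl A : emb A A.
Proof. by exists id; split=> //; exact: elementary_id. Qed.

Lemma emb_trans A B C : emb A B -> emb B C -> emb A C.
Proof. by move=> [i Hi] [j Hj]; exists (j \o i); exact: lemb_comp. Qed.

Record is_union (Fam : lstr -> Prop) (U : lstr) : Prop := IsUnion {
  union_inj : injective (@lab U);
  union_emb : forall A, Fam A -> emb A U;
  union_cover : forall x : U, exists A, Fam A /\ exists y : A, lab y = lab x }.

Definition directed (Fam : lstr -> Prop) :=
  forall A B, Fam A -> Fam B -> exists C, [/\ Fam C, emb A C & emb B C].

Section Union.
Variable Fam : lstr -> Prop.
Variable A0 : lstr.
Hypothesis Fam0 : Fam A0.
Hypothesis Fam_inj : forall A, Fam A -> injective (@lab A).
Hypothesis Fam_dir : directed Fam.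

Definition ucar : Type := {w : W | exists A, Fam A /\ exists x : A, lab x = w}.

Definition inU (A : lstr) (FA : Fam A) (x : A) : ucar :=
  exist _ (lab x) (ex_intro _ A (conj FA (ex_intro _ x erefl))).

Lemma inU_eq (A B : lstr) (FA : Fam A) (FB : Fam B) (x : A) (y : B) :
  lab x = lab y -> inU FA x = inU FB y.
Proof. by move=> E; apply: eq_exist. Qed.

Lemma inU_surj (u : ucar) : exists A (FA : Fam A) (x : A), u = inU FA x.
Proof.
by case: u => w H; have [A [FA [x E]]] := H; exists A, FA, x; apply: eq_exist.
Qed.

Lemma common2 (u v : ucar) :
  exists A (FA : Fam A) (x y : A), u = inU FA x /\ v = inU FA y.
Proof.
have [A [FA [x ->]]] := inU_surj u; have [B [FB [y ->]]] := inU_surj v.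
have [C [FC [i [_ Hi]] [j [_ Hj]]]] := Fam_dir FA FB.
by exists C, FC, (i x), (j y); split; apply: inU_eq.
Qed.

(** An operation is computed in any member that contains both arguments; [uopE] shows that the
    choice of the member is immaterial. *)
Definition opP (op : forall A : structure, A -> A -> A) (u v w : ucar) :=
  exists A (FA : Fam A) (x y : A), [/\ u = inU FA x, v = inU FA y & w = inU FA (op A x y)].

Lemma opP_exists op u v : exists w, opP op u v w.
Proof.
by have [A [FA [x [y [-> ->]]]]] := common2 u v; exists (inU FA (op A x y)), A, FA, x, y.
Qed.

Definition uop op u v := sval (cid (opP_exists op u v)).

Definition ustr : structure := {|
  carrier := ucar;
  zero := inU Fam0 (zero A0);
  one := inU Fam0 (one A0);
  lt := fun u v => exists A (FA : Fam A) (x y : A),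
    [/\ u = inU FA x, v = inU FA y & lt x y];
  add := uop (@add);
  mul := uop (@mul) |}.

Lemma inU_inj (A : lstr) (FA : Fam A) (x y : A) : inU FA x = inU FA y -> x = y.
Proof. by move=> /(congr1 sval) /= /(Fam_inj FA). Qed.

Lemma uopE (op : forall A : structure, A -> A -> A) (A : lstr) (FA : Fam A) (x y : A) :
  (forall (K N : structure) (h : K -> N), elementary_embedding h ->
     forall x y, h (op K x y) = op N (h x) (h y)) ->
  uop op (inU FA x) (inU FA y) = inU FA (op A x y).
Proof.
move=> Hop; rewrite /uop; case: cid => w /= [B [FB [x' [y' [Ex Ey ->]]]]].
have [C [FC [i [Hi Li]] [j [Hj Lj]]]] := Fam_dir FA FB.
have Ex' : i x = j x'.
  by apply: (Fam_inj FC); rewrite Li Lj; exact: (congr1 sval Ex).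
have Ey' : i y = j y'.
  by apply: (Fam_inj FC); rewrite Li Lj; exact: (congr1 sval Ey).
by apply: inU_eq; rewrite -Li -Lj !Hop // Ex' Ey'.
Qed.

Lemma inU_zero (A : lstr) (FA : Fam A) : inU FA (zero A) = zero ustr.
Proof.
have [C [FC [i [Hi Li]] [j [Hj Lj]]]] := Fam_dir FA Fam0.
by apply: inU_eq; rewrite -Li -Lj !emb_zero.
Qed.

Lemma inU_one (A : lstr) (FA : Fam A) : inU FA (one A) = one ustr.
Proof.
have [C [FC [i [Hi Li]] [j [Hj Lj]]]] := Fam_dir FA Fam0.
by apply: inU_eq; rewrite -Li -Lj !emb_one.
Qed.

Lemma inU_lt (A : lstr) (FA : Fam A) (x y : A) :
  lt x y <-> @lt ustr (inU FA x) (inU FA y).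
Proof.
split=> [H|[B [FB [x' [y' [Ex Ey H]]]]]]; first by exists A, FA, x, y.
have [C [FC [i [Hi Li]] [j [Hj Lj]]]] := Fam_dir FA FB.
have Ex' : i x = j x'.
  by apply: (Fam_inj FC); rewrite Li Lj; exact: (congr1 sval Ex).
have Ey' : i y = j y'.
  by apply: (Fam_inj FC); rewrite Li Lj; exact: (congr1 sval Ey).
by apply/(emb_lt Hi); rewrite Ex' Ey' -(emb_lt Hj).
Qed.

Lemma inU_teval (A : lstr) (FA : Fam A) (e : nat -> A) t :
  teval (inU FA \o e : nat -> ustr) t = inU FA (teval e t).
Proof.
elim: t => [n|||t1 H1 t2 H2|t1 H1 t2 H2] /=; rewrite ?H1 ?H2 ?inU_zero ?inU_one //.
  by apply: uopE => K N h Hh x y; exact: emb_add.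
by apply: uopE => K N h Hh x y; exact: emb_mul.
Qed.

(** Tarski's argument for elementary chains: in the quantifier case, the element of the union and
    the assignment are moved to a common extension [C], where the induction hypothesis applies. *)
Lemma inU_elementary (A : lstr) (FA : Fam A) :
  elementary_embedding (inU FA : A -> ustr).
Proof.
move=> p; elim: p A FA => [|t1 t2|t1 t2|p IHp q IHq|p IHp] A FA e /=.
- by [].
- by rewrite !inU_teval; split=> [->|/inU_inj].
- by rewrite !inU_teval; exact: (inU_lt FA).
- by rewrite -IHp -IHq.
have E (B : lstr) (FB : Fam B) (x : B) (e' : nat -> B) :
    env_cons (inU FB x) (inU FB \o e') = inU FB \o env_cons x e'.
  by apply/funext => -[].
split=> H; last by move=> x; apply/(IHp A FA); rewrite -E; apply: H.
move=> u; have [B [FB [y ->]]] := inU_surj u.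
have [C [FC [i [Hi Li]] [j [Hj Lj]]]] := Fam_dir FA FB.
have -> : inU FB y = inU FC (j y) by apply: inU_eq.
have -> : inU FA \o e = inU FC \o (i \o e).
  by apply/funext => n /=; apply: inU_eq.
rewrite E -IHp; have /(Hi (fAll p)) H' : sat e (fAll p) by [].
exact: H'.
Qed.

Lemma union_exists : exists U, is_union Fam U.
Proof.
exists (@LStr ustr (fun u : ustr => sval u)); split.
- by move=> [w H] [w' H'] /= E; apply: eq_exist.
- move=> A FA; exists (inU FA); split=> //; exact: inU_elementary.
- by move=> [w [A [FA [x E]]]]; exists A; split=> //; exists x.
Qed.

End Union.

Lemma union_common (Fam : lstr -> Prop) (U : lstr) (s : seq U) : is_union Fam U ->
  directed Fam -> (exists A, Fam A) ->
  exists (A : lstr) (i : A -> U), [/\ Fam A, lemb i & forall x, List.In x s -> exists y, i y = x].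
Proof.
move=> HU dir [A0 FA0]; elim: s => [|x s [A [i [FA Hi Hs]]]].
  by have [i Hi] := union_emb HU FA0; exists A0, i.
have [B [FB [y Ey]]] := union_cover HU x.
have [C [FC [j Hj] [k Hk]]] := dir _ _ FA FB; have [l Hl] := union_emb HU FC.
exists C, l; split=> // z /= [<-|/Hs [w <-]].
  by exists (k y); apply: (union_inj HU); rewrite Hl.2 Hk.2.
by exists (j w); apply: (union_inj HU); rewrite Hl.2 Hj.2 Hi.2.
Qed.

(** The finitely many values that matter to an axiom lie in one member, where it holds. *)
Lemma union_PA (Fam : lstr -> Prop) U : is_union Fam U -> directed Fam ->
  (exists A, Fam A) -> (forall A, Fam A -> PA_model A) -> PA_model U.
Proof.
move=> HU dir ne hPA p Hp e; have [N HN] := sat_local p.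
have [A [i [FA [Hi _] Hs]]] := union_common (mkseq e N) HU dir ne.
have /choice [e' He'] : forall n, exists y : A, n < N -> i y = e n.
  move=> n; case: (ltnP n N) => nN; last by exists (zero A).
  have [|y Hy] := Hs (e n); last by exists y.
  rewrite /mkseq; apply: List.in_map.
  elim: N nN {HN Hs} => // N IH; rewrite ltnS leq_eqVlt -[N.+1]addn1 iotaD.
  move=> /orP [/eqP ->|/IH H]; apply: List.in_or_app; [right; left|left] => //.
apply/(HN _ e (i \o e')); first by move=> n /He' /= ->.
by rewrite -(Hi p e'); apply: hPA.
Qed.

End Labelled.

(** * The chain of models *)

(** At [l] the recursion chooses some [g] that extends the values built so far and satisfies [P l],
    and retains only its value at [l]. As [P l] depends on the values up to [l], it passes from [g]
    to [f]. *)
Lemma wf_choice (W : Type) (R : W -> W -> Prop) (V : Type)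
    (P : W -> (W -> V) -> Prop) (v0 : V) :
  well_founded R -> (forall x y z, R x y -> R y z -> R x z) ->
  (forall l f g, (forall m, m = l \/ R m l -> f m = g m) -> P l f -> P l g) ->
  (forall l f, (forall m, R m l -> P m f) ->
     exists g, (forall m, R m l -> g m = f m) /\ P l g) ->
  exists f, forall l, P l f.
Proof.
move=> wf tr loc step.
pose ext l (rec : forall m, R m l -> V) m : V :=
  if pselect (R m l) is left H then rec m H else v0.
pose good l (rec : forall m, R m l -> V) g :=
  (forall m, R m l -> g m = ext l rec m) /\ P l g.
pose body l (rec : forall m, R m l -> V) : V :=
  if pselect (exists g, good l rec g) is left H then sval (cid H) l else v0.
pose f := Fix wf (fun=> V) body.
have fE l : f l = body l (fun m _ => f m).
  rewrite /f Fix_eq // => x u v Huv; congr body.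
  by apply/functional_extensionality_dep => m; apply/functional_extensionality_dep => H; exact: Huv.
have irr x : ~ R x x.
  by elim/(well_founded_ind wf): x => x IH Hx; exact: (IH x Hx Hx).
exists f; elim/(well_founded_ind wf) => l IH.
pose rec m (_ : R m l) := f m.
have extE m : R m l -> ext l rec m = f m by rewrite /ext; case: pselect.
have ex : exists g, good l rec g.
  have [g [Hg Pg]] := step l f IH; exists g; split=> // m Hm.
  by rewrite Hg // extE.
have : exists g, good l rec g /\ f l = g l.
  rewrite fE /body; case: pselect => // H; case: (cid H) => g Hg /=.
  by exists g.
move=> [g [[Hg Pg] E]]; apply: loc Pg => m [->//|Hm].
by rewrite Hg // extE.
Qed.

(** * Countable sets and clubs in omega_1 *)

Section Omega1.
Variables (W : Type) (R : W -> W -> Prop).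
Hypothesis W1 : omega1_order R.

Lemma o1_wf : well_founded R. Proof. by case: W1. Qed.
Lemma o1_trans x y z : R x y -> R y z -> R x z.
Proof. by case: W1 => _ H _ _ _; exact: H. Qed.
Lemma o1_total x y : R x y \/ x = y \/ R y x.
Proof. by case: W1 => _ _ H _ _; exact: H. Qed.
Lemma o1_unc : ~ countable [set: W]. Proof. by case: W1. Qed.
Lemma o1_below x : countable (below R x).
Proof. by case: W1 => _ _ _ _; apply. Qed.
Lemma o1_irr x : ~ R x x.
Proof. by elim/(well_founded_ind o1_wf): x => x IH Hx; exact: (IH x Hx Hx). Qed.

Lemma countable_bounded (S : set W) : countable S -> exists b, forall s, S s -> R s b.
Proof.
move=> cS; apply: contrapT => /forallNP N; apply: o1_unc.
apply: (@sub_countable _ _ _ (\bigcup_(s in S) (below R s `|` [set s]))).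
  apply: subset_card_le => w _; have /existsNP [s /not_implyP [Ss ns]] := N w.
  exists s => //; case: (o1_total w s) => [H|[->|H]]; [by left|by right|by []].
apply: bigcup_countable => // s _.
apply: (@sub_countable _ _ _ (\bigcup_(b in [set: bool]) if b then below R s else [set s])).
  by apply: subset_card_le => w [Hw|Hw]; [exists true|exists false].
by apply: bigcup_countable => // -[] _; [exact: o1_below|exact: countable1].
Qed.

(** A supply of fresh labels: iterate a strictly increasing step from a bound of [S]. *)
Lemma countable_avoid (S : set W) : countable S ->
  exists j : nat -> W, injective j /\ forall n, ~ S (j n).
Proof.
move=> /countable_bounded [b Hb].
have /choice [nxt Hnxt] : forall u, exists b, R u b.
  by move=> u; have [c Hc] := countable_bounded (countable1 u); exists c; apply: Hc.
pose j n := iter n nxt b.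
have jlt m n : m < n -> R (j m) (j n).
  elim: n => // n IH; rewrite ltnS leq_eqVlt => /orP [/eqP ->|/IH H]; first exact: Hnxt.
  exact: o1_trans H (Hnxt _).
exists j; split=> [m n E|n /Hb H].
  by case: (ltngtP m n) => // /jlt; rewrite E => /o1_irr.
case: n H => [|n] H; first exact: (o1_irr H).
exact: (o1_irr (o1_trans H (jlt 0 n.+1 isT))).
Qed.

Lemma o1_min (P : W -> Prop) : (exists x, P x) -> exists x, P x /\ forall y, R y x -> ~ P y.
Proof.
move=> [x Px]; apply: contrapT => N.
suff : forall x, ~ P x by move/(_ x).
elim/(well_founded_ind o1_wf) => y IH Py; apply: N; exists y; split=> // z; exact: IH.
Qed.

(** The points closed under an operation with countable values. For unboundedness, [nxt u] bounds
    the values of [T] at all points up to [u], and the least strict upper bound of its iterates is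
    closed. *)
Lemma closure_club (T : W -> set W) w0 : (forall w, countable (T w)) ->
  let C := [set d | R w0 d /\ forall w v, R w d -> T w v -> R v d] in
  closed_in R C /\ unbounded_in R C.
Proof.
move=> cT C; split.
  move=> d [x0 x0d] lim; split.
    by have [y [[Hy _] _ yd]] := lim x0 x0d; exact: o1_trans Hy yd.
  move=> w v wd Tv; have [y [[_ Hy] wy yd]] := lim w wd.
  exact: o1_trans (Hy w v wy Tv) yd.
move=> x.
have /choice [nxt Hnxt] : forall u, exists b, R u b /\ forall w v, R w u \/ w = u -> T w v -> R v b.
  move=> u; have [|b Hb] := @countable_bounded
     ([set u] `|` \bigcup_(w in below R u `|` [set u]) T w).
    apply: (@sub_countable _ _ _ (\bigcup_(b in [set: bool]) if b then [set u] else
       \bigcup_(w in below R u `|` [set u]) T w)).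
      by apply: subset_card_le => w [Hw|Hw]; [exists true|exists false].
    apply: bigcup_countable => // -[] _; first exact: countable1.
    apply: bigcup_countable => //.
    apply: (@sub_countable _ _ _ (\bigcup_(b in [set: bool]) if b then below R u else [set u])).
      by apply: subset_card_le => w [Hw|Hw]; [exists true|exists false].
    by apply: bigcup_countable => // -[] _; [exact: o1_below|exact: countable1].
  exists b; split; first by apply: Hb; left.
  by move=> w v Hw Tv; apply: Hb; right; exists w.
have [b0 Hb0] : exists b, R x b /\ R w0 b.
  have [b Hb] := @countable_bounded ([set x; w0]) (finite_set_countable (finite_set2 _ _)).
  by exists b; split; [apply: Hb; left|apply: Hb; right].
pose s n := iter n nxt b0.
have [|d [Hd Hmin]] := @o1_min (fun d => forall n, R (s n) d).
  have [b Hb] := @countable_bounded (range s) (card_image_le _ _).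
  by exists b => n; apply: Hb; exists n.
exists d; have s0 := Hd 0; split; last exact: o1_trans (Hb0.1) s0.
split; first exact: o1_trans Hb0.2 s0.
move=> w v wd Tv; have /existsNP [n Hn] := Hmin w wd.
apply: o1_trans (Hd n.+1); rewrite /s iterS -/(s n).
apply: (Hnxt (s n)).2 Tv.
by case: (o1_total w (s n)) => [H|[->|H]]; [left|right|].
Qed.

End Omega1.

Lemma kle_refl (K : structure) (x : K) : PA_model K -> kle x x.
Proof. by move=> hK; klra. Qed.

(** * Construction of the chain guided by diamond *)

Section Chain.
Variables (W : Type) (R : W -> W -> Prop).
Hypothesis W1 : omega1_order R.
Local Notation lstr := (lstr W).

(** A cut is a pair of sets of labels, so that it has a meaning in all later models. *)
Definition lomits (K : lstr) (c : set W * set W) :=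
  (exists u : K, c.2 (lab u)) /\
  forall z : K, (exists l, c.1 (lab l) /\ kle z l) \/ (exists u, c.2 (lab u) /\ kle u z).

(* [S] is the set of labels guessed by diamond at the stage that extends [U]. *)
Definition killable (U : lstr) (S : set W) (a : U) (F : U -> U) :=
  [/\ (forall x y, lt x y -> kle y a -> lt (F x) (F y)), F (zero U) = zero U,
      nonstd a, lt a (F a) /\ ~ E3 a (F a) &
      forall w, S w <-> exists x, kle x a /\ w = lab (pr x (F x))].

(** The cut [c] is the preimage under [F] of the position of a new element [y]. As long as it is
    omitted, no increasing extension of [F] to [[0, a]] takes the value [y]. *)
Definition kill_spec (U K : lstr) (i : U -> K) (c : set W * set W) (a : U) (F : U -> U) :=
  exists y : K, lt y (i (F a)) /\ forall w,
    (c.1 w <-> exists x, [/\ kle x a, lt (i (F x)) y & w = lab x]) /\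
    (c.2 w <-> exists x, [/\ kle x a, lt y (i (F x)) & w = lab x]).

(** The guess is only a set of labels. Injectivity of labels and of pairing recovers [a] and [F] on
    [[0, a]] from it, so one extension serves all [F] that match the guess. *)
Lemma killable_uniq (U : lstr) S a F a' F' : PA_model U -> injective (@lab W U) ->
  @killable U S a F -> killable S a' F' -> a = a' /\ forall x, kle x a -> F x = F' x.
Proof.
move=> hU inj [_ _ _ _ H] [_ _ _ _ H'].
have sub b G b' G' : (forall w, S w <-> exists x : U, kle x b /\ w = lab (pr x (G x))) ->
    (forall w, S w <-> exists x : U, kle x b' /\ w = lab (pr x (G' x))) ->
    forall x, kle x b -> kle x b' /\ G x = G' x.
  move=> H1 H2 x xb; have /H2 [x' [xb' E]] : S (lab (pr x (G x))).
    by apply/H1; exists x.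
  by have [-> ->] := pr_inj hU (inj _ _ E).
split; last by move=> x /(sub _ _ _ _ H H') [].
have aa := kle_refl a hU; have aa' := kle_refl a' hU.
have [H1 _] := sub _ _ _ _ H H' a aa; have [H2 _] := sub _ _ _ _ H' H a' aa'.
by klra.
Qed.

Lemma relabel (U : lstr) (K : structure) (h : U -> K) : countable [set: U] ->
  countable [set: K] -> injective (@lab W U) -> injective h ->
  exists l : K -> W, injective l /\ forall x, l (h x) = lab x.
Proof.
move=> cU cK inj hI.
have [j [jI jS]] := countable_avoid W1 (sub_countable (card_image_le (@lab W U) setT) cU).
have /countable_injP [f fI] := cK.
pose l k := if pselect (exists x, h x = k) is left H then lab (sval (cid H)) else j (f k).
have lh x : l (h x) = lab x.
  rewrite /l; case: pselect => [H|[]]; last by exists x.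
  by case: (cid H) => y /= /hI ->.
have ln k : (~ exists x, h x = k) -> l k = j (f k) by rewrite /l; case: pselect.
exists l; split=> // k k' E.
case: (pselect (exists x, h x = k)) => Hk; case: (pselect (exists x, h x = k')) => Hk'.
- by case: Hk Hk' => x Ex [x' Ex']; move: E; rewrite -Ex -Ex' !lh => /inj ->.
- case: Hk => x Ex; move: E; rewrite -Ex lh (ln k') // => E.
  by case: (jS (f k')); rewrite -E; exists x.
- case: Hk' => x Ex; move: E; rewrite -Ex lh (ln k) // => E.
  by case: (jS (f k)); rewrite E; exists x.
- by move: E; rewrite !ln // => /jI /fI; apply; rewrite inE.
Qed.

Lemma labelled_step (U : lstr) (cuts : nat -> set W * set W) (S : set W) :
  PA_model U -> countable [set: U] -> injective (@lab W U) ->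
  (forall n, lomits U (cuts n)) ->
  exists (K : lstr) (i : U -> K) (c : set W * set W),
  [/\ PA_model K, countable [set: K], injective (@lab W K), lemb i &
   [/\ (exists y : K, forall k, y <> i k), (forall n, lomits K (cuts n)), lomits K c &
       forall a F, @killable U S a F -> kill_spec i c a F]].
Proof.
move=> hU cU inj om.
pose cutU n : (U -> Prop) * (U -> Prop) :=
  (fun x => (cuts n).1 (lab x), fun x => (cuts n).2 (lab x)).
have omU n : omits (cutU n).1 (cutU n).2 by case: (om n).
have neU n : exists u, (cutU n).2 u by case: (om n).
have lift (K : structure) (h : U -> K) (l : K -> W) : (forall x, l (h x) = lab x) ->
    good_extension cutU h -> forall n, lomits (LStr l) (cuts n).
  move=> lh [_ _ _ H] n; split; first by have [u Hu] := neU n; exists (h u); rewrite /= lh.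
  by move=> z; case: (H n z) => [[x [Hx zx]]|[x [Hx zx]]]; [left|right];
    exists (h x); rewrite /= lh.
case: (pselect (exists a F, @killable U S a F)) => [[a [F kaF]]|N].
  have [Fm F0 Ha [aF NE] HS] := kaF.
  have [K [h [Kg [y [yF ynew Hcut]]]]] := killing_extension hU cU neU omU Fm F0 Ha aF NE.
  have [hK cK hel _] := Kg.
  have [l [lI lh]] := relabel cU cK inj (emb_inj hel).
  exists (LStr l), h, ([set w | exists x, [/\ kle x a, lt (h (F x)) y & w = lab x]],
    [set w | exists x, [/\ kle x a, lt y (h (F x)) & w = lab x]]); split=> //.
  split; [by exists y|exact: lift| |].
  - split; first by exists (h a); rewrite /= lh; exists a; split=> //; exact: kle_refl.
    move=> z; have [x [xa [[zx xy]|[xz yx]]]] := Hcut z; [left|right];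
      by exists (h x); split=> //=; rewrite lh; exists x.
  - move=> a' F' k'; have [E EF] := killable_uniq hU inj kaF k'; subst a'.
    have aa := kle_refl a hU.
    exists y; split; first by rewrite -EF.
    move=> w; split; split=> -[x [xa xy ->]]; exists x; split=> //; move: xy;
      by rewrite EF.
have [K [h [Kg [y ynew]]]] := proper_extension hU cU neU omU.
have [hK cK hel _] := Kg.
have [l [lI lh]] := relabel cU cK inj (emb_inj hel).
(* With nothing to kill, the extension is merely proper, and the recorded cut is the trivial one
   with 0 in its upper part, which every model omits. *)
exists (LStr l), h, (set0, [set lab (zero U)]); split=> //.
split; [by exists y|exact: lift| |].
- split; first by exists (h (zero U)); rewrite /= lh.
  move=> z; right; exists (h (zero U)); split; first by rewrite /= lh.
  by rewrite (emb_zero hel); exact: kge0.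
- by move=> a F k; case: N; exists a, F.
Qed.

Lemma lomits_emb (A B : lstr) (i : A -> B) c : PA_model A -> PA_model B -> lemb i ->
  forall z : A, ((exists l, c.1 (lab l) /\ kle z l) \/ (exists u, c.2 (lab u) /\ kle u z)) ->
  ((exists l, c.1 (lab l) /\ kle (i z) l) \/ (exists u : B, c.2 (lab u) /\ kle u (i z))).
Proof.
move=> hA hB [Hi Li] z [[x [Hx zx]]|[x [Hx zx]]]; [left|right]; exists (i x);
  by rewrite Li -(emb_kle Hi).
Qed.

Variable base : lstr.
Hypothesis base_PA : PA_model base.
Hypothesis base_countable : countable [set: base].
Hypothesis base_inj : injective (@lab W base).
Variable Adia : W -> set W.

Local Notation V := (lstr * (set W * set W))%type.

Definition fam (f : W -> V) (P : W -> Prop) (A : lstr) :=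
  A = base \/ exists m, P m /\ A = (f m).1.

(** Refers to [f] only up to [l], as recursion requires. The cut recorded at stage [l] is omitted by
    the model of that stage too. *)
Definition chain_ok (l : W) (f : W -> V) :=
  [/\ PA_model (f l).1, countable [set: (f l).1], injective (@lab W (f l).1),
      (forall m, m = l \/ R m l -> lomits (f l).1 (f m).2) &
      exists (U : lstr) (i : U -> (f l).1),
        [/\ is_union (fam f (fun m => R m l)) U, lemb i,
            (exists y, forall k, y <> i k) &
            forall a F, @killable U (Adia l) a F -> kill_spec i (f l).2 a F]].

Section ChainFacts.
Variables (f : W -> V) (P : W -> Prop).
Hypothesis f_ok : forall m, P m -> chain_ok m f.

Lemma chain_base m : P m -> emb base (f m).1.
Proof.
move=> /f_ok [_ _ _ _ [U [i [HU Hi _ _]]]].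
by apply: emb_trans (union_emb HU (or_introl erefl)) _; exists i.
Qed.

Lemma chain_emb m l : R m l -> P l -> emb (f m).1 (f l).1.
Proof.
move=> ml /f_ok [_ _ _ _ [U [i [HU Hi _ _]]]].
by apply: emb_trans (union_emb HU (or_intror _)) _; [exists m|exists i].
Qed.

Lemma fam_directed : directed (fam f P).
Proof.
move=> A B [->|[m [Pm ->]]] [->|[n [Pn ->]]].
- by exists base; split; [left|exact: emb_refl|exact: emb_refl].
- by exists (f n).1; split; [right; exists n|exact: chain_base|exact: emb_refl].
- by exists (f m).1; split; [right; exists m|exact: emb_refl|exact: chain_base].
case: (o1_total W1 m n) => [mn|[->|nm]].
- by exists (f n).1; split; [right; exists n|exact: chain_emb|exact: emb_refl].
- by exists (f n).1; split; [right; exists n|exact: emb_refl|exact: emb_refl].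
- by exists (f m).1; split; [right; exists m|exact: emb_refl|exact: chain_emb].
Qed.

Lemma fam_PA A : fam f P A -> PA_model A.
Proof. by case=> [->//|[m [/f_ok [H _ _ _ _] ->]]]. Qed.

Lemma fam_inj A : fam f P A -> injective (@lab W A).
Proof. by case=> [->//|[m [/f_ok [_ _ H _ _] ->]]]. Qed.

Lemma fam_union_exists : exists U, is_union (fam f P) U.
Proof.
exact: union_exists (or_introl erefl : fam f P base) fam_inj fam_directed.
Qed.

Lemma fam_union_PA U : is_union (fam f P) U -> PA_model U.
Proof.
move=> HU; apply: union_PA HU fam_directed _ fam_PA.
by exists base; left.
Qed.

Lemma fam_union_lomits U m : is_union (fam f P) U -> P m -> lomits U (f m).2.
Proof.
move=> HU Pm; have hU := fam_union_PA HU.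
have Fm : fam f P (f m).1 by right; exists m.
split.
  have [_ _ _ /(_ m (or_introl erefl)) [[u Hu] _] _] := f_ok Pm.
  by have [i [Hi Li]] := union_emb HU Fm; exists (i u); rewrite Li.
move=> z; have [B [FB [y Ey]]] := union_cover HU z.
(* [z] occurs at some stage, and stage [m] contains everything from the base and from stages before
   it; hence [z] occurs at a stage from [m] on, where the cut of [m] is omitted. *)
have [n [Pn mn [y' Ey']]] : exists n, [/\ P n, m = n \/ R m n & exists y : (f n).1, lab y = lab z].
  case: FB y Ey => [->|[n [Pn ->]]] y Ey.
    have [j [_ Lj]] := chain_base Pm; exists m; split=> //; first by left.
    by exists (j y); rewrite Lj.
  case: (o1_total W1 m n) => [mn|[E|nm]].
  - by exists n; split=> //; [right|exists y].
  - by exists n; split=> //; [left|exists y].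
  - have [j [_ Lj]] := chain_emb nm Pm; exists m; split=> //; first by left.
    by exists (j y); rewrite Lj.
have [hn _ _ /(_ m mn) [_ om] _] := f_ok Pn.
have [j Hj] : emb (f n).1 U by apply: (union_emb HU); right; exists n.
have <- : j y' = z by apply: (union_inj HU); rewrite Hj.2.
exact: (lomits_emb hn hU Hj (om y')).
Qed.

Lemma fam_union_countable U : is_union (fam f P) U -> countable P -> countable [set: U].
Proof.
move=> HU cP.
pose S := \bigcup_(o in [set o : option W | if o is Some m then P m else True])
  (if o is Some m then range (@lab W (f m).1) else range (@lab W base)).
have cS : countable S.
  apply: bigcup_countable.
    apply: (@sub_countable _ _ _ (\bigcup_(b in [set: bool]) if b then Some @` P else [set None])).
      by apply: subset_card_le => -[m Pm|_]; [exists true => //; exists m|exists false].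
    apply: bigcup_countable => // -[] _; last exact: countable1.
    exact: sub_countable (card_image_le _ _) cP.
  move=> [m|] Hm; apply: sub_countable (card_image_le _ _) _.
    by have [_ H _ _ _] := f_ok Hm.
  exact: base_countable.
have /countable_injP [g gI] := cS.
apply/countable_injP; exists (g \o @lab W U) => x y _ _ /= E.
have inS (z : U) : lab z \in S.
  rewrite inE; have [A [[->|[m [Pm ->]]] [w Ew]]] := union_cover HU z.
    by exists None => //; exists w.
  by exists (Some m) => //; exists w.
by apply: (union_inj HU); apply: gI E.
Qed.

End ChainFacts.

Lemma fam_ext f g P : (forall m, P m -> f m = g m) -> fam f P = fam g P.
Proof.
move=> H; apply/funext => A; apply/propext.
by split=> -[->|[m [Pm ->]]]; try (by left); right; exists m; rewrite ?H // -H.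
Qed.

Lemma chain_ok_local l f g : (forall m, m = l \/ R m l -> f m = g m) ->
  chain_ok l f -> chain_ok l g.
Proof.
move=> H; rewrite /chain_ok (fam_ext (g := g)); last by move=> m Hm; apply: H; right.
rewrite (H l) ?eqxx; last by left.
move=> [? ? ? om HU]; split=> // m Hm; rewrite -(H m Hm); exact: om.
Qed.

Lemma chain_exists : exists f, forall l, chain_ok l f.
Proof.
have irr := o1_irr W1.
apply: (@wf_choice W R V chain_ok (base, (set0, set0)) (o1_wf W1)).
- by move=> x y z; apply: o1_trans.
- by move=> l f g; apply: chain_ok_local.
move=> l f IH; pose P m := R m l.
have ok m : P m -> chain_ok m f := IH m.
have [U HU] := fam_union_exists ok.
have hU := fam_union_PA ok HU.
have cU := fam_union_countable ok HU (o1_below W1 l).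
have /countable_injP [code codeI] := o1_below W1 l.
(* Enumerates the countably many cuts recorded so far; a number that codes no earlier stage gets the
   trivial cut. *)
pose cuts n := if pselect (exists m, R m l /\ code m = n) is left H
  then (f (sval (cid H))).2 else (set0, [set lab (zero U)]).
have om n : lomits U (cuts n).
  rewrite /cuts; case: pselect => [H|_].
    by case: (cid H) => m [ml _] /=; exact: (fam_union_lomits ok HU).
  split; first by exists (zero U).
  by move=> z; right; exists (zero U); split=> //; exact: kge0.
have cutsE m : R m l -> cuts (code m) = (f m).2.
  move=> ml; rewrite /cuts; case: pselect => [H|[]]; last by exists m.
  by case: (cid H) => m' [m'l /codeI E] /=; rewrite E // inE.
have [K [i [c [hK cK injK Hi [newy omK omc Hkill]]]]] :=
  labelled_step (Adia l) hU cU (union_inj HU) om.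
pose g m := if pselect (m = l) then (K, c) else f m.
have gl : g l = (K, c) by rewrite /g; case: pselect.
have gm m : R m l -> g m = f m.
  by rewrite /g; case: pselect => //= E; rewrite {1}E => /irr.
exists g; split=> //; rewrite /chain_ok gl; split=> //=.
  move=> m [->|ml]; first by rewrite gl.
  by rewrite gm // -cutsE.
exists U, i; split=> //.
by rewrite (fam_ext (g := f)).
Qed.

End Chain.

(** * The limit model *)

Lemma countableU2 (T : Type) (A B : set T) :
  countable A -> countable B -> countable (A `|` B).
Proof.
move=> cA cB; apply: (@sub_countable _ _ _ (\bigcup_(b in [set: bool]) if b then A else B)).
  by apply: subset_card_le => w [Hw|Hw]; [exists true|exists false].
by apply: bigcup_countable => // -[].
Qed.

Lemma klt_nle (K : structure) (x y : K) : PA_model K -> lt x y -> kle y x -> False.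
Proof. by move=> hK H1 H2; klra. Qed.

Lemma klt_le (K : structure) (x y : K) : PA_model K -> lt x y -> kle x y.
Proof. by move=> hK H; klra. Qed.

Lemma E3_sym (K : structure) (a b : K) : E3 a b -> E3 b a.
Proof. by move=> [c [H1 [H2 H3]]]; exists c; split=> // n; have [] := H1 n. Qed.

Lemma E3_refl (K : structure) (a : K) : PA_model K -> nonstd a -> E3 a a.
Proof.
move=> hK Ha; exists (numeral K 2).
have H n : power (numeral K 2) n = numeral K (2 ^ n).
  elim: n => [|n IH]; first by rewrite expn0 /= (kadd0l hK).
  by rewrite expnSr (numeralM hK) -IH.
split; first by move=> n; rewrite H; split; exact: Ha.
by have := Ha 0 => /= ?; split; klra.
Qed.

Lemma order_iso_sym (K : structure) (a b : K) f :
  order_iso (below (@lt K) a) (below (@lt K) b) f ->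
  exists g, order_iso (below (@lt K) b) (below (@lt K) a) g.
Proof.
move=> [[ff fi fs] fl].
have /choice [g Hg] : forall y, exists x, lt y b -> lt x a /\ f x = y.
  move=> y; case: (pselect (lt y b)) => yb; last by exists y.
  by have [x xa xy] := fs y yb; exists x.
exists g; split; first split.
- by move=> y /= /Hg [].
- move=> y y'; rewrite !inE => /= /Hg [_ E] /Hg [_ E'] H.
  by rewrite -E -E' H.
- move=> x /= xa; exists (f x); first exact: ff.
  have [H1 H2] := Hg (f x) (ff _ xa).
  by apply: fi; rewrite ?inE.
- by move=> y y' /Hg [H1 E1] /Hg [H2 E2]; rewrite (fl (g y) (g y')) ?E1 ?E2.
Qed.

Lemma E5_order_iso (K : structure) (a b : K) : E5 a b ->
  exists f, order_iso (below (@lt K) a) (below (@lt K) b) f.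
Proof.
move=> [f [[[_ fi fs] fl] E]]; exists f; split; first split.
- by move=> x /= xa; rewrite /below /= -E -fl.
- by move=> x y _ _; apply: fi; rewrite inE.
- move=> y /= yb; have [x _ xy] := fs y I; exists x => //.
  by rewrite /below /= fl // E xy.
- by move=> x y _ _; apply: fl.
Qed.

(** * Cardinality and rigidity of the union *)

Section Rigid.
Variables (W : Type) (R : W -> W -> Prop) (Adia : W -> set W).
Hypothesis W1 : omega1_order R.
Hypothesis guess : forall X : set W, stationary R [set d | X `&` below R d = Adia d].
Variable base : lstr W.
Variable f : W -> lstr W * (set W * set W).
Hypothesis base_PA : PA_model base.
Hypothesis base_inj : injective (@lab W base).
Hypothesis f_ok : forall l, chain_ok R base Adia l f.
Variable N : lstr W.
Hypothesis NU : is_union (fam base f (fun=> True)) N.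

Let ok m : True -> chain_ok R base Adia m f := fun _ => f_ok m.

Lemma limit_PA : PA_model N.
Proof. exact: (fam_union_PA W1 base_PA ok NU). Qed.

(** Each stage has a label that occurs at no earlier stage, which injects [W] into [N]. *)
Lemma limit_uncountable : ~ countable [set: N].
Proof.
move=> cN; apply: (o1_unc W1).
have /choice [w Hw] : forall l, exists w, (exists y : (f l).1, lab y = w) /\
    forall m, R m l -> ~ exists x : (f m).1, lab x = w.
  move=> l; have [_ _ inj _ [U [i [HU Hi [y ynew] _]]]] := f_ok l.
  exists (lab y); split; first by exists y.
  move=> m ml [x Ex].
  have [j Hj] : emb (f m).1 U by apply: (union_emb HU); right; exists m.
  by apply: (ynew (j x)); apply: inj; rewrite Hi.2 Hj.2 Ex.
have wI l l' : w l = w l' -> l = l'.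
  move=> E; have [H1 H2] := Hw l; have [H1' H2'] := Hw l'.
  case: (o1_total W1 l l') => [H|[//|H]].
    by case: (H2' l H); rewrite -E.
  by case: (H2 l' H); rewrite E.
have /choice [n Hn] : forall l, exists x : N, lab x = w l.
  move=> l; have [[y Ey] _] := Hw l.
  have [j Hj] : emb (f l).1 N by apply: (union_emb NU); right; exists l.
  by exists (j y); rewrite Hj.2.
have /countable_injP [g gI] := cN.
apply/countable_injP; exists (g \o n) => l l' _ _ /= /gI E.
by apply: wI; rewrite -!Hn E // inE.
Qed.

(** [N] itself, ordered by its labels, is an order of type omega_1: well-foundedness and countable
    initial segments are inherited from [W]. *)
Lemma limit_aleph1 : card_aleph1 N.
Proof.
exists N, (fun x y => R (lab x) (lab y)); split; last exact: card_eqxx.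
split.
- move=> x; move Ew: (lab x) => w.
  elim/(well_founded_ind (o1_wf W1)): w x Ew => w IH x Ew.
  by constructor=> y Ry; apply: (IH (lab y)) => //; rewrite -Ew.
- by move=> x y z; apply: o1_trans.
- move=> x y; case: (o1_total W1 (lab x) (lab y)) => [H|[/(union_inj NU) H|H]].
  + by left.
  + by right; left.
  + by right; right.
- exact: limit_uncountable.
- move=> x; have /countable_injP [g gI] := o1_below W1 (lab x).
  apply/countable_injP; exists (g \o @lab W N) => y z; rewrite !inE => yx zx /= E.
  by apply: (union_inj NU); apply: gI E; rewrite inE.
Qed.

Lemma limit_stage (x : N) : exists m, exists y : (f m).1, lab y = lab x.
Proof.
have [A [[->|[m [_ ->]]] [y Ey]]] := union_cover NU x; last by exists m, y.
have [j Hj] := chain_base ok (I : (fun=> True) (lab x)).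
by exists (lab x), (j y); rewrite Hj.2.
Qed.

(** At some closure point [d], diamond guesses the part of the isomorphism that lives on the union
    of the earlier stages. Stage [d] then adds some y < b whose cut is omitted in [N], whereas the
    preimage of [y] would fill it. *)
Lemma limit_rigid_lt (a b : N) g : nonstd a -> lt a b ->
  order_iso (below (@lt N) a) (below (@lt N) b) g -> E3 a b.
Proof.
move=> Ha ab [[gfun ginj gsurj] gl]; apply: contrapT => NE; have hN := limit_PA.
(* The value at [a] is added, so that the function lives on the closed interval [[0, a]] and
   satisfies F a = b. *)
pose F x := if pselect (x = a) then b else g x.
have Fa : F a = b by rewrite /F; case: pselect.
have Flt x : lt x a -> F x = g x.
  by rewrite /F; case: pselect => //= E; rewrite {1}E => H; exfalso; klra.
have Fm x y : lt x y -> kle y a -> lt (F x) (F y).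
  move=> xy ya; have xa : lt x a by klra.
  rewrite (Flt x) //; case: (pselect (y = a)) => [->|E].
    by rewrite Fa; exact: gfun.
  have ya' : lt y a by apply: contrapT => H; apply: E; klra.
  by rewrite (Flt y) // -gl.
have a0 : lt (zero N) a := Ha 0.
have F0 : F (zero N) = zero N.
  have [x xa E] : (g @` below (@lt N) a) (zero N) by apply: gsurj; rewrite /below /=; klra.
  case: (pselect (x = zero N)) => [Ex|N0]; first by rewrite -{1}Ex Flt.
  have x0 : lt (zero N) x by apply: contrapT => H; apply: N0; klra.
  have xa' : kle x a by rewrite /below /= in xa; klra.
  have := Fm _ _ x0 xa'; rewrite (Flt x) // E => H; case: (klt_nle hN H (kge0 hN _)).
pose X : set W := [set w | exists x, kle x a /\ w = lab (pr x (F x))].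
have [st Hst] := choice limit_stage.
have /choice [inv Hinv] : forall w, exists x : N, (exists x' : N, lab x' = w) -> lab x = w.
  by move=> w; case: (pselect (exists x' : N, lab x' = w)) => [[x Hx]|?]; [exists x|exists a].
have invE x : inv (lab x) = x.
  by apply: (union_inj NU); apply: Hinv; exists x.
have /choice [fst Hfst] : forall z : N, exists x, (exists x', z = pr x' (F x')) -> z = pr x (F x).
  by move=> z; case: (pselect (exists x', z = pr x' (F x'))) => [[x Hx]|?]; [exists x|exists a].
have fstE x : fst (pr x (F x)) = x.
  have /(pr_inj hN) [E _] : pr x (F x) = pr (fst (pr x (F x))) (F (fst (pr x (F x)))).
    by apply: Hfst; exists x.
  by rewrite -E.
(* If [d] is closed under [T], the labels below [d] that occur in [N] are exactly those of the union
   of the stages below [d], and this union is closed under [F] and under the first projection of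
   coded pairs. *)
pose T w : set W := range (@lab W (f w).1) `|` ([set st (inv w)] `|`
  ([set lab (F (inv w))] `|` [set lab (fst (inv w))])).
have cT w : countable (T w).
  apply: countableU2; last by do !(apply: countableU2); exact: countable1.
  by have [_ cf _ _ _] := f_ok w; exact: sub_countable (card_image_le _ _) cf.
have [Ccl Cub] := closure_club W1 (lab a) cT.
have [d [dX [ad dT]]] := guess X Ccl Cub.
have [hd _ injd _ [U [i [HU Hi _ Hkill]]]] := f_ok d.
have Fd : fam base f (fun=> True) (f d).1 by right; exists d.
have [j Hj] := union_emb NU Fd.
pose k := j \o i; have Hk : lemb k := lemb_comp Hi Hj.
have hU : PA_model U := fam_union_PA W1 base_PA (fun m _ => f_ok m) HU.
have inU' x : R (lab x) d -> exists u, k u = x.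
  move=> xd; have [y Ey] := Hst x.
  have sd : R (st x) d by apply: (dT (lab x)) => //; right; left; rewrite invE.
  have [l Hl] : emb (f (st x)).1 U by apply: (union_emb HU); right; exists (st x).
  by exists (l y); apply: (union_inj NU); rewrite Hk.2 Hl.2.
have Uin (u : U) : R (lab u) d.
  have [A [[->|[m [md ->]]] [y Ey]]] := union_cover HU u; last first.
    by apply: (dT m) => //; left; exists y.
  (* The labels of the base occur at stage [lab a], which is below [d]. *)
  have [l Hl] := chain_base ok (I : (fun=> True) (lab a)).
  by apply: (dT (lab a)) => //; left; exists (l y) => //; rewrite Hl.2.
have [a' Ea'] := inU' a ad.
have /choice [F' HF'] : forall u, exists v, k v = F (k u).
  move=> u; apply: inU'; apply: (dT (lab u)); first exact: Uin.
  by right; right; left; rewrite -(Hk.2 u) invE.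
have kI := emb_inj Hk.1; have klt := emb_lt Hk.1.
have kkle x y : kle x y <-> kle (k x) (k y) := emb_kle Hk.1 x y hU hN.
have [|y [yF Hy]] := Hkill a' F'.
  split.
  - by move=> x y xy ya; rewrite klt !HF'; apply: Fm; rewrite -?klt // -Ea' -kkle.
  - by apply: kI; rewrite HF' (emb_zero Hk.1).
  - by apply: (emb_nonstd Hk.1); rewrite Ea'.
  - split; first by rewrite klt HF' Ea' Fa.
    by move=> /(emb_E3 Hk.1); rewrite HF' Ea' Fa.
  - move=> w; rewrite -dX; split=> [[[x [xa Ew]] wd]|[x [xa ->]]].
      (* A pair whose label is below [d] has its first component in [U], by the last clause of
         [T]. *)
      have [u Eu] : exists u, k u = x.
        apply: inU'; apply: (dT w) => //; right; right; right.
        by rewrite Ew invE fstE.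
      exists u; split; first by rewrite kkle Eu Ea'.
      by rewrite Ew -(Hk.2 (pr u (F' u))) (emb_pr Hk.1) HF' Eu.
    split; last exact: Uin.
    exists (k x); split; first by rewrite -Ea' -kkle.
    by rewrite -(Hk.2 (pr x (F' x))) (emb_pr Hk.1) HF'.
have [_ om] := fam_union_lomits W1 base_PA ok NU (I : (fun=> True) d).
have yb : lt (j y) b by rewrite -Fa -Ea' -HF' -(emb_lt Hj.1).
have [x xa Ex] : (g @` below (@lt N) a) (j y) by apply: gsurj.
have {}Ex : F x = j y by rewrite Flt.
have Fle x1 x2 : kle x1 x2 -> kle x2 a -> kle (F x1) (F x2) := @Fmono_le N hN F a Fm x1 x2.
rewrite /below /= in xa.
(* Omission puts [x] on one side of the cut, and monotonicity puts [F x] strictly on the same side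
   of [y], against F x = y. *)
case: (om x) => [[l [/(Hy (lab l)).1 [u [ua uy El]] xl]]|[l [/(Hy (lab l)).2 [u [ua uy El]] xl]]].
  have El' : l = k u by apply: (union_inj NU); rewrite Hk.2.
  have H1 : kle (F x) (F l) by apply: Fle => //; rewrite El' -Ea' -kkle.
  have H2 : lt (F l) (j y) by rewrite El' -HF' -(emb_lt Hj.1).
  by rewrite Ex in H1; exact: (klt_nle hN H2 H1).
have El' : l = k u by apply: (union_inj NU); rewrite Hk.2.
have H1 : kle (F l) (F x) by apply: Fle => //; exact: (klt_le hN xa).
have H2 : lt (j y) (F l) by rewrite El' -HF' -(emb_lt Hj.1).
by rewrite Ex in H1; exact: (klt_nle hN H2 H1).
Qed.

Lemma limit_rigid : order_rigid3 N.
Proof.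
have hN := limit_PA.
move=> a b /(nonstdP hN) Ha /(nonstdP hN) Hb [g Hg].
case: (pselect (a = b)) => [<-|E]; first exact: E3_refl.
case: (kle_or_lt hN a b) => H.
  by apply: limit_rigid_lt Hg => //; apply: contrapT => H'; apply: E; klra.
have [g' Hg'] := order_iso_sym Hg.
by apply: E3_sym; exact: limit_rigid_lt Hg'.
Qed.

End Rigid.

Theorem theorem3p9 (M : structure) :
  diamond_aleph1 ->
  PA_model M -> ordinary M -> countable [set: M] ->
  exists (N : structure) (h : M -> N),
    [/\ elementary_embedding h,
        PA_model N /\ ordinary N,
        card_aleph1 N,
        (forall a b : N, ~ standard a -> ~ standard b -> (E5 a b <-> E3 a b)) &
        order_rigid3 N].
Proof.
move=> [W [R [W1 [Adia [_ guess]]]]] hM _ cM.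
(* An injection of the natural numbers into [W], which provides labels for the countable model
   [M]. *)
have [j [jI _]] := countable_avoid W1 (@countable0 W).
have /countable_injP [c cI] := cM.
pose base := @LStr W M (j \o c).
have base_inj : injective (@lab W base).
  by move=> x y /= /jI /cI; apply; rewrite inE.
have [f f_ok] := chain_exists W1 (base := base) hM cM base_inj Adia.
have ok m : True -> chain_ok R base Adia m f := fun _ => f_ok m.
have [N NU] := fam_union_exists W1 base_inj ok.
have hN := limit_PA W1 (base := base) hM f_ok NU.
have rigid := limit_rigid W1 guess (base := base) hM f_ok NU.
have [h [hel _]] : emb base N by apply: (union_emb NU); left.
exists N, h; split=> //.
- by split=> //; exact: PA_ordinary.
- exact: (limit_aleph1 W1 f_ok NU).
- move=> a b Ha Hb; split=> [/E5_order_iso|]; first exact: rigid.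
  exact: E3_imp_E5.
Qed.
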